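(* Let $\alpha,x>0$ and $\mu\in\mathbb{R}$. Then $$W_{\mu,0}(x)+2\sum_{n=1}^{\infty}W_{\mu,i\alpha n}(x)=\frac{2^{-\mu}\sqrt{\pi x}}{\alpha}\left(D_{2\mu}\left(\sqrt{2x}\right)+2e^{\frac{x}{4}}\sum_{n=1}^{\infty}e^{-\frac{x}{4}\cosh\left(\frac{2\pi n}{\alpha}\right)}D_{2\mu}\left(\sqrt{2x}\cosh\left(\frac{\pi n}{\alpha}\right)\right)\right).$$
   Context: For $z>0$, Tricomi's function is $\Psi(a,c;z)=\frac{\Gamma(1-c)}{\Gamma(a-c+1)}\,{}_1F_1(a;c;z)+z^{1-c}\frac{\Gamma(c-1)}{\Gamma(a)}\,{}_1F_1(a-c+1;2-c;z)$ (for integer $c$ defined by continuity in $c$), where ${}_1F_1(a;c;z)=\sum_{k\ge 0}\frac{(a)_k}{(c)_k}\frac{z^k}{k!}$. The Whittaker function is $W_{\mu,\nu}(z)=e^{-z/2}z^{\nu+\frac12}\,\Psi\left(\tfrac12+\nu-\mu,\,2\nu+1;\,z\right)$; it is entire in $\mu$ and in $\nu$. The parabolic cylinder function is, for $z>0$, $D_{\mu}(z)=2^{\frac{\mu}{2}+\frac14}z^{-\frac12}W_{\frac{\mu}{2}+\frac14,\frac14}\left(\frac{z^2}{2}\right)$. *)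

(* Defs.v *)
From Stdlib Require Import Reals ZArith ClassicalEpsilon.
From Coquelicot Require Import Coquelicot.

Open Scope R_scope.
Open Scope C_scope.

(* Total limit and sum operators on C.  They are taken componentwise, hence
   are meaningful exactly when the complex sequence or series converges. *)
Definition CLim_seq (u : nat -> C) : C :=
  (real (Lim_seq (fun n => Re (u n))), real (Lim_seq (fun n => Im (u n)))).

Definition CSeries (u : nat -> C) : C :=
  (Series (fun n => Re (u n)), Series (fun n => Im (u n))).

Definition Cexp (z : C) : C :=
  ((exp (Re z) * cos (Im z))%R, (exp (Re z) * sin (Im z))%R).

(* Principal power, for a base t > 0. *)
Definition Rcpow (t : R) (s : C) : C := Cexp (s * RtoC (ln t)).

(* (a)_k = a (a+1) ... (a+k-1) *)
Fixpoint pochhammer (a : C) (k : nat) : C :=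
  match k with
  | O => 1
  | S k' => pochhammer a k' * (a + RtoC (INR k'))
  end.

(* The entire function 1/Gamma, by Gauss's product
   Gamma(z) = lim n! n^z / (z (z+1) ... (z+n)); it vanishes at the poles
   0, -1, -2, ... of Gamma. *)
Definition rGamma (z : C) : C :=
  CLim_seq (fun n =>
    pochhammer z (S n) / (RtoC (INR (fact n)) * Rcpow (INR n) z)).

Definition CGamma (z : C) : C := / rGamma z.

Definition hyp1F1 (a c z : C) : C :=
  CSeries (fun k =>
    pochhammer a k / pochhammer c k * (Cpow z k / RtoC (INR (fact k)))).

(* For c not an integer.  The quotients by Gamma are written with rGamma, so
   that they vanish where the denominator has a pole. *)
Definition tricomi_nonint (a c : C) (z : R) : C :=
  CGamma (1 - c) * rGamma (a - c + 1) * hyp1F1 a c (RtoC z)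
  + Rcpow z (1 - c) * (CGamma (c - 1) * rGamma a)
    * hyp1F1 (a - c + 1) (2 - c) (RtoC z).

(* C_lim is the limit at a point, the value at the point itself excluded. *)
Definition tricomi (a c : C) (z : R) : C :=
  if excluded_middle_informative (exists k : Z, c = RtoC (IZR k))
  then C_lim (fun c' => tricomi_nonint a c' z) c
  else tricomi_nonint a c z.

Definition whittakerW (mu nu : C) (z : R) : C :=
  RtoC (exp (- z / 2)) * Rcpow z (nu + / 2)
  * tricomi (/ 2 + nu - mu) (2 * nu + 1) z.

Definition parabolicD (mu : C) (z : R) : C :=
  Rcpow 2 (mu / 2 + / 4) * RtoC (Rpower z (- / 2))
  * whittakerW (mu / 2 + / 4) (/ 4) (z ^ 2 / 2).

(* Main.v *)
(** Both sides are built from one function: up to elementary factors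
    [D_(2 mu) (sqrt (2 u))] is [h u], and [W_(mu, i tau) x] is the Fourier
    integral over [y] of [h (x cosh^2 (y/2)) cos (tau y)].  The theorem is then
    Poisson summation for [y |-> h (x cosh^2 (y/2))].

    The Fourier representation is first proved for [mu <= -3/2].  There the
    combination of two [1F1] defining Tricomi's function equals
    [1/Gamma(a)] times the integral of [e^(-x t) t^(a-1) (1+t)^(c-a-1)], as the
    Wronskians of the three functions are constant and can be read off at [0].
    This integral and the Fourier integral solve the same Kummer equation; their
    Wronskian vanishes since both decay at infinity, and Laplace's method fixes
    the constant factor.  All other [mu] follow from the three-term recurrence in
    [mu] common to both sides, which for the Fourier integral is an integration
    by parts. *)

Require Import Defs.
From Stdlib Require Import Arith Reals Lra Lia ClassicalEpsilon.
From Coquelicot Require Import Coquelicot.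

Open Scope C_scope.
Open Scope R_scope.

(** * Complex-valued functions of a real variable *)

(** The first series runs over imaginary [nu], so [c = 1 + 2 nu] lies on the line [Re c = 1], and
    its term [nu = 0] sits at [c = 1], where the formula with two 1F1 is singular and Tricomi's
    function is a limit in [c]. The integral over [t] is continuous there, so the limit is taken on
    the integral side. For [mu <= -3/2] the parameter [a] has [Re a >= 2] both at [c = 3/2] (for
    [D]) and at [c = 1 + 2 nu] (for [W]), so [Re a] and [Re (a-c+1)] are positive and the Gamma
    factors are finite and nonzero. Recurrences in [mu] then do the work of analytic continuation.
    Kummer's equation is used as a first-order system for a pair with parameters [a] and [a + 1]:
    constancy of Wronskians then takes first derivatives only, and these come from contiguous
    relations or from integration by parts. A vanishing Wronskian gives proportionality only where
    one of the functions is known not to vanish; a third solution with a nonzero Wronskian avoids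
    that question. Poisson summation goes through the Dirichlet kernel, so that convergence of the
    cosine series is obtained together with the identity. *)

Lemma C_ext (z w : C) : Re z = Re w -> Im z = Im w -> z = w.
Proof. destruct z, w; simpl; intros; subst; reflexivity. Qed.

Lemma Cmod_le_parts (z : C) : Cmod z <= Rabs (Re z) + Rabs (Im z).
Proof.
  replace z with (RtoC (Re z) + Ci * RtoC (Im z))%C at 1
    by (apply C_ext; simpl; ring).
  eapply Rle_trans; [apply Cmod_triangle|].
  rewrite Cmod_mult, Cmod_Ci, !Cmod_R. lra.
Qed.

Lemma Im_le_Cmod (z : C) : Rabs (Im z) <= Cmod z.
Proof.
  eapply Rle_trans; [apply Rmax_r|apply (Rmax_Cmod z)].
Qed.

Lemma Re_le_Cmod (z : C) : Rabs (Re z) <= Cmod z.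
Proof. apply re_le_Cmod. Qed.

Lemma Cmod_minus_sym (z w : C) : Cmod (z - w) = Cmod (w - z).
Proof. rewrite <- Cmod_opp. f_equal. ring. Qed.

Lemma Cmod_minus_le (z w : C) : Cmod (z - w) <= Cmod z + Cmod w.
Proof.
  unfold Cminus. eapply Rle_trans; [apply Cmod_triangle|].
  rewrite Cmod_opp. lra.
Qed.

Lemma Re_Cplus (z w : C) : Re (z + w) = Re z + Re w. Proof. reflexivity. Qed.
Lemma Im_Cplus (z w : C) : Im (z + w) = Im z + Im w. Proof. reflexivity. Qed.
Lemma Re_Cmult (z w : C) : Re (z * w) = Re z * Re w - Im z * Im w.
Proof. reflexivity. Qed.
Lemma Im_Cmult (z w : C) : Im (z * w) = Re z * Im w + Im z * Re w.
Proof. reflexivity. Qed.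
Lemma Re_Copp (z : C) : Re (- z) = - Re z. Proof. reflexivity. Qed.
Lemma Re_Cminus (z w : C) : Re (z - w) = Re z - Re w. Proof. reflexivity. Qed.
Lemma Im_Cminus (z w : C) : Im (z - w) = Im z - Im w. Proof. reflexivity. Qed.

Lemma RtoC_neq_0 (r : R) : r <> 0 -> RtoC r <> 0%C.
Proof. intros H E. apply H. now apply RtoC_inj. Qed.

Lemma Re_neq_0 (z : C) : Re z <> 0 -> z <> 0%C.
Proof. intros H E. apply H. now rewrite E. Qed.

Lemma Cexp_plus (z w : C) : Cexp (z + w) = (Cexp z * Cexp w)%C.
Proof.
  rewrite (surjective_pairing z), (surjective_pairing w).
  apply C_ext; unfold Cexp; simpl;
    rewrite exp_plus, ?cos_plus, ?sin_plus; ring.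
Qed.

Lemma Cexp_0 : Cexp 0 = 1%C.
Proof. apply C_ext; unfold Cexp; simpl; rewrite exp_0, ?cos_0, ?sin_0; ring. Qed.

Lemma Cexp_RtoC (r : R) : Cexp (RtoC r) = RtoC (exp r).
Proof. apply C_ext; unfold Cexp; simpl; rewrite ?cos_0, ?sin_0; ring. Qed.

Lemma Cmod_Cexp (z : C) : Cmod (Cexp z) = exp (Re z).
Proof.
  unfold Cmod, Cexp; simpl fst; simpl snd.
  replace (_ + _) with (Rsqr (exp (Re z))).
  - apply sqrt_Rsqr; left; apply exp_pos.
  - pose proof (sin2_cos2 (Im z)) as H. unfold Rsqr in *.
    transitivity (exp (Re z) * exp (Re z)
      * (sin (Im z) * sin (Im z) + cos (Im z) * cos (Im z))).
    + rewrite H; ring.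
    + ring.
Qed.

Lemma Cexp_neq_0 (z : C) : Cexp z <> 0%C.
Proof.
  intros E. assert (H := Cmod_Cexp z). rewrite E, Cmod_0 in H.
  pose proof (exp_pos (Re z)). lra.
Qed.

Lemma Cexp_opp (z : C) : Cexp (- z) = (/ Cexp z)%C.
Proof.
  assert (H : (Cexp (- z) * Cexp z)%C = 1%C).
  { rewrite <- Cexp_plus, <- Cexp_0. f_equal. ring. }
  transitivity (Cexp (- z) * Cexp z / Cexp z)%C.
  - field. apply Cexp_neq_0.
  - rewrite H. field. apply Cexp_neq_0.
Qed.

Lemma Rcpow_plus (t : R) (s s' : C) : Rcpow t (s + s') = (Rcpow t s * Rcpow t s')%C.
Proof. unfold Rcpow. rewrite <- Cexp_plus. f_equal. ring. Qed.

Lemma Rcpow_opp (t : R) (s : C) : Rcpow t (- s) = (/ Rcpow t s)%C.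
Proof. unfold Rcpow. rewrite <- Cexp_opp. f_equal. ring. Qed.

Lemma Rcpow_1 (t : R) : 0 < t -> Rcpow t 1 = RtoC t.
Proof.
  intros Ht. unfold Rcpow. rewrite Cmult_1_l, Cexp_RtoC. now rewrite exp_ln.
Qed.

Lemma Rcpow_RtoC (t s : R) : Rcpow t (RtoC s) = RtoC (Rpower t s).
Proof. unfold Rcpow, Rpower. now rewrite <- RtoC_mult, Cexp_RtoC. Qed.

Lemma Cmod_Rcpow (t : R) (s : C) : Cmod (Rcpow t s) = Rpower t (Re s).
Proof.
  unfold Rcpow, Rpower. rewrite Cmod_Cexp, Re_Cmult, re_RtoC, im_RtoC. f_equal. ring.
Qed.

Lemma Rcpow_neq_0 (t : R) (s : C) : Rcpow t s <> 0%C.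
Proof. apply Cexp_neq_0. Qed.

Lemma is_derive_Rmult (f g : R -> R) (x l m : R) :
  is_derive f x l -> is_derive g x m ->
  is_derive (fun t => f t * g t) x (l * g x + f x * m).
Proof.
  intros H1 H2.
  exact (is_derive_mult (K := R_AbsRing) f g x l m H1 H2 Rmult_comm).
Qed.

Lemma is_derive_Rplus (f g : R -> R) (x l m : R) :
  is_derive f x l -> is_derive g x m -> is_derive (fun t => f t + g t) x (l + m).
Proof. exact (is_derive_plus (K := R_AbsRing) (V := R_NormedModule) f g x l m). Qed.

Lemma is_derive_Rminus (f g : R -> R) (x l m : R) :
  is_derive f x l -> is_derive g x m -> is_derive (fun t => f t - g t) x (l - m).
Proof. exact (is_derive_minus (K := R_AbsRing) (V := R_NormedModule) f g x l m). Qed.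

Lemma is_derive_eq (f : R -> R) (x l m : R) : is_derive f x l -> l = m -> is_derive f x m.
Proof. now intros H <-. Qed.

(** Two real derivatives: the mean value inequality and the fundamental theorem of calculus then
    apply to each component. *)
Definition cderive (f : R -> C) (x : R) (l : C) : Prop :=
  is_derive (fun t => Re (f t)) x (Re l) /\
  is_derive (fun t => Im (f t)) x (Im l).

Definition ccontinuous (f : R -> C) (x : R) : Prop :=
  continuous (fun t => Re (f t)) x /\ continuous (fun t => Im (f t)) x.

Lemma cderive_continuous (f : R -> C) (x : R) (l : C) :
  cderive f x l -> ccontinuous f x.
Proof.
  intros [H1 H2]; split.
  - apply (ex_derive_continuous (fun t => Re (f t))). eexists; exact H1.
  - apply (ex_derive_continuous (fun t => Im (f t))). eexists; exact H2.
Qed.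

Lemma cderive_const (k : C) (x : R) : cderive (fun _ => k) x 0.
Proof.
  split.
  - exact (is_derive_const (K := R_AbsRing) (V := R_NormedModule) (Re k) x).
  - exact (is_derive_const (K := R_AbsRing) (V := R_NormedModule) (Im k) x).
Qed.

Lemma cderive_RtoC (f : R -> R) (x l : R) :
  is_derive f x l -> cderive (fun t => RtoC (f t)) x (RtoC l).
Proof.
  intros H; split; [exact H|].
  exact (is_derive_const (K := R_AbsRing) (V := R_NormedModule) 0 x).
Qed.

Lemma cderive_plus (f g : R -> C) (x : R) (l m : C) :
  cderive f x l -> cderive g x m -> cderive (fun t => f t + g t)%C x (l + m).
Proof.
  intros [H1 H2] [H3 H4]; split.
  - exact (is_derive_plus _ _ _ _ _ H1 H3).
  - exact (is_derive_plus _ _ _ _ _ H2 H4).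
Qed.

Lemma cderive_mult (f g : R -> C) (x : R) (l m : C) :
  cderive f x l -> cderive g x m ->
  cderive (fun t => f t * g t)%C x (l * g x + f x * m).
Proof.
  intros [H1 H2] [H3 H4]; split.
  - eapply is_derive_eq.
    + apply is_derive_Rminus; apply is_derive_Rmult; eassumption.
    + rewrite Re_Cplus, !Re_Cmult. unfold Re, Im. ring.
  - eapply is_derive_eq.
    + apply is_derive_Rplus; apply is_derive_Rmult; eassumption.
    + rewrite Im_Cplus, !Im_Cmult. unfold Re, Im. ring.
Qed.

Lemma cderive_eq (f : R -> C) (x : R) (l m : C) :
  cderive f x l -> l = m -> cderive f x m.
Proof. now intros H <-. Qed.

Ltac cring := cbv beta; ring.

Lemma cderive_ext_loc (f g : R -> C) (x : R) (l : C) :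
  locally x (fun t => f t = g t) -> cderive f x l -> cderive g x l.
Proof.
  intros E [H1 H2]; split; (eapply is_derive_ext_loc; [|eassumption]);
    (eapply filter_imp; [|exact E]); intros t Ht; cbv beta in *; now rewrite Ht.
Qed.

Lemma cderive_ext (f g : R -> C) (x : R) (l : C) :
  (forall t, f t = g t) -> cderive f x l -> cderive g x l.
Proof. intros E; apply cderive_ext_loc, filter_forall, E. Qed.

Lemma cderive_scal (k : C) (f : R -> C) (x : R) (l : C) :
  cderive f x l -> cderive (fun t => k * f t)%C x (k * l).
Proof.
  intros H. eapply cderive_eq.
  - apply cderive_mult; [apply cderive_const|exact H].
  - cring.
Qed.

Lemma cderive_opp (f : R -> C) (x : R) (l : C) :
  cderive f x l -> cderive (fun t => - f t)%C x (- l).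
Proof.
  intros H. apply cderive_ext with (fun t => RtoC (-1) * f t)%C.
  - intros t. apply C_ext; simpl; ring.
  - eapply cderive_eq; [apply cderive_scal, H|]. apply C_ext; simpl; ring.
Qed.

Lemma cderive_minus (f g : R -> C) (x : R) (l m : C) :
  cderive f x l -> cderive g x m -> cderive (fun t => f t - g t)%C x (l - m).
Proof. intros H1 H2. apply cderive_plus; [|apply cderive_opp]; assumption. Qed.

Lemma cderive_comp (f : R -> C) (g : R -> R) (x : R) (l : C) (m : R) :
  cderive f (g x) l -> is_derive g x m ->
  cderive (fun t => f (g t)) x (RtoC m * l).
Proof.
  intros [H1 H2] H. split.
  - replace (Re _) with (scal m (Re l)).
    + exact (is_derive_comp (fun t => Re (f t)) g x _ _ H1 H).
    + rewrite Re_Cmult. simpl. unfold scal; simpl; unfold mult; simpl. ring.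
  - replace (Im _) with (scal m (Im l)).
    + exact (is_derive_comp (fun t => Im (f t)) g x _ _ H2 H).
    + rewrite Im_Cmult. simpl. unfold scal; simpl; unfold mult; simpl. ring.
Qed.

Lemma cderive_Cexp (f : R -> C) (x : R) (l : C) :
  cderive f x l -> cderive (fun t => Cexp (f t)) x (l * Cexp (f x)).
Proof.
  intros [H1 H2].
  assert (He : is_derive (fun t => exp (Re (f t))) x (Re l * exp (Re (f x)))).
  { apply (is_derive_comp exp (fun t => Re (f t)) x); [apply is_derive_exp|exact H1]. }
  assert (Hc : is_derive (fun t => cos (Im (f t))) x (Im l * - sin (Im (f x)))).
  { apply (is_derive_comp cos (fun t => Im (f t)) x); [apply is_derive_cos|exact H2]. }
  assert (Hs : is_derive (fun t => sin (Im (f t))) x (Im l * cos (Im (f x)))).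
  { apply (is_derive_comp sin (fun t => Im (f t)) x); [apply is_derive_sin|exact H2]. }
  split.
  - eapply is_derive_eq; [apply (is_derive_Rmult _ _ _ _ _ He Hc)|].
    rewrite Re_Cmult. simpl. ring.
  - eapply is_derive_eq; [apply (is_derive_Rmult _ _ _ _ _ He Hs)|].
    rewrite Im_Cmult. simpl. ring.
Qed.

Lemma cderive_Rcpow (s : C) (x : R) :
  0 < x -> cderive (fun t => Rcpow t s) x (s / RtoC x * Rcpow x s).
Proof.
  intros Hx. unfold Rcpow. eapply cderive_eq.
  - apply cderive_Cexp, cderive_scal, cderive_RtoC, is_derive_ln, Hx.
  - rewrite RtoC_inv by lra. unfold Cdiv. cring.
Qed.

(** The real mean value inequality is applied to each component, which costs the factor 2. The
    numerical constants in the exponential and Taylor estimates below come from repeating this. *)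
Lemma cmean_value (f f' : R -> C) (D x y : R) :
  (forall t, Rabs (t - x) <= Rabs (y - x) -> cderive f t (f' t) /\ Cmod (f' t) <= D) ->
  Cmod (f y - f x) <= 2 * D * Rabs (y - x).
Proof.
  intros H. eapply Rle_trans; [apply Cmod_le_parts|].
  assert (H1 : Rabs (Re (f y) - Re (f x)) <= D * Rabs (y - x)).
  { apply (bounded_variation (fun t => Re (f t)) (fun t => Re (f' t))).
    intros t Ht. destruct (H t Ht) as [[A _] B]. split; [exact A|].
    eapply Rle_trans; [apply Re_le_Cmod|exact B]. }
  assert (H2 : Rabs (Im (f y) - Im (f x)) <= D * Rabs (y - x)).
  { apply (bounded_variation (fun t => Im (f t)) (fun t => Im (f' t))).
    intros t Ht. destruct (H t Ht) as [[_ A] B]. split; [exact A|].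
    eapply Rle_trans; [apply Im_le_Cmod|exact B]. }
  rewrite Re_Cminus, Im_Cminus. lra.
Qed.

Lemma cderive_0_const (f : R -> C) (a b : R) :
  a <= b -> (forall t, a <= t <= b -> cderive f t 0) -> f a = f b.
Proof.
  intros Hab H. destruct Hab as [Hab| ->]; [|reflexivity].
  apply C_ext.
  - apply (eq_is_derive (fun t => Re (f t)) a b); [intros t Ht; apply (H t Ht)|exact Hab].
  - apply (eq_is_derive (fun t => Im (f t)) a b); [intros t Ht; apply (H t Ht)|exact Hab].
Qed.

Lemma exp_le (x y : R) : x <= y -> exp x <= exp y.
Proof. intros [H| ->]; [left; now apply exp_increasing|right; reflexivity]. Qed.

Lemma Cexp_ray_bound (z : C) (t : R) :
  Rabs t <= 1 -> Cmod (Cexp (RtoC t * z)) <= exp (Cmod z).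
Proof.
  intros Ht.
  rewrite Cmod_Cexp. apply exp_le.
  eapply Rle_trans; [apply Rle_abs|]. eapply Rle_trans; [apply Re_le_Cmod|].
  rewrite Cmod_mult, Cmod_R. pose proof (Cmod_ge_0 z). nra.
Qed.

Lemma cderive_Cexp_ray (z : C) (t : R) :
  cderive (fun s => Cexp (RtoC s * z)) t (z * Cexp (RtoC t * z)).
Proof.
  eapply cderive_eq.
  - apply cderive_Cexp, cderive_mult; [|apply cderive_const].
    apply cderive_RtoC, (is_derive_id (K := R_AbsRing)).
  - change (@one R_AbsRing) with 1%R. cring.
Qed.

(** Mean value inequality along the segment from 0 to [z]. The constant is crude; later uses depend
    only on the order of vanishing at 0. *)
Lemma Cexp_minus_1_le (z : C) : Cmod (Cexp z - 1) <= 2 * Cmod z * exp (Cmod z).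
Proof.
  pose proof (cmean_value (fun t => Cexp (RtoC t * z)) (fun t => z * Cexp (RtoC t * z))%C
    (Cmod z * exp (Cmod z)) 0 1) as H.
  cbv beta in H. rewrite Cmult_0_l, Cexp_0, Cmult_1_l, Rminus_0_r, Rabs_R1 in H.
  rewrite !Rmult_1_r in H. rewrite Rmult_assoc. apply H. intros t Ht. split.
  - apply cderive_Cexp_ray.
  - rewrite Cmod_mult. apply Rmult_le_compat_l; [apply Cmod_ge_0|].
    apply Cexp_ray_bound. now rewrite ?Rminus_0_r, ?Rabs_R1 in Ht.
Qed.

(** The derivative of [Cexp (t z) - t z] in [t] is [z (Cexp (t z) - 1)], to which the first-order
    estimate applies. *)
Lemma Cexp_minus_1_minus_le (z : C) :
  Cmod (Cexp z - 1 - z) <= 4 * Cmod z ^ 2 * exp (Cmod z).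
Proof.
  pose proof (cmean_value (fun t => Cexp (RtoC t * z) - RtoC t * z)%C
    (fun t => z * Cexp (RtoC t * z) - z)%C
    (2 * Cmod z ^ 2 * exp (Cmod z)) 0 1) as H.
  cbv beta in H. rewrite !Cmult_0_l, Cexp_0, !Cmult_1_l, Rminus_0_r, Rabs_R1 in H.
  replace (Cexp z - 1 - z)%C with (Cexp z - z - (1 - 0))%C by ring.
  rewrite !Rmult_1_r in H.
  eapply Rle_trans; [apply H|right; ring]. intros t Ht. split.
  - apply cderive_minus; [apply cderive_Cexp_ray|].
    eapply cderive_eq.
    + apply cderive_mult; [|apply cderive_const].
      apply cderive_RtoC, (is_derive_id (K := R_AbsRing)).
    + change (@one R_AbsRing) with 1%R. cring.
  - replace (z * Cexp (RtoC t * z) - z)%C with (z * (Cexp (RtoC t * z) - 1))%C by ring.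
    rewrite Cmod_mult.
    assert (Ht' : Cmod (RtoC t * z) <= Cmod z).
    { rewrite Cmod_mult, Cmod_R. rewrite ?Rminus_0_r, ?Rabs_R1 in Ht.
      pose proof (Cmod_ge_0 z). nra. }
    pose proof (Cexp_minus_1_le (RtoC t * z)) as H1.
    pose proof (exp_le _ _ Ht') as H2. pose proof (Cmod_ge_0 z).
    pose proof (Cmod_ge_0 (RtoC t * z)). pose proof (exp_pos (Cmod (RtoC t * z))).
    assert (Cmod (Cexp (RtoC t * z) - 1) <= 2 * Cmod z * exp (Cmod z)).
    { eapply Rle_trans; [exact H1|]. apply Rmult_le_compat; lra. }
    simpl. nra.
Qed.

Lemma is_derive_continuous (f : R -> R) (x l : R) : is_derive f x l -> continuous f x.
Proof. intros H. apply (ex_derive_continuous f). now exists l. Qed.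

Lemma ccontinuous_const (k : C) (x : R) : ccontinuous (fun _ => k) x.
Proof. eapply cderive_continuous, cderive_const. Qed.

Lemma ccontinuous_RtoC (f : R -> R) (x : R) :
  continuous f x -> ccontinuous (fun t => RtoC (f t)) x.
Proof. intros H; split; [exact H|apply continuous_const]. Qed.

Lemma ccontinuous_plus (f g : R -> C) (x : R) :
  ccontinuous f x -> ccontinuous g x -> ccontinuous (fun t => f t + g t)%C x.
Proof.
  intros [H1 H2] [H3 H4]; split.
  - exact (continuous_plus _ _ x H1 H3).
  - exact (continuous_plus _ _ x H2 H4).
Qed.

Lemma ccontinuous_mult (f g : R -> C) (x : R) :
  ccontinuous f x -> ccontinuous g x -> ccontinuous (fun t => f t * g t)%C x.
Proof.
  intros [H1 H2] [H3 H4]; split.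
  - apply (continuous_minus (fun t => Re (f t) * Re (g t)) (fun t => Im (f t) * Im (g t)));
      apply (continuous_mult (K := R_AbsRing)); assumption.
  - apply (continuous_plus (fun t => Re (f t) * Im (g t)) (fun t => Im (f t) * Re (g t)));
      apply (continuous_mult (K := R_AbsRing)); assumption.
Qed.

Lemma ccontinuous_scal (k : C) (f : R -> C) (x : R) :
  ccontinuous f x -> ccontinuous (fun t => k * f t)%C x.
Proof. intros H. apply ccontinuous_mult; [apply ccontinuous_const|exact H]. Qed.

Lemma ccontinuous_minus (f g : R -> C) (x : R) :
  ccontinuous f x -> ccontinuous g x -> ccontinuous (fun t => f t - g t)%C x.
Proof.
  intros [H1 H2] [H3 H4]; split.
  - exact (continuous_minus _ _ x H1 H3).
  - exact (continuous_minus _ _ x H2 H4).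
Qed.

Lemma ccontinuous_comp (f : R -> C) (g : R -> R) (x : R) :
  ccontinuous f (g x) -> continuous g x -> ccontinuous (fun t => f (g t)) x.
Proof.
  intros [H1 H2] H; split.
  - exact (continuous_comp g (fun t => Re (f t)) x H H1).
  - exact (continuous_comp g (fun t => Im (f t)) x H H2).
Qed.

Lemma ccontinuous_Cexp (f : R -> C) (x : R) :
  ccontinuous f x -> ccontinuous (fun t => Cexp (f t)) x.
Proof.
  intros [H1 H2]; split; unfold Cexp; simpl.
  - apply (continuous_mult (K := R_AbsRing)).
    + apply (continuous_comp (fun t => Re (f t)) exp); [exact H1|].
      eapply is_derive_continuous, is_derive_exp.
    + apply (continuous_comp (fun t => Im (f t)) cos); [exact H2|].
      eapply is_derive_continuous, is_derive_cos.
  - apply (continuous_mult (K := R_AbsRing)).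
    + apply (continuous_comp (fun t => Re (f t)) exp); [exact H1|].
      eapply is_derive_continuous, is_derive_exp.
    + apply (continuous_comp (fun t => Im (f t)) sin); [exact H2|].
      eapply is_derive_continuous, is_derive_sin.
Qed.

(** * Integrals over the real line *)

(** A total operator built on symmetric integer windows. For [rnice] functions the limit exists and
    is the same along all windows growing to the line ([rint_near], [rint_unique]). *)
Definition rint (f : R -> R) : R :=
  real (Lim_seq (fun n => RInt f (- INR n) (INR n))).

Definition cint (f : R -> C) : C := (rint (fun v => Re (f v)), rint (fun v => Im (f v))).

(** The constants are explicit because dominated convergence and the Poisson estimate need one bound
    for a whole family. *)
Definition rnice (K d : R) (f : R -> R) : Prop :=
  (forall v, continuous f v) /\ 0 < d /\ forall v, Rabs (f v) <= K * exp (- d * Rabs v).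

Lemma ex_RInt_cont (f : R -> R) (a b : R) :
  (forall v, continuous f v) -> ex_RInt f a b.
Proof. intros H. apply (ex_RInt_continuous (V := R_CompleteNormedModule)). auto. Qed.

Lemma RInt_exp_scal (K d a b : R) :
  d <> 0 -> is_RInt (fun v => K * exp (d * v)) a b (K / d * exp (d * b) - K / d * exp (d * a)).
Proof.
  intros Hd.
  apply (is_RInt_derive (fun v => K / d * exp (d * v)) (fun v => K * exp (d * v))).
  - intros x _. auto_derive; [exact I|]. field; exact Hd.
  - intros x _. apply (is_derive_continuous _ _ (K * (d * exp (d * x)))).
    auto_derive; [exact I|]. ring.
Qed.

Lemma RInt_abs_le (f g : R -> R) (a b l : R) :
  a <= b -> (forall v, continuous f v) -> is_RInt g a b l ->
  (forall v, a <= v <= b -> Rabs (f v) <= g v) -> Rabs (RInt f a b) <= l.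
Proof.
  intros Hab Hf Hg H.
  apply (norm_RInt_le (V := R_NormedModule) f g a b); auto.
  apply (RInt_correct (V := R_CompleteNormedModule)). now apply ex_RInt_cont.
Qed.

Lemma rnice_K_ge_0 (K d : R) (f : R -> R) : rnice K d f -> 0 <= K.
Proof.
  intros (_ & _ & H). specialize (H 0). rewrite Rabs_R0, Rmult_0_r, exp_0 in H.
  pose proof (Rabs_pos (f 0)). lra.
Qed.

Lemma RInt_tail_right (K d : R) (f : R -> R) (a b : R) :
  rnice K d f -> 0 <= a <= b -> Rabs (RInt f a b) <= K / d * exp (- d * a).
Proof.
  intros Hf Hab. pose proof (rnice_K_ge_0 _ _ _ Hf) as HK.
  destruct Hf as (Hc & Hd & H).
  eapply Rle_trans.
  - apply (RInt_abs_le f (fun v => K * exp (- d * v)) a b); [lra|exact Hc| |].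
    + apply RInt_exp_scal; lra.
    + intros v Hv. rewrite <- (Rabs_pos_eq v) at 2 by lra. apply H.
  - assert (0 <= K / d) by (apply Rdiv_le_0_compat; lra).
    pose proof (exp_pos (- d * b)).
    replace (K / - d) with (- (K / d)) by (field; lra). nra.
Qed.

Lemma RInt_tail_left (K d : R) (f : R -> R) (a b : R) :
  rnice K d f -> 0 <= a <= b -> Rabs (RInt f (- b) (- a)) <= K / d * exp (- d * a).
Proof.
  intros Hf Hab. pose proof (rnice_K_ge_0 _ _ _ Hf) as HK.
  destruct Hf as (Hc & Hd & H).
  eapply Rle_trans.
  - apply (RInt_abs_le f (fun v => K * exp (d * v)) (- b) (- a)); [lra|exact Hc| |].
    + apply RInt_exp_scal; lra.
    + intros v Hv. replace (d * v) with (- d * Rabs v); [apply H|].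
      rewrite Rabs_left1 by lra. ring.
  - assert (0 <= K / d) by (apply Rdiv_le_0_compat; lra).
    pose proof (exp_pos (d * - b)). replace (d * - a) with (- d * a) by ring. nra.
Qed.

Lemma RInt_split3 (f : R -> R) (a b c d : R) :
  (forall v, continuous f v) -> RInt f a d = RInt f a b + RInt f b c + RInt f c d.
Proof.
  intros H.
  rewrite <- (RInt_Chasles f a c d), <- (RInt_Chasles f a b c); auto using ex_RInt_cont.
Qed.

Lemma RInt_expand (K d : R) (f : R -> R) (A a b a' b' : R) :
  rnice K d f -> 0 <= A -> A <= a <= a' -> A <= b <= b' ->
  Rabs (RInt f (- a') b' - RInt f (- a) b) <= 2 * K / d * exp (- d * A).
Proof.
  intros Hf HA Ha Hb. rewrite (RInt_split3 f (- a') (- a) b b') by apply Hf.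
  assert (H1 := RInt_tail_left K d f a a' Hf ltac:(lra)).
  assert (H2 := RInt_tail_right K d f b b' Hf ltac:(lra)).
  pose proof (rnice_K_ge_0 _ _ _ Hf) as HK. destruct Hf as (_ & Hd & _).
  assert (0 <= K / d) by (apply Rdiv_le_0_compat; lra).
  assert (exp (- d * a) <= exp (- d * A)) by (apply exp_le; nra).
  assert (exp (- d * b) <= exp (- d * A)) by (apply exp_le; nra).
  replace (_ - _) with (RInt f (- a') (- a) + RInt f b b') by ring.
  eapply Rle_trans; [apply Rabs_triang|].
  replace (2 * K / d) with (K / d + K / d) by (field; lra). nra.
Qed.

Lemma exp_small (d eps : R) : 0 < d -> 0 < eps -> exists A, 0 <= A /\ exp (- d * A) < eps.
Proof.
  (* At this point the exponential is [exp (- / eps)], and [exp (/ eps) > 1 + / eps]. *)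
  intros Hd He. exists (/ (d * eps)). split.
  - left. apply Rinv_0_lt_compat. nra.
  - replace (- d * / (d * eps)) with (- (/ eps)) by (field; lra).
    rewrite exp_Ropp. rewrite <- (Rinv_inv eps) at 2.
    apply Rinv_lt_contravar.
    + apply Rmult_lt_0_compat; [now apply Rinv_0_lt_compat|apply exp_pos].
    + pose proof (exp_ineq1 (/ eps)). pose proof (Rinv_0_lt_compat _ He). lra.
Qed.

(** Cauchy criterion: two windows that both contain [[-A, A]] differ by at most two tails. *)
Lemma rint_lim (K d : R) (f : R -> R) :
  rnice K d f -> is_lim_seq (fun n => RInt f (- INR n) (INR n)) (rint f).
Proof.
  intros Hf.
  assert (Hex : ex_finite_lim_seq (fun n => RInt f (- INR n) (INR n))).
  { apply ex_lim_seq_cauchy_corr. intros eps.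
    pose proof (rnice_K_ge_0 _ _ _ Hf) as HK.
    destruct (exp_small d (eps / (2 * K / d + 1))) as (A & HA & HA').
    - apply Hf.
    - apply Rdiv_lt_0_compat; [apply cond_pos|].
      assert (0 <= 2 * K / d) by (apply Rdiv_le_0_compat; [lra|apply Hf]). lra.
    - destruct (nfloor_ex A HA) as (N & HN).
      assert (Hsmall : 2 * K / d * exp (- d * A) < eps).
      { assert (0 <= 2 * K / d) by (apply Rdiv_le_0_compat; [lra|apply Hf]).
        apply Rle_lt_trans with (2 * K / d * (eps / (2 * K / d + 1))).
        - apply Rmult_le_compat_l; lra.
        - pose proof (cond_pos eps).
          apply Rmult_lt_reg_r with (2 * K / d + 1); [lra|].
          replace (_ * _) with (2 * K / d * eps) by (field; split; [apply Rgt_not_eq, Hf|];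
            pose proof (proj1 (proj2 Hf)); nra). nra. }
      assert (Hw : forall p q, (S N <= p <= q)%nat ->
        Rabs (RInt f (- INR q) (INR q) - RInt f (- INR p) (INR p)) < eps).
      { intros p q Hpq. eapply Rle_lt_trans; [|exact Hsmall].
        assert (INR (S N) <= INR p) by (apply le_INR; lia).
        assert (INR p <= INR q) by (apply le_INR; lia). rewrite S_INR in *.
        apply RInt_expand; auto; lra. }
      exists (S N). intros n m Hn Hm. destruct (Nat.le_ge_cases n m).
      + rewrite Rabs_minus_sym. apply Hw; lia.
      + apply Hw; lia. }
  apply Lim_seq_correct', Hex.
Qed.

Lemma rint_tail (K d : R) (f : R -> R) (A a b : R) :
  rnice K d f -> 0 <= A -> A <= a -> A <= b ->
  Rabs (rint f - RInt f (- a) b) <= 2 * K / d * exp (- d * A).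
Proof.
  intros Hf HA Ha Hb.
  assert (H := rint_lim _ _ _ Hf).
  assert (H2 : is_lim_seq (fun n => Rabs (RInt f (- INR n) (INR n) - RInt f (- a) b))
    (Rabs (rint f - RInt f (- a) b))).
  { apply (is_lim_seq_abs _ (rint f - RInt f (- a) b)).
    apply is_lim_seq_minus'; [exact H|apply is_lim_seq_const]. }
  apply (is_lim_seq_le_loc (fun n => Rabs (RInt f (- INR n) (INR n) - RInt f (- a) b))
    (fun _ => 2 * K / d * exp (- d * A)) (Rabs (rint f - RInt f (- a) b)) (2 * K / d * exp (- d * A))).
  - destruct (nfloor_ex (Rabs a + Rabs b)) as (N & HN).
    { pose proof (Rabs_pos a); pose proof (Rabs_pos b); lra. }
    exists (S N). intros n Hn. assert (INR (S N) <= INR n) by (apply le_INR; lia).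
    rewrite S_INR in *. pose proof (Rle_abs a). pose proof (Rle_abs b).
    pose proof (Rabs_pos a); pose proof (Rabs_pos b).
    apply RInt_expand; auto; lra.
  - exact H2.
  - apply is_lim_seq_const.
Qed.

Lemma rint_near (K d : R) (f : R -> R) (eps : R) :
  rnice K d f -> 0 < eps ->
  exists A, forall a b, A <= a -> A <= b -> Rabs (RInt f (- a) b - rint f) < eps.
Proof.
  intros Hf He.
  assert (HK : 0 <= 2 * K / d).
  { pose proof (rnice_K_ge_0 _ _ _ Hf). apply Rdiv_le_0_compat; [lra|apply Hf]. }
  destruct (exp_small d (eps / (2 * K / d + 1))) as (A & HA & HA').
  { apply Hf. }
  { apply Rdiv_lt_0_compat; lra. }
  exists A. intros a b Ha Hb.
  pose proof (rint_tail K d f A a b Hf HA Ha Hb) as H.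
  rewrite Rabs_minus_sym. eapply Rle_lt_trans; [exact H|].
  revert HK HA'. generalize (2 * K / d). intros Q HQ HA'.
  apply Rle_lt_trans with ((Q + 1) * exp (- d * A)).
  - pose proof (exp_pos (- d * A)). nra.
  - apply Rmult_lt_compat_l with (r := Q + 1) in HA'; [|lra].
    replace ((Q + 1) * (eps / (Q + 1))) with eps in HA' by (field; lra). exact HA'.
Qed.

(** Allows an integral to be computed along arbitrarily chosen windows, as a substitution does not
    map integer windows to integer windows. *)
Lemma rint_unique (K d : R) (f : R -> R) (l : R) :
  rnice K d f ->
  (forall eps, 0 < eps -> forall A, exists a b, A <= a /\ A <= b /\
     Rabs (RInt f (- a) b - l) < eps) ->
  rint f = l.
Proof.
  intros Hf H. apply cond_eq. intros eps He.
  destruct (rint_near K d f (eps / 2) Hf ltac:(lra)) as (A & HA).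
  destruct (H (eps / 2) ltac:(lra) A) as (a & b & Ha & Hb & Hab).
  specialize (HA a b Ha Hb). rewrite Rabs_minus_sym in HA.
  replace (rint f - l) with ((rint f - RInt f (- a) b) + (RInt f (- a) b - l)) by ring.
  eapply Rle_lt_trans; [apply Rabs_triang|]. lra.
Qed.

Lemma rint_lin (K d K' d' : R) (f g : R -> R) (a b : R) :
  rnice K d f -> rnice K' d' g ->
  rint (fun v => a * f v + b * g v) = a * rint f + b * rint g.
Proof.
  intros Hf Hg. unfold rint at 1.
  assert (H : is_lim_seq (fun n => RInt (fun v => a * f v + b * g v) (- INR n) (INR n))
    (a * rint f + b * rint g)).
  { apply is_lim_seq_ext with
      (fun n => a * RInt f (- INR n) (INR n) + b * RInt g (- INR n) (INR n)).
    - intros n. symmetry. apply is_RInt_unique.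
      apply (is_RInt_plus (V := R_NormedModule) (fun v => a * f v) (fun v => b * g v));
      apply (is_RInt_scal (V := R_NormedModule));
      apply (RInt_correct (V := R_CompleteNormedModule)), ex_RInt_cont; [apply Hf|apply Hg].
    - apply is_lim_seq_plus'; apply is_lim_seq_mult'; try apply is_lim_seq_const;
        eapply rint_lim; eassumption. }
  now rewrite (is_lim_seq_unique _ _ H).
Qed.

Lemma rint_ext (f g : R -> R) : (forall v, f v = g v) -> rint f = rint g.
Proof.
  intros H. unfold rint. f_equal. apply Lim_seq_ext. intros n.
  apply RInt_ext. auto.
Qed.

Definition cdom (K d : R) (f : R -> C) : Prop :=
  (forall v, ccontinuous f v) /\ 0 < d /\ forall v, Cmod (f v) <= K * exp (- d * Rabs v).

(** The form used where linearity and integration by parts ask only for convergence and the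
    constants are irrelevant. *)
Definition cnice (f : R -> C) : Prop := exists K d, cdom K d f.

Lemma cdom_Re (K d : R) (f : R -> C) : cdom K d f -> rnice K d (fun v => Re (f v)).
Proof.
  intros (Hc & Hd & H). split; [intros v; apply Hc|split; [exact Hd|]].
  intros v. eapply Rle_trans; [apply Re_le_Cmod|apply H].
Qed.

Lemma cdom_Im (K d : R) (f : R -> C) : cdom K d f -> rnice K d (fun v => Im (f v)).
Proof.
  intros (Hc & Hd & H). split; [intros v; apply Hc|split; [exact Hd|]].
  intros v. eapply Rle_trans; [apply Im_le_Cmod|apply H].
Qed.

Lemma cdom_K_ge_0 (K d : R) (f : R -> C) : cdom K d f -> 0 <= K.
Proof. intros H. eapply rnice_K_ge_0, cdom_Re, H. Qed.

Lemma cdom_weaken (K d K' d' : R) (f : R -> C) :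
  cdom K d f -> K <= K' -> 0 < d' <= d -> cdom K' d' f.
Proof.
  intros Hf HK Hd. pose proof (cdom_K_ge_0 _ _ _ Hf).
  destruct Hf as (Hc & Hd' & H1). split; [exact Hc|split; [lra|]].
  intros v. eapply Rle_trans; [apply H1|].
  apply Rmult_le_compat; auto; [left; apply exp_pos|].
  apply exp_le. pose proof (Rabs_pos v). nra.
Qed.

Lemma cnice_plus (f g : R -> C) : cnice f -> cnice g -> cnice (fun v => f v + g v)%C.
Proof.
  intros (K & d & Hf) (K' & d' & Hg).
  pose proof (cdom_K_ge_0 _ _ _ Hf). pose proof (cdom_K_ge_0 _ _ _ Hg).
  assert (Hm : 0 < Rmin d d') by (apply Rmin_glb_lt; [apply Hf|apply Hg]).
  apply (cdom_weaken _ _ K (Rmin d d')) in Hf; [|lra|split; [lra|apply Rmin_l]].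
  apply (cdom_weaken _ _ K' (Rmin d d')) in Hg; [|lra|split; [lra|apply Rmin_r]].
  exists (K + K'), (Rmin d d'). split; [|split; [lra|]].
  - intros v. apply ccontinuous_plus; [apply Hf|apply Hg].
  - intros v. eapply Rle_trans; [apply Cmod_triangle|].
    rewrite Rmult_plus_distr_r. apply Rplus_le_compat; [apply Hf|apply Hg].
Qed.

Lemma cnice_scal (k : C) (f : R -> C) : cnice f -> cnice (fun v => k * f v)%C.
Proof.
  intros (K & d & Hf). exists (Cmod k * K), d. split; [|split; [apply Hf|]].
  - intros v. apply ccontinuous_scal, Hf.
  - intros v. rewrite Cmod_mult, Rmult_assoc.
    apply Rmult_le_compat_l; [apply Cmod_ge_0|apply Hf].
Qed.

Lemma cnice_ext (f g : R -> C) : (forall v, f v = g v) -> cnice f -> cnice g.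
Proof.
  intros E (K & d & Hc & Hd & H). exists K, d. split; [|split; [exact Hd|]].
  - intros v. destruct (Hc v) as [H1 H2]. split.
    + apply (continuous_ext (fun t => Re (f t))); [intros t; now rewrite E|exact H1].
    + apply (continuous_ext (fun t => Im (f t))); [intros t; now rewrite E|exact H2].
  - intros v. rewrite <- E. apply H.
Qed.

Lemma cint_ext (f g : R -> C) : (forall v, f v = g v) -> cint f = cint g.
Proof.
  intros H. unfold cint. f_equal; apply rint_ext; intros v; now rewrite H.
Qed.

Lemma cint_plus (f g : R -> C) :
  cnice f -> cnice g -> cint (fun v => f v + g v)%C = (cint f + cint g)%C.
Proof.
  intros (K & d & Hf) (K' & d' & Hg). apply C_ext; simpl.
  - rewrite <- (Rmult_1_l (rint (fun v => Re (f v)))),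
      <- (Rmult_1_l (rint (fun v => Re (g v)))).
    erewrite <- rint_lin; [|apply cdom_Re, Hf|apply cdom_Re, Hg].
    apply rint_ext. intros v. unfold Re. ring.
  - rewrite <- (Rmult_1_l (rint (fun v => Im (f v)))),
      <- (Rmult_1_l (rint (fun v => Im (g v)))).
    erewrite <- rint_lin; [|apply cdom_Im, Hf|apply cdom_Im, Hg].
    apply rint_ext. intros v. unfold Im. ring.
Qed.

Lemma cint_scal (k : C) (f : R -> C) :
  cnice f -> cint (fun v => k * f v)%C = (k * cint f)%C.
Proof.
  intros (K & d & Hf). apply C_ext.
  - rewrite Re_Cmult. simpl.
    transitivity (Re k * rint (fun v => Re (f v)) + (- Im k) * rint (fun v => Im (f v)));
      [|ring].
    erewrite <- rint_lin; [|apply cdom_Re, Hf|apply cdom_Im, Hf].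
    apply rint_ext. intros v. unfold Re, Im. ring.
  - rewrite Im_Cmult. simpl.
    erewrite <- rint_lin; [|apply cdom_Im, Hf|apply cdom_Re, Hf].
    apply rint_ext. intros v. unfold Re, Im. ring.
Qed.

Lemma cnice_minus (f g : R -> C) : cnice f -> cnice g -> cnice (fun v => f v - g v)%C.
Proof.
  intros Hf Hg. apply cnice_ext with (fun v => f v + RtoC (-1) * g v)%C.
  - intros v. apply C_ext; simpl; ring.
  - apply cnice_plus; [exact Hf|apply cnice_scal, Hg].
Qed.

Lemma cint_minus (f g : R -> C) :
  cnice f -> cnice g -> cint (fun v => f v - g v)%C = (cint f - cint g)%C.
Proof.
  intros Hf Hg. rewrite (cint_ext _ (fun v => f v + RtoC (-1) * g v)%C).
  - rewrite cint_plus, cint_scal; auto using cnice_scal. apply C_ext; simpl; ring.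
  - intros v. apply C_ext; simpl; ring.
Qed.

(** With the empty window the tail estimate bounds the whole integral: [2 K / d] for each
    component. *)
Lemma cint_bound (K d : R) (f : R -> C) : cdom K d f -> Cmod (cint f) <= 4 * K / d.
Proof.
  intros Hf. eapply Rle_trans; [apply Cmod_le_parts|]. simpl.
  assert (H1 := rint_tail _ _ _ 0 0 0 (cdom_Re _ _ _ Hf)).
  assert (H2 := rint_tail _ _ _ 0 0 0 (cdom_Im _ _ _ Hf)).
  rewrite Ropp_0, RInt_point, Rmult_0_r, exp_0 in H1, H2.
  unfold zero in H1, H2; simpl in H1, H2. rewrite Rminus_0_r, Rmult_1_r in H1, H2.
  replace (4 * K / d) with (2 * K / d + 2 * K / d) by (field; apply Rgt_not_eq, Hf).
  apply Rplus_le_compat; [apply H1|apply H2]; lra.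
Qed.

Lemma rint_scale_shift (K d : R) (f : R -> R) (k s : R) :
  0 < k -> rnice K d f -> rint (fun v => k * f (k * v + s)) = rint f.
Proof.
  intros Hk Hf.
  assert (Hc : forall v, continuous (fun v => k * f (k * v + s)) v).
  { intros v. apply (continuous_scal_r k (fun v => f (k * v + s))).
    apply (continuous_comp (fun v => k * v + s) f); [|apply Hf].
    apply (is_derive_continuous _ _ k). auto_derive; [exact I|ring]. }
  assert (Hn : rnice (k * (K * exp (d * Rabs s))) (d * k) (fun v => k * f (k * v + s))).
  { pose proof (rnice_K_ge_0 _ _ _ Hf). destruct Hf as (_ & Hd & H1).
    split; [exact Hc|split; [nra|]]. intros v.
    rewrite Rabs_mult, (Rabs_pos_eq k), Rmult_assoc by lra.
    apply Rmult_le_compat_l; [lra|]. eapply Rle_trans; [apply H1|].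
    rewrite Rmult_assoc, <- exp_plus. apply Rmult_le_compat_l; [lra|]. apply exp_le.
    assert (Hv : k * Rabs v <= Rabs (k * v + s) + Rabs s).
    { rewrite <- (Rabs_pos_eq k) at 1 by lra. rewrite <- Rabs_mult.
      replace (k * v) with ((k * v + s) + - s) at 1 by ring.
      eapply Rle_trans; [apply Rabs_triang|]. rewrite Rabs_Ropp. lra. }
    nra. }
  eapply rint_unique; [exact Hn|]. intros eps He A.
  destruct (rint_near _ _ _ eps Hf He) as (B & HB).
  (* Large enough for both image endpoints, [k M + s] and [k M - s], to exceed [B]. *)
  set (M := Rmax (Rabs A) ((Rabs B + Rabs s) / k)).
  assert (HM : Rabs B + Rabs s <= k * M).
  { apply Rle_trans with (k * ((Rabs B + Rabs s) / k)).
    - right. field. lra.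
    - apply Rmult_le_compat_l; [lra|apply Rmax_r]. }
  assert (HMA : A <= M) by (eapply Rle_trans; [apply Rle_abs|apply Rmax_l]).
  exists M, M. split; [exact HMA|split; [exact HMA|]].
  assert (E : RInt (fun v => k * f (k * v + s)) (- M) M = RInt f (k * - M + s) (k * M + s)).
  { apply (RInt_comp_lin (V := R_CompleteNormedModule) f k s).
    apply ex_RInt_cont, Hf. }
  rewrite E. replace (k * - M + s) with (- (k * M - s)) by ring.
  pose proof (Rle_abs B). pose proof (Rle_abs s).
  pose proof (Rle_abs (- s)) as Hs. rewrite Rabs_Ropp in Hs. apply HB; lra.
Qed.

Lemma cint_scale_shift (f : R -> C) (k s : R) :
  0 < k -> cnice f -> cint (fun v => RtoC k * f (k * v + s)%R)%C = cint f.
Proof.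
  intros Hk (K & d & Hf). unfold cint. f_equal.
  - rewrite <- (rint_scale_shift _ _ _ k s Hk (cdom_Re _ _ _ Hf)).
    apply rint_ext. intros v. apply re_scal_l.
  - rewrite <- (rint_scale_shift _ _ _ k s Hk (cdom_Im _ _ _ Hf)).
    apply rint_ext. intros v. apply im_scal_l.
Qed.

Lemma cint_shift (f : R -> C) (s : R) :
  cnice f -> cint (fun v => f (v + s)) = cint f.
Proof.
  intros Hf. rewrite <- (cint_scale_shift f 1 s Rlt_0_1 Hf).
  apply cint_ext. intros v. rewrite Cmult_1_l. f_equal. ring.
Qed.

(** * Complex limits along filters and dominated convergence *)

(** An arbitrary filter lets the same lemmas serve sequences, [x] tending to 0 or to infinity,
    punctured neighbourhoods, and the filter [at_point], whose limit is the value. *)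
Definition has_clim {U : Type} (f : U -> C) (F : (U -> Prop) -> Prop) (l : C) : Prop :=
  forall eps, 0 < eps -> F (fun u => Cmod (f u - l) < eps).

Lemma rint_derive (K d : R) (f g : R -> R) (l m : R) :
  (forall v, is_derive g v (f v)) -> rnice K d f ->
  filterlim g (Rbar_locally p_infty) (locally l) ->
  filterlim g (Rbar_locally m_infty) (locally m) ->
  rint f = l - m.
Proof.
  intros Hg Hf Hl Hm. eapply rint_unique; [exact Hf|]. intros eps He A.
  assert (Hb := Hl _ (locally_ball l (mkposreal (eps / 2) ltac:(lra)))).
  assert (Ha := Hm _ (locally_ball m (mkposreal (eps / 2) ltac:(lra)))).
  destruct Hb as (B & HB). destruct Ha as (B' & HB').
  set (b := Rmax A (B + 1)). set (a := Rmax A (1 - B')).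
  assert (H1 : ball l (eps / 2) (g b)) by (apply HB; pose proof (Rmax_r A (B + 1)); unfold b; lra).
  assert (H2 : ball m (eps / 2) (g (- a)))
    by (apply HB'; pose proof (Rmax_r A (1 - B')); unfold a; lra).
  exists a, b. split; [apply Rmax_l|split; [apply Rmax_l|]].
  rewrite (is_RInt_unique f (- a) b (g b - g (- a))).
  - unfold ball in H1, H2; simpl in H1, H2; unfold AbsRing_ball, abs, minus, plus, opp in H1, H2;
      simpl in H1, H2.
    replace (g b - g (- a) - (l - m)) with ((g b + - l) + - (g (- a) + - m)) by ring.
    eapply Rle_lt_trans; [apply Rabs_triang|]. rewrite Rabs_Ropp. lra.
  - apply (is_RInt_derive (V := R_CompleteNormedModule) g f).
    + intros x _. apply Hg.
    + intros x _. apply Hf.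
Qed.

Lemma has_clim_Re {U : Type} (f : U -> C) (F : (U -> Prop) -> Prop) {FF : Filter F} (l : C) :
  has_clim f F l -> filterlim (fun u => Re (f u)) F (locally (Re l)).
Proof.
  intros H. apply filterlim_locally. intros eps.
  eapply filter_imp; [|apply (H eps), cond_pos].
  intros u Hu. eapply Rle_lt_trans; [|exact Hu]. apply (Re_le_Cmod (f u - l)).
Qed.

Lemma has_clim_Im {U : Type} (f : U -> C) (F : (U -> Prop) -> Prop) {FF : Filter F} (l : C) :
  has_clim f F l -> filterlim (fun u => Im (f u)) F (locally (Im l)).
Proof.
  intros H. apply filterlim_locally. intros eps.
  eapply filter_imp; [|apply (H eps), cond_pos].
  intros u Hu. eapply Rle_lt_trans; [|exact Hu]. apply (Im_le_Cmod (f u - l)).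
Qed.

Lemma cint_derive (f g : R -> C) (l m : C) :
  (forall v, cderive g v (f v)) -> cnice f ->
  has_clim g (Rbar_locally p_infty) l -> has_clim g (Rbar_locally m_infty) m ->
  cint f = (l - m)%C.
Proof.
  intros Hg (K & d & Hf) Hl Hm. apply C_ext; simpl.
  - apply (rint_derive K d (fun v => Re (f v)) (fun v => Re (g v))).
    + intros v. apply Hg.
    + now apply cdom_Re.
    + now apply has_clim_Re; [apply Rbar_locally_filter|].
    + now apply has_clim_Re; [apply Rbar_locally_filter|].
  - apply (rint_derive K d (fun v => Im (f v)) (fun v => Im (g v))).
    + intros v. apply Hg.
    + now apply cdom_Im.
    + now apply has_clim_Im; [apply Rbar_locally_filter|].
    + now apply has_clim_Im; [apply Rbar_locally_filter|].
Qed.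

Lemma cdom_lim_0 (K d : R) (f : R -> C) :
  cdom K d f -> has_clim f (Rbar_locally p_infty) 0 /\ has_clim f (Rbar_locally m_infty) 0.
Proof.
  intros Hf. pose proof (cdom_K_ge_0 _ _ _ Hf) as HK. destruct Hf as (_ & Hd & H).
  assert (Hs : forall eps, 0 < eps -> exists A, forall v, A <= Rabs v -> Cmod (f v - 0) < eps).
  { intros eps He. destruct (exp_small d (eps / (K + 1)) Hd) as (A & HA & HA').
    { apply Rdiv_lt_0_compat; lra. }
    exists A. intros v Hv. replace (f v - 0)%C with (f v) by ring.
    eapply Rle_lt_trans; [apply H|].
    apply Rle_lt_trans with ((K + 1) * exp (- d * A)).
    - apply Rmult_le_compat; try lra; [left; apply exp_pos|apply exp_le; nra].
    - apply Rmult_lt_compat_l with (r := K + 1) in HA'; [|lra].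
      replace ((K + 1) * (eps / (K + 1))) with eps in HA' by (field; lra). exact HA'. }
  split; intros eps He; destruct (Hs eps He) as (A & HA).
  - exists A. intros v Hv. apply HA. pose proof (Rle_abs v). lra.
  - exists (- A). intros v Hv. apply HA. pose proof (Rle_abs (- v)).
    rewrite Rabs_Ropp in H0. lra.
Qed.

Lemma cint_derive_0 (f g : R -> C) :
  (forall v, cderive g v (f v)) -> cnice g -> cnice f -> cint f = 0%C.
Proof.
  intros H (K & d & Hg) Hf. destruct (cdom_lim_0 _ _ _ Hg) as [H1 H2].
  rewrite (cint_derive f g 0 0 H Hf H1 H2). ring.
Qed.

(** Dominated convergence, for locally uniform convergence. *)
Lemma cint_lim {U : Type} (F : (U -> Prop) -> Prop) {FF : ProperFilter F}
  (f : U -> R -> C) (g : R -> C) (K d : R) :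
  F (fun u => cdom K d (f u)) -> (forall v, ccontinuous g v) ->
  (forall N eps, 0 < eps -> F (fun u => forall v, Rabs v <= N -> Cmod (f u v - g v) < eps)) ->
  cdom K d g /\ has_clim (fun u => cint (f u)) F (cint g).
Proof.
  intros Hf Hgc Hlim.
  destruct (filter_ex _ Hf) as (u0 & Hu0).
  pose proof (cdom_K_ge_0 _ _ _ Hu0) as HK. assert (Hd : 0 < d) by apply Hu0.
  (* The majorant passes to the limit pointwise, so the tail of [g] obeys the same estimate as those
     of [f u]. *)
  assert (Hg : cdom K d g).
  { split; [exact Hgc|split; [exact Hd|]]. intros v. apply Rle_plus_epsilon.
    intros eps He.
    destruct (filter_ex _ (filter_and _ _ Hf (Hlim (Rabs v) eps He))) as (u & (_ & _ & H1) & H2).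
    specialize (H2 v (Rle_refl _)). specialize (H1 v).
    replace (g v) with (f u v - (f u v - g v))%C by ring.
    eapply Rle_trans; [apply Cmod_minus_le|]. lra. }
  split; [exact Hg|]. intros eps He.
  (* Each component of the error consists of two tails and one window, each at most [eps / 8]; the
     two components add up to [6 eps / 8]. *)
  destruct (exp_small d (eps / 4 / (4 * K / d + 1)) Hd) as (A & HA & HA').
  { assert (0 <= 4 * K / d) by (apply Rdiv_le_0_compat; lra).
    apply Rdiv_lt_0_compat; lra. }
  assert (HKA : 2 * K / d * exp (- d * A) <= eps / 8).
  { assert (0 <= 4 * K / d) by (apply Rdiv_le_0_compat; lra).
    assert ((4 * K / d + 1) * exp (- d * A) <= eps / 4).
    { apply Rle_trans with ((4 * K / d + 1) * (eps / 4 / (4 * K / d + 1))).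
      - apply Rmult_le_compat_l; lra.
      - right. field. split; nra. }
    replace (2 * K / d) with (4 * K / d / 2) by (field; lra).
    pose proof (exp_pos (- d * A)). nra. }
  assert (He2 : 0 < eps / (8 * (2 * A + 1))) by (apply Rdiv_lt_0_compat; lra).
  assert (Hfin : forall (p : C -> R) (Hp : forall z w, Rabs (p z - p w) <= Cmod (z - w)) u,
    (forall v, Rabs v <= A -> Cmod (f u v - g v) < eps / (8 * (2 * A + 1))) ->
    (forall v, continuous (fun t => p (f u t)) v) -> (forall v, continuous (fun t => p (g t)) v) ->
    Rabs (RInt (fun v => p (f u v)) (- A) A - RInt (fun v => p (g v)) (- A) A) <= eps / 8).
  { intros p Hp u Hu H1 H2.
    assert (E : RInt (fun v => p (f u v)) (- A) A - RInt (fun v => p (g v)) (- A) A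
      = RInt (fun v => p (f u v) - p (g v)) (- A) A).
    { symmetry. apply (RInt_minus (V := R_CompleteNormedModule)
        (fun v => p (f u v)) (fun v => p (g v))); now apply ex_RInt_cont. }
    rewrite E. eapply Rle_trans.
    - apply abs_RInt_le_const with (M := eps / (8 * (2 * A + 1))); [lra| |].
      + apply ex_RInt_cont. intros v.
        apply (continuous_minus (fun v => p (f u v)) (fun v => p (g v))); auto.
      + intros v Hv. left. eapply Rle_lt_trans; [apply Hp|]. apply Hu.
        apply Rabs_le; lra.
    - apply Rle_trans with ((2 * A + 1) * (eps / (8 * (2 * A + 1)))).
      + apply Rmult_le_compat_r; lra.
      + right. field. lra. }
  eapply filter_imp; [|exact (filter_and _ _ Hf (Hlim A _ He2))].
  intros u [H1 H2]. eapply Rle_lt_trans; [apply Cmod_le_parts|].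
  rewrite Re_Cminus, Im_Cminus. simpl.
  assert (HR : Rabs (rint (fun v => Re (f u v)) - rint (fun v => Re (g v))) <= 3 * (eps / 8)).
  { pose proof (rint_tail _ _ _ A A A (cdom_Re _ _ _ H1) HA (Rle_refl _) (Rle_refl _)) as T1.
    pose proof (rint_tail _ _ _ A A A (cdom_Re _ _ _ Hg) HA (Rle_refl _) (Rle_refl _)) as T2.
    pose proof (Hfin Re (fun z w => Re_le_Cmod (z - w)) u H2
      (fun v => proj1 (proj1 H1 v)) (fun v => proj1 (Hgc v))) as T3.
    revert T1 T2 T3. cbv beta. unfold Rabs; repeat destruct Rcase_abs; intros; lra. }
  assert (HI : Rabs (rint (fun v => Im (f u v)) - rint (fun v => Im (g v))) <= 3 * (eps / 8)).
  { pose proof (rint_tail _ _ _ A A A (cdom_Im _ _ _ H1) HA (Rle_refl _) (Rle_refl _)) as T1.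
    pose proof (rint_tail _ _ _ A A A (cdom_Im _ _ _ Hg) HA (Rle_refl _) (Rle_refl _)) as T2.
    pose proof (Hfin Im (fun z w => Im_le_Cmod (z - w)) u H2
      (fun v => proj2 (proj1 H1 v)) (fun v => proj2 (Hgc v))) as T3.
    revert T1 T2 T3. cbv beta. unfold Rabs; repeat destruct Rcase_abs; intros; lra. }
  lra.
Qed.

Lemma has_clim_const {U : Type} (F : (U -> Prop) -> Prop) {FF : Filter F} (l : C) :
  has_clim (fun _ => l) F l.
Proof.
  intros eps He. apply filter_forall. intros _.
  replace (l - l)%C with (RtoC 0) by ring. now rewrite Cmod_0.
Qed.

Lemma has_clim_ext_loc {U : Type} (F : (U -> Prop) -> Prop) {FF : Filter F}
  (f g : U -> C) (l : C) :
  F (fun u => f u = g u) -> has_clim f F l -> has_clim g F l.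
Proof.
  intros E H eps He. eapply filter_imp; [|exact (filter_and _ _ E (H eps He))].
  intros u [H1 H2]. now rewrite <- H1.
Qed.

Lemma has_clim_ext {U : Type} (F : (U -> Prop) -> Prop) {FF : Filter F}
  (f g : U -> C) (l : C) :
  (forall u, f u = g u) -> has_clim f F l -> has_clim g F l.
Proof. intros E. apply has_clim_ext_loc; [exact FF|]. now apply filter_forall. Qed.

Lemma has_clim_plus {U : Type} (F : (U -> Prop) -> Prop) {FF : Filter F}
  (f g : U -> C) (l m : C) :
  has_clim f F l -> has_clim g F m -> has_clim (fun u => f u + g u)%C F (l + m)%C.
Proof.
  intros Hf Hg eps He. assert (He2 : 0 < eps / 2) by lra.
  eapply filter_imp; [|exact (filter_and _ _ (Hf _ He2) (Hg _ He2))].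
  intros u [H1 H2]. replace (f u + g u - (l + m))%C with ((f u - l) + (g u - m))%C by ring.
  eapply Rle_lt_trans; [apply Cmod_triangle|]. lra.
Qed.

Lemma has_clim_mult {U : Type} (F : (U -> Prop) -> Prop) {FF : Filter F}
  (f g : U -> C) (l m : C) :
  has_clim f F l -> has_clim g F m -> has_clim (fun u => f u * g u)%C F (l * m)%C.
Proof.
  intros Hf Hg eps He. pose proof (Cmod_ge_0 l) as Hl. pose proof (Cmod_ge_0 m) as Hm.
  set (e := Rmin 1 (eps / (2 * (Cmod l + Cmod m + 1)))).
  assert (H0 : 0 < eps / (2 * (Cmod l + Cmod m + 1))) by (apply Rdiv_lt_0_compat; lra).
  assert (He1 : 0 < e) by (apply Rmin_glb_lt; lra).
  assert (He2 : e * (Cmod l + Cmod m + 1) <= eps / 2).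
  { apply Rle_trans with (eps / (2 * (Cmod l + Cmod m + 1)) * (Cmod l + Cmod m + 1)).
    - apply Rmult_le_compat_r; [lra|apply Rmin_r].
    - right. field. lra. }
  assert (He3 : e <= 1) by apply Rmin_l.
  eapply filter_imp; [|exact (filter_and _ _ (Hf e He1) (Hg e He1))].
  intros u [H1 H2].
  replace (f u * g u - l * m)%C with ((f u - l) * (g u - m) + (f u - l) * m + l * (g u - m))%C by ring.
  eapply Rle_lt_trans; [apply Cmod_triangle|].
  eapply Rle_lt_trans; [apply Rplus_le_compat_r, Cmod_triangle|].
  rewrite !Cmod_mult.
  pose proof (Cmod_ge_0 (f u - l)). pose proof (Cmod_ge_0 (g u - m)).
  assert (Cmod (f u - l) * Cmod (g u - m) <= e * 1) by (apply Rmult_le_compat; lra).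
  assert (Cmod (f u - l) * Cmod m <= e * Cmod m) by (apply Rmult_le_compat_r; lra).
  assert (Cmod l * Cmod (g u - m) <= Cmod l * e) by (apply Rmult_le_compat_l; lra).
  nra.
Qed.

Lemma has_clim_scal {U : Type} (F : (U -> Prop) -> Prop) {FF : Filter F}
  (k : C) (f : U -> C) (l : C) :
  has_clim f F l -> has_clim (fun u => k * f u)%C F (k * l)%C.
Proof. intros H. apply has_clim_mult; [exact FF|now apply has_clim_const|exact H]. Qed.

Lemma has_clim_minus {U : Type} (F : (U -> Prop) -> Prop) {FF : Filter F}
  (f g : U -> C) (l m : C) :
  has_clim f F l -> has_clim g F m -> has_clim (fun u => f u - g u)%C F (l - m)%C.
Proof.
  intros Hf Hg. apply (has_clim_scal F (RtoC (-1))) in Hg.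
  pose proof (has_clim_plus F _ _ _ _ Hf Hg) as H. cbv beta in H.
  replace (l - m)%C with (l + RtoC (-1) * m)%C by (apply C_ext; simpl; ring).
  eapply has_clim_ext; [exact FF| |exact H]. intros u. apply C_ext; simpl; ring.
Qed.

Lemma has_clim_unique {U : Type} (F : (U -> Prop) -> Prop) {FF : ProperFilter F}
  (f : U -> C) (l m : C) : has_clim f F l -> has_clim f F m -> l = m.
Proof.
  intros H1 H2. apply Ceq_minus, Cmod_eq_0, Rle_antisym; [|apply Cmod_ge_0].
  apply Rle_plus_epsilon. intros eps He. assert (He2 : 0 < eps / 2) by lra.
  destruct (filter_ex _ (filter_and _ _ (H1 _ He2) (H2 _ He2)))
    as (u & Hu1 & Hu2).
  replace (l - m)%C with ((f u - m) - (f u - l))%C by ring.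
  eapply Rle_trans; [apply Cmod_minus_le|]. lra.
Qed.

Lemma has_clim_0_bound {U : Type} (F : (U -> Prop) -> Prop) {FF : Filter F}
  (f : U -> C) (r : U -> R) :
  F (fun u => Cmod (f u) <= r u) -> filterlim r F (locally 0) -> has_clim f F 0.
Proof.
  intros H Hr eps He.
  assert (Hr' : F (fun u => ball 0 eps (r u)))
    by exact (Hr _ (locally_ball 0 (mkposreal eps He))).
  eapply filter_imp; [|exact (filter_and _ _ H Hr')].
  intros u [H1 H2]. replace (f u - 0)%C with (f u) by ring.
  unfold ball in H2; simpl in H2; unfold AbsRing_ball, abs, minus, plus, opp in H2;
    simpl in H2.
  pose proof (Rle_abs (r u + - 0)). lra.
Qed.

(** From [Cexp g - Cexp f = Cexp f (Cexp (g - f) - 1)] and the bound on [Cexp f], convergence of the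
    exponents is enough. The integrands in [t = e^v] are pure exponentials, so every later passage
    to the limit compares exponents only. *)
Lemma cint_exp_lim {U : Type} (F : (U -> Prop) -> Prop) {FF : ProperFilter F}
  (f : U -> R -> C) (g : R -> C) (K d : R) :
  F (fun u => cdom K d (fun v => Cexp (f u v))) -> (forall v, ccontinuous g v) ->
  (forall N eps, 0 < eps -> F (fun u => forall v, Rabs v <= N -> Cmod (f u v - g v) < eps)) ->
  has_clim (fun u => cint (fun v => Cexp (f u v))) F (cint (fun v => Cexp (g v))).
Proof.
  intros Hf Hg H.
  apply (cint_lim F (fun u v => Cexp (f u v)) (fun v => Cexp (g v)) K d Hf).
  { intros v. now apply ccontinuous_Cexp. }
  intros N eps He. destruct (filter_ex _ Hf) as (u0 & Hu0).
  pose proof (cdom_K_ge_0 _ _ _ Hu0) as HK.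
  (* For [r < e <= 1] one has [2 r exp r <= 6 e], and [6 e (K + 1)] stays below [eps]. *)
  set (e := Rmin 1 (eps / (7 * (K + 1)))).
  assert (H0 : 0 < eps / (7 * (K + 1))) by (apply Rdiv_lt_0_compat; lra).
  assert (He1 : 0 < e) by (apply Rmin_glb_lt; lra).
  eapply filter_imp; [|exact (filter_and _ _ Hf (H N e He1))].
  intros u [(_ & Hd & H1) H2] v Hv. specialize (H1 v). specialize (H2 v Hv).
  replace (Cexp (f u v) - Cexp (g v))%C with (- (Cexp (f u v) * (Cexp (g v - f u v) - 1)))%C.
  2: { replace (Cexp (g v)) with (Cexp (f u v) * Cexp (g v - f u v))%C.
       - ring.
       - rewrite <- Cexp_plus. f_equal. ring. }
  rewrite Cmod_opp, Cmod_mult.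
  pose proof (Cexp_minus_1_le (g v - f u v)) as H3.
  rewrite (Cmod_minus_sym (g v)) in H3.
  set (r := Cmod (f u v - g v)) in *.
  assert (Hr : 0 <= r) by apply Cmod_ge_0.
  assert (He3 : e <= 1) by apply Rmin_l.
  assert (H4 : exp r <= 3).
  { eapply Rle_trans; [|apply exp_le_3]. apply exp_le. lra. }
  assert (H5 : Cmod (Cexp (f u v)) <= K + 1).
  { eapply Rle_trans; [apply H1|]. apply Rle_trans with (K * 1); [|lra].
    apply Rmult_le_compat_l; [exact HK|]. rewrite <- exp_0. apply exp_le.
    pose proof (Rabs_pos v). nra. }
  assert (H6 : e * (K + 1) <= eps / 7).
  { apply Rle_trans with (eps / (7 * (K + 1)) * (K + 1)).
    - apply Rmult_le_compat_r; [lra|apply Rmin_r].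
    - right. field. lra. }
  pose proof (exp_pos r). pose proof (Cmod_ge_0 (Cexp (f u v))).
  pose proof (Cmod_ge_0 (Cexp (g v - f u v) - 1)).
  assert (2 * r * exp r <= 6 * e) by nra.
  apply Rle_lt_trans with ((K + 1) * (6 * e)); [|nra].
  apply Rmult_le_compat; lra.
Qed.

(** * Integrals of [e^(-x t) t^(p-1) (1+t)^q] over [t > 0] *)

Lemma ln_1p_exp_ge_0 (y : R) : 0 <= y -> 0 <= ln (1 + y).
Proof. intros H. rewrite <- ln_1. apply ln_le; lra. Qed.

Lemma ln_1p_le (y : R) : 0 <= y -> ln (1 + y) <= y.
Proof.
  intros H. rewrite <- (ln_exp y) at 2. apply ln_le; [lra|]. apply exp_ineq1_le.
Qed.

Lemma ln_1p_ge (y : R) : 0 <= y -> y - y ^ 2 <= ln (1 + y).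
Proof.
  intros H. assert (H1 : - ln (1 + y) <= / (1 + y) - 1).
  { rewrite <- ln_Rinv by lra. pose proof (exp_ineq1_le (ln (/ (1 + y)))) as H1.
    rewrite exp_ln in H1 by (apply Rinv_0_lt_compat; lra). lra. }
  assert (H2 : / (1 + y) <= 1 - y + y ^ 2).
  { apply Rmult_le_reg_l with (1 + y); [lra|]. rewrite Rinv_r by lra. nra. }
  lra.
Qed.

(** The substitution [t = e^v] makes all integrands smooth on the real line. *)
Definition kernel (p q : C) (x v : R) : C :=
  Cexp (p * RtoC v + q * RtoC (ln (1 + exp v)) - RtoC (x * exp v)).

Definition kint (p q : C) (x : R) : C := cint (kernel p q x).

Definition gammaint (p : C) : C := kint p 0 1.

(** Euler's beta integral in the form $\int_0^\infty t^{p-1}(1+t)^{-p-q}\,dt$. As the case [x = 0]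
    of [kint] it inherits the splitting and integration by parts of that family. *)
Definition betaint (p q : C) : C := kint p (- (p + q)) 0.

Lemma is_derive_ln_1p_exp (v : R) :
  is_derive (fun v => ln (1 + exp v)) v (exp v / (1 + exp v)).
Proof.
  pose proof (exp_pos v). auto_derive; [lra|]. field. lra.
Qed.

Lemma Cexp_RtoC_ln (r : R) : 0 < r -> Cexp (RtoC (ln r)) = RtoC r.
Proof. intros H. now rewrite Cexp_RtoC, exp_ln. Qed.

Lemma kernel_succ_l (p q : C) (x v : R) :
  kernel (p + 1) q x v = (RtoC (exp v) * kernel p q x v)%C.
Proof.
  unfold kernel. rewrite <- Cexp_RtoC, <- Cexp_plus. f_equal. ring.
Qed.

Lemma kernel_succ_r (p q : C) (x v : R) :
  kernel p (q + 1) x v = (RtoC (1 + exp v) * kernel p q x v)%C.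
Proof.
  unfold kernel. pose proof (exp_pos v).
  rewrite <- (Cexp_RtoC_ln (1 + exp v)), <- Cexp_plus by lra. f_equal. ring.
Qed.

Lemma kernel_continuous (p q : C) (x v : R) : ccontinuous (kernel p q x) v.
Proof.
  unfold kernel. pose proof (exp_pos v). apply ccontinuous_Cexp.
  apply ccontinuous_minus; [apply ccontinuous_plus|].
  - apply ccontinuous_scal, ccontinuous_RtoC, continuous_id.
  - apply ccontinuous_scal, ccontinuous_RtoC.
    eapply is_derive_continuous, is_derive_ln_1p_exp.
  - apply ccontinuous_RtoC. eapply is_derive_continuous. auto_derive; [exact I|reflexivity].
Qed.

Lemma cderive_kernel (p q : C) (x v : R) :
  cderive (kernel p q x) v
    (p * kernel p q x v + q * kernel (p + 1) (q - 1) x v - RtoC x * kernel (p + 1) q x v).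
Proof.
  unfold kernel at 1. pose proof (exp_pos v). eapply cderive_eq.
  - apply cderive_Cexp. apply cderive_minus; [apply cderive_plus|].
    + apply cderive_scal, cderive_RtoC, (is_derive_id (K := R_AbsRing)).
    + apply cderive_scal, cderive_RtoC, is_derive_ln_1p_exp.
    + apply cderive_RtoC. instantiate (1 := x * exp v).
      auto_derive; [exact I|]. ring.
  - cbv beta. fold (kernel p q x v). rewrite !kernel_succ_l.
    (* Differentiating the logarithm produces [exp v / (1 + exp v)]; lowering [q] by one clears this
       denominator. *)
    replace (kernel p q x v) with (RtoC (1 + exp v) * kernel p (q - 1) x v)%C.
    + rewrite RtoC_div, RtoC_mult, RtoC_plus by lra. change (@one R_AbsRing) with 1.
      field. apply Re_neq_0. simpl. lra.
    + rewrite <- kernel_succ_r. f_equal. ring.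
Qed.

Lemma Cmod_kernel (p q : C) (x v : R) :
  Cmod (kernel p q x v) = exp (Re p * v + Re q * ln (1 + exp v) - x * exp v).
Proof.
  unfold kernel. rewrite Cmod_Cexp. f_equal.
  rewrite Re_Cminus, Re_Cplus, !Re_Cmult, !re_RtoC, !im_RtoC. ring.
Qed.

Lemma ln_1p_exp_le (v : R) : 0 <= v -> ln (1 + exp v) <= v + 1.
Proof.
  intros Hv. rewrite <- (ln_exp (v + 1)). pose proof (exp_pos v). apply ln_le; [lra|].
  rewrite exp_plus. pose proof (exp_ineq1_le 1).
  assert (1 <= exp v) by (rewrite <- exp_0; apply exp_le, Hv). nra.
Qed.

Lemma ln_1p_exp_ge (v : R) : v <= ln (1 + exp v).
Proof. rewrite <- (ln_exp v) at 1. pose proof (exp_pos v). apply ln_le; lra. Qed.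

Lemma ln_1p_exp_le_1 (v : R) : v <= 0 -> 0 <= ln (1 + exp v) <= 1.
Proof.
  intros Hv. pose proof (exp_pos v).
  assert (exp v <= 1) by (rewrite <- exp_0; now apply exp_le). split.
  - apply ln_1p_exp_ge_0; lra.
  - eapply Rle_trans; [apply ln_1p_le; lra|lra].
Qed.

Lemma exp_ge_quad (v : R) : 0 <= v -> v ^ 2 / 4 <= exp v.
Proof.
  intros Hv. replace v with (v / 2 + v / 2) at 2 by field. rewrite exp_plus.
  pose proof (exp_ineq1_le (v / 2)). nra.
Qed.

(** Maximum of a quadratic, attained at [v = 2 b / c]. Together with [exp_ge_quad] it lets [exp v]
    in the exponent absorb any linear term. *)
Lemma quad_bound (b c v : R) : 0 < c -> b * v - c * (v ^ 2 / 4) <= b ^ 2 / c.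
Proof.
  intros Hc. apply Rmult_le_reg_l with c; [exact Hc|].
  replace (c * (b ^ 2 / c)) with (b ^ 2) by (field; lra).
  pose proof (pow2_ge_0 (c * v / 2 - b)). nra.
Qed.

Lemma kernel_exponent_le_neg (P Q x d Q1 v : R) :
  d <= P -> Rabs Q <= Q1 -> 0 <= x -> v <= 0 ->
  P * v + Q * ln (1 + exp v) - x * exp v <= Q1 - d * Rabs v.
Proof.
  intros HP HQ Hx Hv. rewrite Rabs_left1 by exact Hv.
  pose proof (ln_1p_exp_le_1 v Hv). pose proof (exp_pos v).
  pose proof (Rle_abs Q). pose proof (Rabs_pos Q).
  assert (Q * ln (1 + exp v) <= Q1 * 1) by nra. nra.
Qed.

(** For [v <= 0] the decay comes from [e^(p v)], for [v > 0] from [e^(-x e^v)]. The majorant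
    involves only the bounds [P1], [Q1], [x0], so it is uniform over families of parameters. *)
Lemma kernel_cdom_pos (p q : C) (x x0 d P1 Q1 : R) :
  0 < d <= Re p -> Re p <= P1 -> Rabs (Re q) <= Q1 -> 0 < x0 <= x ->
  cdom (exp (Q1 + (P1 + Q1 + d) ^ 2 / x0)) d (kernel p q x).
Proof.
  intros Hd HP HQ Hx. split; [apply kernel_continuous|split; [lra|]].
  intros v. rewrite Cmod_kernel, <- exp_plus. apply exp_le.
  destruct (Rle_dec v 0) as [Hv|Hv].
  - pose proof (kernel_exponent_le_neg (Re p) (Re q) x d Q1 v ltac:(lra) HQ ltac:(lra) Hv).
    assert (0 <= (P1 + Q1 + d) ^ 2 / x0) by (apply Rdiv_le_0_compat; [apply pow2_ge_0|lra]).
    lra.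
  - rewrite Rabs_pos_eq by lra.
    pose proof (quad_bound (P1 + Q1 + d) x0 v ltac:(lra)).
    pose proof (exp_ge_quad v ltac:(lra)). pose proof (ln_1p_exp_le v ltac:(lra)).
    pose proof (ln_1p_exp_ge v). pose proof (Rle_abs (Re q)).
    pose proof (Rabs_pos (Re q)).
    assert (Re q * ln (1 + exp v) <= Q1 * (v + 1)).
    { apply Rle_trans with (Q1 * ln (1 + exp v)).
      - apply Rmult_le_compat_r; lra.
      - apply Rmult_le_compat_l; lra. }
    assert (Re p * v <= P1 * v) by (apply Rmult_le_compat_r; lra).
    assert (x0 * (v ^ 2 / 4) <= x * exp v).
    { apply Rmult_le_compat; try lra. pose proof (pow2_ge_0 v); lra. }
    nra.
Qed.

(** The decay for [v > 0] now comes from [Re (p + q) < 0] alone. The majorant does not depend on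
    [x >= 0], which permits the limit [x -> 0]. *)
Lemma kernel_cdom_0 (p q : C) (x d : R) :
  0 < d <= Re p -> Re (p + q) <= - d -> 0 <= x ->
  cdom (exp (Rabs (Re q))) d (kernel p q x).
Proof.
  intros Hd HP Hx. rewrite Re_Cplus in HP. split; [apply kernel_continuous|split; [lra|]].
  intros v. rewrite Cmod_kernel, <- exp_plus. apply exp_le.
  destruct (Rle_dec v 0) as [Hv|Hv].
  - pose proof (kernel_exponent_le_neg (Re p) (Re q) x d (Rabs (Re q)) v ltac:(lra)
      (Rle_refl _) ltac:(lra) Hv). lra.
  - rewrite (Rabs_pos_eq v), Rabs_left by lra.
    pose proof (ln_1p_exp_le v ltac:(lra)). pose proof (ln_1p_exp_ge v).
    pose proof (exp_pos v).
    assert (Re q * ln (1 + exp v) <= Re q * v) by nra.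
    assert ((Re p + Re q) * v <= - d * v) by (apply Rmult_le_compat_r; lra).
    assert (0 <= x * exp v) by (apply Rmult_le_pos; lra). lra.
Qed.

Lemma kernel_cnice_pos (p q : C) (x : R) : 0 < Re p -> 0 < x -> cnice (kernel p q x).
Proof.
  intros Hp Hx. do 2 eexists.
  apply (kernel_cdom_pos p q x x (Re p) (Re p) (Rabs (Re q))); lra.
Qed.

Lemma kernel_cnice_0 (p q : C) : 0 < Re p -> Re (p + q) < 0 -> cnice (kernel p q 0).
Proof.
  intros Hp Hq. do 2 eexists.
  apply (kernel_cdom_0 p q 0 (Rmin (Re p) (- Re (p + q)))); [split|..].
  - apply Rmin_glb_lt; lra.
  - apply Rmin_l.
  - pose proof (Rmin_r (Re p) (- Re (p + q))). lra.
  - lra.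
Qed.

Lemma kint_succ (p q : C) (x : R) :
  cnice (kernel p q x) -> cnice (kernel (p + 1) q x) ->
  kint p (q + 1) x = (kint p q x + kint (p + 1) q x)%C.
Proof.
  intros H1 H2. unfold kint. rewrite <- cint_plus by assumption.
  apply cint_ext. intros v. rewrite kernel_succ_r, kernel_succ_l, RtoC_plus. ring.
Qed.

(** The left side is the integral of the derivative of [kernel p q x], which vanishes at both
    ends. *)
Lemma kint_ibp (p q : C) (x : R) :
  0 < Re p -> 0 < x ->
  (p * kint p q x + q * kint (p + 1) (q - 1) x - RtoC x * kint (p + 1) q x = 0)%C.
Proof.
  intros Hp Hx. unfold kint.
  assert (Hp1 : 0 < Re (p + 1)) by (rewrite Re_Cplus; simpl; lra).
  rewrite <- !cint_scal by (apply kernel_cnice_pos; assumption).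
  rewrite <- cint_plus, <- cint_minus
    by auto using cnice_plus, cnice_scal, kernel_cnice_pos.
  apply (cint_derive_0 _ (kernel p q x)).
  - intros v. apply cderive_kernel.
  - now apply kernel_cnice_pos.
  - auto using cnice_minus, cnice_plus, cnice_scal, kernel_cnice_pos.
Qed.

Lemma kint_ibp_0 (p q : C) :
  0 < Re p -> Re (p + q) < 0 ->
  (p * kint p q 0 + q * kint (p + 1) (q - 1) 0 = 0)%C.
Proof.
  intros Hp Hq. unfold kint.
  assert (Hp1 : 0 < Re (p + 1)) by (rewrite Re_Cplus; simpl; lra).
  assert (Hq1 : Re (p + 1 + (q - 1)) < 0)
    by (replace (p + 1 + (q - 1))%C with (p + q)%C by ring; exact Hq).
  assert (N1 : cnice (kernel p q 0)) by now apply kernel_cnice_0.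
  assert (N2 : cnice (kernel (p + 1) (q - 1) 0)) by now apply kernel_cnice_0.
  rewrite <- !cint_scal, <- cint_plus by auto using cnice_scal.
  apply (cint_derive_0 _ (kernel p q 0)); auto using cnice_plus, cnice_scal.
  intros v. eapply cderive_eq; [apply cderive_kernel|]. cring.
Qed.

(** Elimination between integration by parts at [x = 0] and the splitting of one factor [1 + t]. *)
Lemma betaint_succ (p q : C) :
  0 < Re p -> 0 < Re q -> (q * betaint p q = (p + q) * betaint p (q + 1))%C.
Proof.
  intros Hp Hq. unfold betaint.
  assert (H1 : Re (p + - (p + q)) < 0) by (simpl; unfold Re in *; lra).
  pose proof (kint_ibp_0 p (- (p + q)) Hp H1) as E1.
  pose proof (kint_succ p (- (p + q) - 1) 0) as E2.
  replace (- (p + q) - 1 + 1)%C with (- (p + q))%C in E2 by ring.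
  replace (- (p + (q + 1)))%C with (- (p + q) - 1)%C by ring.
  rewrite E2 in E1 |- *; try (apply kernel_cnice_0; simpl; unfold Re in *; lra).
  set (A := kint p (- (p + q) - 1) 0) in *. set (B := kint (p + 1) (- (p + q) - 1) 0) in *.
  replace (q * (A + B))%C with
    ((p + q) * A - (p * (A + B) + - (p + q) * B))%C by ring. rewrite E1. ring.
Qed.

(** * The Gamma function *)

Definition gauss (z : C) (n : nat) : C :=
  (pochhammer z (S n) / (RtoC (INR (fact n)) * Rcpow (INR n) z))%C.

Lemma has_clim_RtoC {U : Type} (F : (U -> Prop) -> Prop) {FF : Filter F} (f : U -> R) (l : R) :
  filterlim f F (locally l) -> has_clim (fun u => RtoC (f u)) F (RtoC l).
Proof.
  intros H eps He.
  assert (H' : F (fun u => ball l eps (f u)))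
    by exact (H _ (locally_ball l (mkposreal eps He))).
  eapply filter_imp; [|exact H']. intros u Hu.
  rewrite <- RtoC_minus, Cmod_R. exact Hu.
Qed.

Lemma is_lim_seq_inv_INR : is_lim_seq (fun n => / INR n) 0.
Proof.
  apply (is_lim_seq_inv _ p_infty); [apply is_lim_seq_INR|easy].
Qed.

Lemma pochhammer_S (a : C) (n : nat) :
  pochhammer a (S n) = (pochhammer a n * (a + RtoC (INR n)))%C.
Proof. reflexivity. Qed.

Lemma pochhammer_plus_1 (a : C) (n : nat) :
  pochhammer a (S n) = (a * pochhammer (a + 1) n)%C.
Proof.
  induction n as [|n IH].
  - simpl. ring.
  - change (pochhammer a (S n) * (a + RtoC (INR (S n))) =
      a * (pochhammer (a + 1) n * (a + 1 + RtoC (INR n))))%C.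
    rewrite IH, S_INR, RtoC_plus. ring.
Qed.

Lemma pochhammer_1 (n : nat) : pochhammer 1 n = RtoC (INR (fact n)).
Proof.
  induction n as [|n IH]; [reflexivity|].
  change (pochhammer 1 n * (1 + RtoC (INR n)) = RtoC (INR (fact (S n))))%C.
  rewrite IH, fact_simpl, mult_INR, S_INR, RtoC_mult, RtoC_plus. ring.
Qed.

Lemma INR_fact_neq_0' (n : nat) : RtoC (INR (fact n)) <> 0%C.
Proof. apply RtoC_neq_0, INR_fact_neq_0. Qed.

(** The increments are dominated by those of [- K / n], so their sums telescope. *)
Lemma Csequence_cauchy (g : nat -> C) (K : R) :
  0 <= K ->
  (forall n, (1 <= n)%nat -> Cmod (g (S n) - g n) <= K * (/ INR n - / INR (S n))) ->
  exists l, has_clim g eventually l.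
Proof.
  intros HK H.
  assert (H1 : forall n k, (1 <= n)%nat ->
    Cmod (g (n + k)%nat - g n) <= K * (/ INR n - / INR (n + k))).
  { intros n k Hn. induction k as [|k IH].
    - rewrite Nat.add_0_r. replace (g n - g n)%C with (RtoC 0) by ring. rewrite Cmod_0. lra.
    - replace (n + S k)%nat with (S (n + k)) by lia.
      replace (g (S (n + k)) - g n)%C with ((g (S (n + k)) - g (n + k)%nat) + (g (n + k)%nat - g n))%C by ring.
      eapply Rle_trans; [apply Cmod_triangle|].
      specialize (H (n + k)%nat ltac:(lia)). lra. }
  assert (H2 : forall n m, (1 <= n <= m)%nat -> Cmod (g m - g n) <= K * / INR n).
  { intros n m Hnm. replace m with (n + (m - n))%nat by lia.
    eapply Rle_trans; [apply H1; lia|]. apply Rmult_le_compat_l; [exact HK|].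
    assert (0 < / INR (n + (m - n))) by (apply Rinv_0_lt_compat, lt_0_INR; lia). lra. }
  assert (Hc : forall p : C -> R, (forall z w, Rabs (p z - p w) <= Cmod (z - w)) ->
    exists l, is_lim_seq (fun n => p (g n)) (Finite l)).
  { intros p Hp. apply ex_lim_seq_cauchy_corr. intros eps.
    destruct (proj2 (is_lim_seq_spec _ _) is_lim_seq_inv_INR
      (mkposreal (eps / (K + 1)) ltac:(apply Rdiv_lt_0_compat; [apply cond_pos|lra]))) as (N & HN).
    simpl in HN.
    assert (Hs : forall n m, (S N <= n <= m)%nat -> Rabs (p (g m) - p (g n)) < eps).
    { intros n m Hnm. eapply Rle_lt_trans; [apply Hp|].
      eapply Rle_lt_trans; [apply H2; lia|].
      specialize (HN n ltac:(lia)). rewrite Rminus_0_r in HN.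
      assert (Hi : 0 < / INR n) by (apply Rinv_0_lt_compat, lt_0_INR; lia).
      rewrite Rabs_pos_eq in HN by lra.
      apply Rle_lt_trans with ((K + 1) * / INR n); [nra|].
      apply Rmult_lt_compat_l with (r := K + 1) in HN; [|lra].
      replace ((K + 1) * (eps / (K + 1))) with (pos eps) in HN by (field; lra). exact HN. }
    exists (S N). intros n m Hn Hm. destruct (Nat.le_ge_cases n m).
    - rewrite Rabs_minus_sym. apply Hs; lia.
    - apply Hs; lia. }
  destruct (Hc Re (fun z w => Re_le_Cmod (z - w))) as (a & Ha).
  destruct (Hc Im (fun z w => Im_le_Cmod (z - w))) as (b & Hb).
  exists (a, b). intros eps He.
  assert (He2 : 0 < eps / 2) by lra.
  assert (Ha' := proj2 (is_lim_seq_spec _ _) Ha (mkposreal _ He2)).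
  assert (Hb' := proj2 (is_lim_seq_spec _ _) Hb (mkposreal _ He2)).
  simpl in Ha', Hb'.
  eapply filter_imp; [|exact (filter_and _ _ Ha' Hb')].
  intros n [E1 E2]. eapply Rle_lt_trans; [apply Cmod_le_parts|].
  rewrite Re_Cminus, Im_Cminus. simpl. lra.
Qed.

Lemma gauss_succ (z : C) (n : nat) :
  (1 <= n)%nat ->
  gauss z (S n) = (gauss z n * ((1 + z / RtoC (INR (S n)))
                     * Cexp (- (z * RtoC (ln (1 + / INR n))))))%C.
Proof.
  intros Hn. unfold gauss.
  assert (H0 : 0 < INR n) by (apply lt_0_INR; lia).
  change (pochhammer z (S (S n))) with (pochhammer z (S n) * (z + RtoC (INR (S n))))%C.
  rewrite fact_simpl, mult_INR, RtoC_mult.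
  assert (E : Rcpow (INR (S n)) z = (Rcpow (INR n) z * Cexp (z * RtoC (ln (1 + / INR n))))%C).
  { unfold Rcpow. rewrite <- Cexp_plus. f_equal. rewrite <- Cmult_plus_distr_l.
    f_equal. rewrite <- RtoC_plus. f_equal.
    assert (0 < / INR n) by now apply Rinv_0_lt_compat.
    rewrite <- ln_mult by lra. f_equal. rewrite S_INR. field. lra. }
  rewrite E, Cexp_opp.
  assert (RtoC (INR (S n)) <> 0%C) by (apply RtoC_neq_0; rewrite S_INR; lra).
  field. repeat split; auto using INR_fact_neq_0', Rcpow_neq_0, Cexp_neq_0.
Qed.

(** The ratio of consecutive terms is $(1+\frac{z}{n+1})(1+\frac1n)^{-z}$; the first-order
    contributions [z / (n+1)] and [- z ln (1 + 1/n)] cancel up to order [1 / n^2]. *)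
Lemma gauss_factor_bound (z : C) (n : nat) :
  (1 <= n)%nat ->
  Cmod ((1 + z / RtoC (INR (S n))) * Cexp (- (z * RtoC (ln (1 + / INR n)))) - 1)
    <= (2 * Cmod z + Cmod z ^ 2 + 4 * (1 + Cmod z) * (Cmod z ^ 2 * exp (Cmod z)))
       * (/ INR n) ^ 2.
Proof.
  intros Hn. assert (H0 : 1 <= INR n) by (change 1 with (INR 1); now apply le_INR).
  set (y := / INR n). set (l := ln (1 + y)).
  assert (Hy : 0 < y <= 1).
  { split; [apply Rinv_0_lt_compat; lra|]. rewrite <- Rinv_1. apply Rinv_le_contravar; lra. }
  pose proof (ln_1p_le y ltac:(lra)) as L1. pose proof (ln_1p_ge y ltac:(lra)) as L2.
  pose proof (ln_1p_exp_ge_0 y ltac:(lra)) as L3. fold l in L1, L2, L3.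
  set (s := / INR (S n)).
  assert (Hs : 0 < s) by (apply Rinv_0_lt_compat; rewrite S_INR; lra).
  assert (Hys : y - s = y * s) by (unfold y, s; rewrite S_INR; field; lra).
  assert (Hs2 : s <= y) by nra.
  assert (Hd : Rabs (s - l) <= 2 * y ^ 2) by (apply Rabs_le; nra).
  replace (z / RtoC (INR (S n)))%C with (z * RtoC s)%C
    by (unfold s; rewrite RtoC_inv by (rewrite S_INR; lra); reflexivity).
  replace (_ - 1)%C with
    ((1 + z * RtoC s) * (Cexp (- (z * RtoC l)) - 1 - (- (z * RtoC l)))
     + (z * RtoC (s - l) - z * z * RtoC (l * s)))%C
    by (rewrite RtoC_minus, RtoC_mult; ring).
  pose proof (Cmod_ge_0 z) as Hz. set (Z := Cmod z) in *.
  eapply Rle_trans; [apply Cmod_triangle|].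
  assert (B1 : Cmod (z * RtoC (s - l) - z * z * RtoC (l * s)) <= Z * (2 * y ^ 2) + Z ^ 2 * y ^ 2).
  { eapply Rle_trans; [apply Cmod_minus_le|]. rewrite !Cmod_mult, !Cmod_R. fold Z.
    rewrite (Rabs_pos_eq (l * s)) by (apply Rmult_le_pos; lra).
    apply Rplus_le_compat; [apply Rmult_le_compat_l; lra|].
    replace (Z ^ 2) with (Z * Z) by ring. apply Rmult_le_compat_l; nra. }
  assert (B2 : Cmod (- (z * RtoC l)) <= Z * y).
  { rewrite Cmod_opp, Cmod_mult, Cmod_R, Rabs_pos_eq by lra. apply Rmult_le_compat_l; lra. }
  assert (B3 : Cmod (Cexp (- (z * RtoC l)) - 1 - (- (z * RtoC l))) <= 4 * (Z * y) ^ 2 * exp Z).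
  { eapply Rle_trans; [apply Cexp_minus_1_minus_le|].
    pose proof (Cmod_ge_0 (- (z * RtoC l))).
    apply Rmult_le_compat.
    - pose proof (pow2_ge_0 (Cmod (- (z * RtoC l)))); lra.
    - left; apply exp_pos.
    - apply Rmult_le_compat_l; [lra|]. apply pow_incr; lra.
    - apply exp_le. nra. }
  assert (B4 : Cmod (1 + z * RtoC s) <= 1 + Z).
  { eapply Rle_trans; [apply Cmod_triangle|]. rewrite Cmod_1, Cmod_mult, Cmod_R.
    rewrite Rabs_pos_eq by lra. fold Z. nra. }
  rewrite Cmod_mult.
  apply Rle_trans with ((1 + Z) * (4 * (Z * y) ^ 2 * exp Z) + (Z * (2 * y ^ 2) + Z ^ 2 * y ^ 2)).
  - apply Rplus_le_compat; [|exact B1].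
    apply Rmult_le_compat; auto using Cmod_ge_0.
  - right. ring.
Qed.

Lemma gauss_converges (z : C) : exists l, has_clim (gauss z) eventually l.
Proof.
  set (c := 2 * Cmod z + Cmod z ^ 2 + 4 * (1 + Cmod z) * (Cmod z ^ 2 * exp (Cmod z))).
  assert (Hc : 0 <= c).
  { pose proof (Cmod_ge_0 z). pose proof (exp_pos (Cmod z)). pose proof (pow2_ge_0 (Cmod z)).
    unfold c. assert (0 <= Cmod z ^ 2 * exp (Cmod z)) by (apply Rmult_le_pos; lra). nra. }
  (* The factor 2 comes from [1/n^2 <= 2 (1/n - 1/(n+1))], which puts the bound in telescoping
     form. *)
  assert (Hstep : forall n, (1 <= n)%nat ->
    Cmod (gauss z (S n) - gauss z n) <= Cmod (gauss z n) * (2 * c * (/ INR n - / INR (S n)))).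
  { intros n Hn. rewrite gauss_succ by exact Hn.
    replace (gauss z n * _ - gauss z n)%C with
      (gauss z n * ((1 + z / RtoC (INR (S n))) * Cexp (- (z * RtoC (ln (1 + / INR n)))) - 1))%C
      by ring.
    rewrite Cmod_mult. apply Rmult_le_compat_l; [apply Cmod_ge_0|].
    eapply Rle_trans; [apply gauss_factor_bound, Hn|]. fold c.
    assert (H0 : 1 <= INR n) by (change 1 with (INR 1); now apply le_INR).
    replace (/ INR n - / INR (S n)) with (/ INR n * / (INR n + 1))
      by (rewrite S_INR; field; lra).
    replace (2 * c * (/ INR n * / (INR n + 1))) with (c * (/ INR n * (2 * / (INR n + 1)))) by ring.
    apply Rmult_le_compat_l; [exact Hc|].
    assert (0 < / INR n) by (apply Rinv_0_lt_compat; lra).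
    replace ((/ INR n) ^ 2) with (/ INR n * / INR n) by ring.
    apply Rmult_le_compat_l; [lra|].
    apply Rmult_le_reg_r with (INR n * (INR n + 1)); [nra|].
    field_simplify; lra. }
  set (B := Cmod (gauss z 1) * exp (2 * c)).
  (* The increments are relative to [Cmod (gauss z n)], so boundedness comes first. Multiplied by
     [exp (2 c / n)] the moduli no longer increase: a step costs at most [1 + e <= exp e], and the
     compensating factor shrinks by exactly [exp e]. *)
  assert (Hb : forall n, (1 <= n)%nat -> Cmod (gauss z n) * exp (2 * c * / INR n) <= B).
  { intros n Hn. induction Hn as [|n Hn IH].
    - simpl. rewrite Rinv_1, Rmult_1_r. apply Rle_refl.
    - eapply Rle_trans; [|exact IH].
      set (e := 2 * c * (/ INR n - / INR (S n))).
      assert (H1 : Cmod (gauss z (S n)) <= Cmod (gauss z n) * (1 + e)).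
      { replace (gauss z (S n)) with (gauss z n + (gauss z (S n) - gauss z n))%C by ring.
        eapply Rle_trans; [apply Cmod_triangle|]. specialize (Hstep n Hn). fold e in Hstep. lra. }
      replace (2 * c * / INR n) with (e + 2 * c * / INR (S n)) by (unfold e; ring).
      rewrite exp_plus, <- Rmult_assoc. apply Rmult_le_compat_r; [left; apply exp_pos|].
      eapply Rle_trans; [exact H1|].
      apply Rmult_le_compat_l; [apply Cmod_ge_0|apply exp_ineq1_le]. }
  assert (Hb' : forall n, (1 <= n)%nat -> Cmod (gauss z n) <= B).
  { intros n Hn. eapply Rle_trans; [|apply Hb, Hn].
    rewrite <- (Rmult_1_r (Cmod (gauss z n))) at 1.
    apply Rmult_le_compat_l; [apply Cmod_ge_0|]. rewrite <- exp_0. apply exp_le.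
    assert (0 < / INR n) by (apply Rinv_0_lt_compat, lt_0_INR; lia).
    apply Rmult_le_pos; lra. }
  apply (Csequence_cauchy (gauss z) (B * (2 * c))).
  - apply Rmult_le_pos; [|lra]. eapply Rle_trans; [apply (Cmod_ge_0 (gauss z 1))|apply Hb'; lia].
  - intros n Hn. eapply Rle_trans; [apply Hstep, Hn|]. rewrite (Rmult_assoc B).
    apply Rmult_le_compat_r; [|apply Hb', Hn].
    apply Rmult_le_pos; [lra|].
    assert (/ INR (S n) <= / INR n).
    { apply Rinv_le_contravar; [apply lt_0_INR; lia|apply le_INR; lia]. }
    lra.
Qed.

(** Convergence turns the total componentwise limit in the definition of [rGamma] into a genuine
    one. *)
Lemma rGamma_lim (z : C) : has_clim (gauss z) eventually (rGamma z).
Proof.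
  destruct (gauss_converges z) as (l & Hl).
  replace (rGamma z) with l; [exact Hl|].
  apply C_ext; unfold rGamma, CLim_seq; simpl; symmetry.
  - assert (H : is_lim_seq (fun n => Re (gauss z n)) (Re l)) by now apply has_clim_Re; [typeclasses eauto|].
    apply (f_equal real (is_lim_seq_unique _ _ H)).
  - assert (H : is_lim_seq (fun n => Im (gauss z n)) (Im l)) by now apply has_clim_Im; [typeclasses eauto|].
    apply (f_equal real (is_lim_seq_unique _ _ H)).
Qed.

Lemma eventually_ge (N : nat) (P : nat -> Prop) : (forall n, (N <= n)%nat -> P n) -> eventually P.
Proof. intros H; exists N; exact H. Qed.

Lemma has_clim_const_div_INR (k : C) : has_clim (fun n => k * RtoC (/ INR n))%C eventually 0.
Proof.
  replace (RtoC 0) with (k * RtoC 0)%C by ring.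
  apply has_clim_scal; [typeclasses eauto|].
  apply has_clim_RtoC; [typeclasses eauto|]. exact is_lim_seq_inv_INR.
Qed.

(** For [n >= 1] the terms satisfy $z\,g_n(z+1)=g_n(z)\,(1+\frac{z+1}{n})$ exactly. Stated for the
    reciprocal, the functional equation holds at the poles of Gamma as well. *)
Lemma rGamma_succ (z : C) : rGamma z = (z * rGamma (z + 1))%C.
Proof.
  apply (has_clim_unique eventually (fun n => z * gauss (z + 1) n)%C).
  2: { apply has_clim_scal; [typeclasses eauto|apply rGamma_lim]. }
  replace (rGamma z) with (rGamma z * (1 + 0))%C by ring.
  apply (has_clim_ext_loc eventually
    (fun n => gauss z n * (1 + (z + 1) * RtoC (/ INR n)))%C).
  2: { apply has_clim_mult; [typeclasses eauto|apply rGamma_lim|].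
       apply has_clim_plus; [typeclasses eauto|apply has_clim_const; typeclasses eauto|].
       apply has_clim_const_div_INR. }
  apply (eventually_ge 1). intros n Hn. unfold gauss.
  assert (Hn0 : 0 < INR n) by (apply lt_0_INR; lia).
  rewrite (pochhammer_plus_1 z n).
  rewrite (pochhammer_S (z + 1) n).
  rewrite Rcpow_plus, Rcpow_1, RtoC_inv by lra.
  pose proof (RtoC_neq_0 (INR n) ltac:(lra)).
  field. repeat split; auto using INR_fact_neq_0', Rcpow_neq_0.
Qed.

Lemma rGamma_1 : rGamma 1 = 1%C.
Proof.
  transitivity (1 + 0)%C; [|ring].
  apply (has_clim_unique eventually (gauss 1)); [apply rGamma_lim|].
  apply (has_clim_ext_loc eventually (fun n => 1 + 1 * RtoC (/ INR n))%C).
  2: { apply has_clim_plus; [typeclasses eauto|apply has_clim_const; typeclasses eauto|].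
       apply has_clim_const_div_INR. }
  apply (eventually_ge 1). intros n Hn. unfold gauss.
  assert (Hn0 : 0 < INR n) by (apply lt_0_INR; lia).
  rewrite (pochhammer_S 1 n).
  rewrite pochhammer_1, Rcpow_1, RtoC_inv by lra.
  pose proof (RtoC_neq_0 (INR n) ltac:(lra)).
  field. repeat split; auto using INR_fact_neq_0'.
Qed.

(** The integrand $t^{p-1}(1+t)^{-p-1}$ has the antiderivative
    $\frac1p\left(\frac{t}{1+t}\right)^p$. *)
Lemma betaint_1 (p : C) : 0 < Re p -> betaint p 1 = (/ p)%C.
Proof.
  intros Hp. assert (Hp0 : p <> 0%C) by (apply Re_neq_0; lra).
  unfold betaint, kint.
  rewrite (cint_derive _ (fun v => / p * Cexp (p * RtoC (v - ln (1 + exp v))))%C (/ p) 0).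
  - ring.
  - intros v. pose proof (exp_pos v). eapply cderive_eq.
    + apply cderive_scal, cderive_Cexp, cderive_scal, cderive_RtoC.
      apply is_derive_Rminus; [apply (is_derive_id (K := R_AbsRing))|apply is_derive_ln_1p_exp].
    + change (@one R_AbsRing) with 1.
      replace (1 - exp v / (1 + exp v)) with (/ (1 + exp v)) by (field; lra).
      transitivity (RtoC (/ (1 + exp v)) * Cexp (p * RtoC (v - ln (1 + exp v))))%C.
      { field. exact Hp0. }
      rewrite <- (exp_ln (1 + exp v)) at 1 by lra. rewrite <- exp_Ropp, <- Cexp_RtoC, <- Cexp_plus.
      unfold kernel. f_equal. rewrite RtoC_minus, RtoC_opp, Rmult_0_l. ring.
  - apply kernel_cnice_0; simpl; unfold Re in *; lra.
  - apply (has_clim_ext _ (fun v => / p + / p * (Cexp (p * RtoC (v - ln (1 + exp v))) - 1))%C).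
    { intros v. ring. }
    replace (/ p)%C with (/ p + / p * 0)%C at 1 by ring.
    apply has_clim_plus; [typeclasses eauto|apply has_clim_const; typeclasses eauto|].
    apply has_clim_scal; [typeclasses eauto|].
    (* Since [v - ln (1 + e^v) = - ln (1 + e^(-v))], the exponent is of order [e^(-v)]. *)
    apply (has_clim_0_bound _ _ (fun v => 2 * (Cmod p * exp (- v)) * exp (Cmod p))).
    + exists 0. intros v Hv.
      assert (Hw : Cmod (p * RtoC (v - ln (1 + exp v))) <= Cmod p * exp (- v)).
      { rewrite Cmod_mult, Cmod_R. apply Rmult_le_compat_l; [apply Cmod_ge_0|].
        pose proof (ln_1p_exp_ge v). rewrite Rabs_left1 by lra.
        assert (E : ln (1 + exp v) = v + ln (1 + exp (- v))).
        { pose proof (exp_pos v). pose proof (exp_pos (- v)).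
          rewrite <- (ln_exp v) at 2. rewrite <- ln_mult by lra. f_equal.
          rewrite Rmult_plus_distr_l, <- exp_plus, Rplus_opp_r, exp_0. ring. }
        rewrite E. pose proof (ln_1p_le (exp (- v)) ltac:(left; apply exp_pos)). lra. }
      assert (He : exp (- v) <= 1) by (rewrite <- exp_0; apply exp_le; lra).
      pose proof (exp_pos (- v)). pose proof (Cmod_ge_0 p).
      eapply Rle_trans; [apply Cexp_minus_1_le|].
      pose proof (Cmod_ge_0 (p * RtoC (v - ln (1 + exp v)))).
      apply Rmult_le_compat; [lra|left; apply exp_pos|lra|]. apply exp_le. nra.
    + assert (H1 : is_lim (fun v => exp (- v)) p_infty 0).
      { apply (is_lim_comp exp (fun v => - v) p_infty 0 m_infty).
        - apply is_lim_exp_m.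
        - apply (is_lim_opp (fun v => v) p_infty p_infty), is_lim_id.
        - exists 0. intros; discriminate. }
      assert (H2 : is_lim (fun v => (2 * Cmod p * exp (Cmod p)) * exp (- v)) p_infty
        (Rbar_mult (2 * Cmod p * exp (Cmod p)) 0)) by now apply is_lim_scal_l.
      simpl in H2. rewrite Rmult_0_r in H2.
      apply (is_lim_ext _ (fun v => 2 * (Cmod p * exp (- v)) * exp (Cmod p))) in H2.
      * exact H2.
      * intros v. ring.
  - replace (RtoC 0) with (/ p * 0)%C by ring. apply has_clim_scal; [typeclasses eauto|].
    apply (has_clim_0_bound _ _ (fun v => exp (Re p * v))).
    + exists 0. intros v Hv. rewrite Cmod_Cexp, Re_Cmult, re_RtoC, im_RtoC. apply exp_le.
      pose proof (ln_1p_exp_le_1 v ltac:(lra)). nra.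
    + change (is_lim (fun v => exp (Re p * v)) m_infty 0).
      apply (is_lim_comp exp (fun v => Re p * v) m_infty 0 m_infty).
      * apply is_lim_exp_m.
      * pose proof (is_lim_scal_l (fun v => v) (Re p) m_infty m_infty (is_lim_id _)) as H.
        rewrite Rbar_mult_comm in H.
        replace (Rbar_mult m_infty (Re p)) with m_infty in H; [exact H|].
        simpl. destruct (Rle_dec 0 (Re p)) as [H1|H1]; [|lra].
        destruct (Rle_lt_or_eq_dec 0 (Re p) H1); [reflexivity|lra].
      * exists 0. intros; discriminate.
Qed.

(** Iteration of [betaint_succ]. It brings the Pochhammer products of Gauss's formula into play;
    letting [n] grow identifies the Gamma integral with [1 / rGamma]. *)
Lemma betaint_pochhammer (p q : C) (n : nat) :
  0 < Re p -> 0 < Re q ->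
  (betaint p q * pochhammer q n = pochhammer (p + q) n * betaint p (q + RtoC (INR n)))%C.
Proof.
  intros Hp Hq. induction n as [|n IH].
  - simpl. replace (q + 0)%C with q by ring. ring.
  - rewrite !pochhammer_S, Cmult_assoc, IH.
    assert (H : 0 < Re (q + RtoC (INR n))).
    { rewrite Re_Cplus, re_RtoC. pose proof (pos_INR n). lra. }
    pose proof (betaint_succ p _ Hp H) as E.
    replace (q + RtoC (INR (S n)))%C with (q + RtoC (INR n) + 1)%C
      by (rewrite S_INR, RtoC_plus; ring).
    transitivity (pochhammer (p + q) n * ((q + RtoC (INR n)) * betaint p (q + RtoC (INR n))))%C;
      [ring|].
    rewrite E. ring.
Qed.

Lemma ln_1p_ge_div (s : R) : 0 <= s -> s / (1 + s) <= ln (1 + s).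
Proof.
  intros H. assert (H1 : - ln (1 + s) <= / (1 + s) - 1).
  { rewrite <- ln_Rinv by lra. pose proof (exp_ineq1_le (ln (/ (1 + s)))) as H1.
    rewrite exp_ln in H1 by (apply Rinv_0_lt_compat; lra). lra. }
  replace (s / (1 + s)) with (1 - / (1 + s)) by (field; lra). lra.
Qed.

(** The classical fact that $(1+y/n)^n$ increases with [n]. It bounds $(1+y/n)^{-n}$ by its value at
    a fixed [m], a majorant independent of [n]. *)
Lemma mul_ln_1p_div_mono (y m n : R) :
  0 <= y -> 0 < m <= n -> m * ln (1 + y / m) <= n * ln (1 + y / n).
Proof.
  intros Hy Hmn.
  assert (Hpos : forall t, 0 < t -> 0 <= y / t) by (intros; apply Rdiv_le_0_compat; lra).
  destruct (MVT_gen (fun t => t * ln (1 + y / t)) m n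
    (fun t => ln (1 + y / t) - y / t / (1 + y / t))) as (c & Hc & E).
  - intros t Ht. rewrite Rmin_left, Rmax_right in Ht by lra.
    pose proof (Hpos t ltac:(lra)). auto_derive; [split; [lra|split; [lra|exact I]]|].
    unfold Rdiv. field. lra.
  - intros t Ht. rewrite Rmin_left, Rmax_right in Ht by lra.
    pose proof (Hpos t ltac:(lra)).
    apply continuity_pt_filterlim, (ex_derive_continuous (fun t => t * ln (1 + y / t))).
    auto_derive; split; [lra|split; [lra|exact I]].
  - rewrite Rmin_left, Rmax_right in Hc by lra.
    pose proof (ln_1p_ge_div (y / c) (Hpos c ltac:(lra))).
    assert (0 <= (ln (1 + y / c) - y / c / (1 + y / c)) * (n - m)) by (apply Rmult_le_pos; lra).
    lra.
Qed.

(** Scaling [t] by [1/n] is a shift of [v] by [ln n]; it turns [(1 + t)^(-n)] into a factor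
    converging to an exponential. *)
Lemma betaint_scaled (p q : C) (n : nat) :
  (1 <= n)%nat -> 0 < Re p -> 0 < Re q ->
  (Rcpow (INR n) p * betaint p (q + RtoC (INR n)))%C =
  cint (fun v => Cexp (p * RtoC v - (p + q + RtoC (INR n)) * RtoC (ln (1 + exp v / INR n)))).
Proof.
  intros Hn Hp Hq. assert (Hn0 : 0 < INR n) by (apply lt_0_INR; lia).
  assert (HN : cnice (kernel p (- (p + (q + RtoC (INR n)))) 0)).
  { apply kernel_cnice_0; [exact Hp|]. simpl; unfold Re in *; lra. }
  unfold betaint, kint. rewrite <- (cint_shift _ (- ln (INR n)) HN), <- cint_scal.
  - apply cint_ext. intros v. unfold Rcpow, kernel. rewrite <- Cexp_plus. f_equal.
    rewrite Rmult_0_l, exp_plus, exp_Ropp, exp_ln by exact Hn0.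
    rewrite RtoC_plus, RtoC_opp. unfold Rdiv. ring.
  - destruct HN as (K & d & HN). pose proof (rnice_K_ge_0 _ _ _ (cdom_Re _ _ _ HN)).
    exists (K * exp (d * Rabs (ln (INR n)))), d. destruct HN as (H1 & H2 & H3).
    split; [|split; [exact H2|]].
    + intros v. apply (ccontinuous_comp _ (fun v => v + - ln (INR n))); [apply H1|].
      apply (is_derive_continuous _ _ 1). auto_derive; [exact I|ring].
    + intros v. eapply Rle_trans; [apply H3|]. rewrite Rmult_assoc, <- exp_plus.
      apply Rmult_le_compat_l; [exact H|]. apply exp_le.
      assert (Rabs v <= Rabs (v + - ln (INR n)) + Rabs (ln (INR n))).
      { replace v with ((v + - ln (INR n)) + ln (INR n)) at 1 by ring. apply Rabs_triang. }
      nra.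
Qed.

Lemma ccontinuous_linear (p : C) (v : R) : ccontinuous (fun v => p * RtoC v)%C v.
Proof. apply ccontinuous_scal, ccontinuous_RtoC, continuous_id. Qed.

Lemma betaint_gamma_lim (p q : C) :
  0 < Re p -> 0 < Re q ->
  has_clim (fun n => Rcpow (INR n) p * betaint p (q + RtoC (INR n)))%C eventually (gammaint p).
Proof.
  intros Hp Hq.
  eapply has_clim_ext_loc; [typeclasses eauto| |].
  { apply (eventually_ge 1). intros n Hn. symmetry. now apply betaint_scaled. }
  unfold gammaint, kint.
  rewrite (cint_ext (kernel p 0 1) (fun v => Cexp (p * RtoC v - RtoC (exp v))%C)).
  2: { intros v. unfold kernel. f_equal. rewrite Rmult_1_l. ring. }
  (* With [m >= 2 Re p] the factor $(1+e^v/m)^{-m}\le m^m e^{-mv}$ beats [e^(v Re p)] and leaves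
     decay at rate [Re p]; [m^m] is the constant of the majorant. *)
  destruct (nfloor_ex (Re p + Re p) ltac:(lra)) as (m0 & Hm0).
  set (m := S m0). assert (Hm : Re p + Re p <= INR m) by (unfold m; rewrite S_INR; lra).
  assert (Hm1 : 1 <= INR m) by (unfold m; rewrite S_INR; pose proof (pos_INR m0); lra).
  apply (cint_exp_lim eventually _ _ (exp (INR m * ln (INR m))) (Re p)).
  - exists m. intros n Hn.
    assert (Hn1 : INR m <= INR n) by now apply le_INR.
    split; [|split; [exact Hp|]].
    + intros v. apply ccontinuous_Cexp, ccontinuous_minus; [apply ccontinuous_linear|].
      apply ccontinuous_scal, ccontinuous_RtoC.
      pose proof (exp_pos v). assert (0 < exp v / INR n) by (apply Rdiv_lt_0_compat; lra).
      eapply is_derive_continuous. auto_derive; [lra|reflexivity].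
    + intros v. rewrite Cmod_Cexp, <- exp_plus. apply exp_le.
      rewrite Re_Cminus, !Re_Cmult, !Re_Cplus, !re_RtoC, !im_RtoC, !Rmult_0_r, !Rminus_0_r.
      pose proof (exp_pos v).
      pose proof (mul_ln_1p_div_mono (exp v) (INR m) (INR n) ltac:(lra) ltac:(lra)) as Hmono.
      assert (H1 : 0 < exp v / INR n) by (apply Rdiv_lt_0_compat; lra).
      assert (H2 : 0 < exp v / INR m) by (apply Rdiv_lt_0_compat; lra).
      pose proof (ln_1p_exp_ge_0 _ (Rlt_le _ _ H1)). pose proof (ln_1p_exp_ge_0 _ (Rlt_le _ _ H2)).
      assert (0 <= (Re p + Re q) * ln (1 + exp v / INR n)) by (apply Rmult_le_pos; lra).
      assert (Hlm : 0 <= ln (INR m)) by (rewrite <- ln_1; apply ln_le; lra).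
      destruct (Rle_dec v 0) as [Hv|Hv].
      * rewrite Rabs_left1 by lra. nra.
      * rewrite Rabs_pos_eq by lra.
        assert (Hl : v - ln (INR m) <= ln (1 + exp v / INR m)).
        { rewrite <- (ln_exp (v - ln (INR m))).
          apply ln_le; [apply exp_pos|]. unfold Rminus. rewrite exp_plus, exp_Ropp, exp_ln by lra.
          unfold Rdiv in *. lra. }
        assert (INR m * (v - ln (INR m)) <= INR m * ln (1 + exp v / INR m))
          by (apply Rmult_le_compat_l; lra).
        assert ((Re p + Re p) * v <= INR m * v) by (apply Rmult_le_compat_r; lra). lra.
  - intros v. apply ccontinuous_minus; [apply ccontinuous_linear|].
    apply ccontinuous_RtoC. eapply is_derive_continuous, is_derive_exp.
  (* For [|v| <= N] the exponents differ by at most [c / n]: [ln (1 + y)] lies between [y - y^2] and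
     [y] for [y = e^v / n]. *)
  - intros N eps He. set (c := Cmod (p + q) * exp N + exp N ^ 2 + 1).
    assert (Hc : 0 < c).
    { pose proof (exp_pos N). pose proof (Cmod_ge_0 (p + q)). unfold c. nra. }
    destruct (proj2 (is_lim_seq_spec _ _) is_lim_seq_inv_INR
      (mkposreal (eps / c) ltac:(apply Rdiv_lt_0_compat; lra))) as (M & HM). simpl in HM.
    exists (S M). intros n Hn v Hv. specialize (HM n ltac:(lia)).
    assert (Hn0 : 0 < INR n) by (apply lt_0_INR; lia).
    assert (Hi : 0 < / INR n) by now apply Rinv_0_lt_compat.
    rewrite Rminus_0_r, Rabs_pos_eq in HM by lra.
    pose proof (exp_pos v). set (y := exp v / INR n).
    assert (Hy : 0 <= y) by (apply Rdiv_le_0_compat; lra).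
    pose proof (ln_1p_le y Hy) as L1. pose proof (ln_1p_ge y Hy) as L2.
    pose proof (ln_1p_exp_ge_0 y Hy) as L3. set (l := ln (1 + y)) in *.
    replace (p * RtoC v - (p + q + RtoC (INR n)) * RtoC l - (p * RtoC v - RtoC (exp v)))%C
      with (RtoC (exp v - INR n * l) - (p + q) * RtoC l)%C
      by (rewrite RtoC_minus, RtoC_mult; ring).
    assert (Hvn : exp v = INR n * y) by (unfold y; field; lra).
    assert (Hev : exp v <= exp N).
    { apply exp_le. pose proof (Rle_abs v). lra. }
    eapply Rle_lt_trans; [apply Cmod_minus_le|]. rewrite Cmod_mult, !Cmod_R.
    rewrite (Rabs_pos_eq l), (Rabs_pos_eq (exp v - INR n * l)) by nra.
    pose proof (Cmod_ge_0 (p + q)).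
    assert (HyN : y <= exp N * / INR n) by (unfold y, Rdiv; apply Rmult_le_compat_r; lra).
    assert (B1 : exp v - INR n * l <= exp N ^ 2 * / INR n).
    { apply Rle_trans with (INR n * y ^ 2); [rewrite Hvn; nra|].
      replace (INR n * y ^ 2) with (exp v ^ 2 * / INR n) by (unfold y; field; lra).
      apply Rmult_le_compat_r; [lra|]. apply pow_incr; lra. }
    assert (B2 : Cmod (p + q) * l <= Cmod (p + q) * (exp N * / INR n))
      by (apply Rmult_le_compat_l; lra).
    apply Rle_lt_trans with (c * / INR n); [unfold c; lra|].
    apply Rmult_lt_compat_l with (r := c) in HM; [|exact Hc].
    replace (c * (eps / c)) with eps in HM by (field; lra). exact HM.
Qed.

(** At [q = 1] the product of the [n]-th approximations to the two factors equals 1 for every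
    [n >= 1]. *)
Lemma gammaint_rGamma (p : C) : 0 < Re p -> (gammaint p * rGamma p)%C = 1%C.
Proof.
  intros Hp. assert (Hp0 : p <> 0%C) by (apply Re_neq_0; lra).
  assert (H1 : 0 < Re 1) by (simpl; lra).
  pose proof (has_clim_mult eventually _ _ _ _ (betaint_gamma_lim p 1 Hp H1) (rGamma_lim p)) as H.
  apply (has_clim_unique eventually _ _ _ H).
  apply (has_clim_ext_loc eventually (fun _ => 1%C)).
  2: { apply has_clim_const; typeclasses eauto. }
  apply (eventually_ge 1). intros n Hn.
  pose proof (betaint_pochhammer p 1 n Hp H1) as E. rewrite betaint_1, pochhammer_1 in E by exact Hp.
  unfold gauss. rewrite pochhammer_plus_1.
  transitivity (p * (pochhammer (p + 1) n * betaint p (1 + RtoC (INR n))) / RtoC (INR (fact n)))%C.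
  - rewrite <- E. field. split; [exact Hp0|apply INR_fact_neq_0'|..].
  - field. split; [apply Rcpow_neq_0|apply INR_fact_neq_0'].
Qed.

Lemma gammaint_neq_0 (p : C) : 0 < Re p -> gammaint p <> 0%C.
Proof.
  intros Hp E. pose proof (gammaint_rGamma p Hp) as H. rewrite E, Cmult_0_l in H.
  now apply C1_nz.
Qed.

Lemma rGamma_neq_0 (p : C) : 0 < Re p -> rGamma p <> 0%C.
Proof.
  intros Hp E. pose proof (gammaint_rGamma p Hp) as H. rewrite E, Cmult_0_r in H.
  now apply C1_nz.
Qed.

Lemma gammaint_eq (p : C) : 0 < Re p -> gammaint p = (/ rGamma p)%C.
Proof.
  intros Hp. pose proof (gammaint_rGamma p Hp) as H. pose proof (rGamma_neq_0 p Hp).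
  transitivity (gammaint p * rGamma p / rGamma p)%C; [field; assumption|].
  rewrite H. field. assumption.
Qed.

(** [betaint_pochhammer], divided by [n! n^q], expresses [B(p,q)] times a Gauss term at [q] by a
    Gauss term at [p + q] times $n^p B(p,q+1+n)$; both sides have known limits. *)
Lemma betaint_eq (p q : C) :
  0 < Re p -> 0 < Re q -> betaint p q = (gammaint p * gammaint q * rGamma (p + q))%C.
Proof.
  intros Hp Hq.
  assert (Hq1 : 0 < Re (q + 1)) by (rewrite Re_Cplus; simpl; lra).
  assert (E : (betaint p q * rGamma q)%C = (rGamma (p + q) * gammaint p)%C).
  { apply (has_clim_unique eventually (fun n => betaint p q * gauss q n)%C).
    - apply has_clim_scal; [typeclasses eauto|apply rGamma_lim].
    - pose proof (has_clim_mult eventually _ _ _ _ (rGamma_lim (p + q))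
        (betaint_gamma_lim p (q + 1) Hp Hq1)) as H.
      eapply has_clim_ext_loc; [typeclasses eauto| |exact H].
      apply (eventually_ge 1). intros n Hn. cbv beta.
      pose proof (betaint_pochhammer p q (S n) Hp Hq) as E.
      replace (q + RtoC (INR (S n)))%C with (q + 1 + RtoC (INR n))%C in E
        by (rewrite S_INR, RtoC_plus; ring).
      unfold gauss. rewrite Rcpow_plus.
      transitivity (pochhammer (p + q) (S n) * betaint p (q + 1 + RtoC (INR n))
        / (RtoC (INR (fact n)) * Rcpow (INR n) q))%C.
      + field. repeat split; auto using INR_fact_neq_0', Rcpow_neq_0.
      + rewrite <- E. field. repeat split; auto using INR_fact_neq_0', Rcpow_neq_0. }
  pose proof (gammaint_rGamma q Hq) as Hg.
  transitivity (betaint p q * rGamma q * gammaint q)%C; [|rewrite E; ring].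
  transitivity (betaint p q * (gammaint q * rGamma q))%C; [rewrite Hg; ring|ring].
Qed.

(** * The Gaussian integral *)

Lemma RInt_gauss_subst (a b : R) :
  RInt (fun v => exp (/ 2 * v - exp v)) (- a) b =
  2 * RInt (fun s => exp (- s ^ 2)) (exp (- a / 2)) (exp (b / 2)).
Proof.
  assert (Hc : forall s, continuous (fun s => exp (- s ^ 2)) s).
  { intros s. eapply is_derive_continuous. auto_derive; [exact I|reflexivity]. }
  pose proof (is_RInt_comp (V := R_CompleteNormedModule) (fun s => exp (- s ^ 2))
    (fun v => exp (v / 2)) (fun v => / 2 * exp (v / 2)) (- a) b) as H.
  cbv beta in H.
  assert (H1 := H (fun x _ => Hc _)). clear H.
  assert (H2 : is_RInt (fun y => scal (/ 2 * exp (y / 2)) (exp (- exp (y / 2) ^ 2))) (- a) b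
    (RInt (fun s => exp (- s ^ 2)) (exp (- a / 2)) (exp (b / 2)))).
  { apply H1. intros x _. split.
    - auto_derive; [exact I|]. unfold Rdiv. field.
    - eapply is_derive_continuous. auto_derive; [exact I|reflexivity]. }
  apply (is_RInt_scal _ _ _ 2) in H2.
  apply is_RInt_unique. eapply is_RInt_ext; [|exact H2].
  intros v _. unfold scal; simpl; unfold mult; simpl.
  replace (exp (v / 2) * (exp (v / 2) * 1)) with (exp v)
    by (rewrite Rmult_1_r, <- exp_plus; f_equal; field).
  unfold Rminus. rewrite exp_plus. replace (/ 2 * v) with (v / 2) by (unfold Rdiv; ring). field.
Qed.

Lemma gauss_rnice : rnice 2 1 (fun s => exp (- s ^ 2)).
Proof.
  split; [|split; [lra|]].
  - intros s. eapply is_derive_continuous. auto_derive; [exact I|reflexivity].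
  - intros s. rewrite Rabs_pos_eq by (left; apply exp_pos).
    apply Rle_trans with (exp (/ 2) * exp (-1 * Rabs s)).
    + rewrite <- exp_plus. apply exp_le. rewrite <- (pow2_abs s).
      pose proof (pow2_ge_0 (Rabs s - / 2)). nra.
    + apply Rmult_le_compat_r; [left; apply exp_pos|].
      pose proof exp_le_3 as H3. replace 1 with (/ 2 + / 2) in H3 by field.
      rewrite exp_plus in H3. pose proof (exp_pos (/ 2)). nra.
Qed.

Lemma RInt_even (f : R -> R) (a : R) :
  (forall v, continuous f v) -> (forall v, f (- v) = f v) ->
  RInt f (- a) a = 2 * RInt f 0 a.
Proof.
  intros Hc He.
  assert (E : RInt f (- a) 0 = RInt f 0 a).
  { pose proof (RInt_comp_lin (V := R_CompleteNormedModule) f (-1) 0 0 a) as H.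
    replace (-1 * 0 + 0) with 0 in H by ring. replace (-1 * a + 0) with (- a) in H by ring.
    rewrite <- (opp_RInt_swap (V := R_CompleteNormedModule)) by now apply ex_RInt_cont.
    rewrite <- H by now apply ex_RInt_cont.
    rewrite <- (RInt_opp (V := R_CompleteNormedModule)).
    - apply RInt_ext. intros x _. unfold opp, scal; simpl; unfold mult; simpl.
      rewrite <- (He x). replace (-1 * x + 0) with (- x) by ring. ring.
    - apply ex_RInt_cont. intros v. apply (continuous_scal_r (-1) (fun v => f (-1 * v + 0))).
      apply (continuous_comp (fun v => -1 * v + 0) f); [|apply Hc].
      apply (is_derive_continuous _ _ (-1)). auto_derive; [exact I|ring]. }
  rewrite <- (RInt_Chasles f (- a) 0 a), E by now apply ex_RInt_cont.
  unfold plus; simpl. ring.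
Qed.

(** The substitution [s = e^(v/2)] covers the positive half line only. Evenness accounts for the
    factor 2, and the missing piece near 0 disappears with the left end of the window. *)
Lemma rint_gauss_subst : rint (fun v => exp (/ 2 * v - exp v)) = rint (fun s => exp (- s ^ 2)).
Proof.
  assert (Hn : rnice (exp (1 + (1 + 1 + / 2) ^ 2 / 1)) (/ 2) (fun v => exp (/ 2 * v - exp v))).
  { assert (H : cdom (exp (1 + (1 + 1 + / 2) ^ 2 / 1)) (/ 2) (kernel (/ 2) 0 1)).
    { apply kernel_cdom_pos; simpl; unfold Re; simpl; try rewrite Rabs_R0; lra. }
    apply cdom_Re in H. destruct H as (_ & H1 & H2). split; [|split; [exact H1|]].
    - intros s. eapply is_derive_continuous. auto_derive; [exact I|reflexivity].
    - intros v. replace (exp (/ 2 * v - exp v)) with (Re (kernel (/ 2) 0 1 v)); [apply H2|].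
      unfold kernel. replace (/ 2 * RtoC v + 0 * RtoC (ln (1 + exp v)) - RtoC (1 * exp v))%C
        with (RtoC (/ 2 * v - exp v)).
      + now rewrite Cexp_RtoC.
      + rewrite RtoC_minus, RtoC_mult, RtoC_inv by lra. rewrite Rmult_1_l. ring. }
  eapply rint_unique; [exact Hn|]. intros eps He A.
  destruct (rint_near _ _ _ (eps / 2) gauss_rnice ltac:(lra)) as (B & HB).
  assert (He4 : 0 < eps / 4) by lra.
  (* [e^(b/2)] then exceeds [B], and the left end [e^(-a/2)] falls below [eps / 4]. *)
  set (b := Rmax A (2 * B)). set (a := Rmax A (2 * / (eps / 4))).
  exists a, b. split; [apply Rmax_l|split; [apply Rmax_l|]].
  rewrite RInt_gauss_subst.
  set (f := fun s => exp (- s ^ 2)) in *. set (M := exp (b / 2)). set (e := exp (- a / 2)).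
  assert (HM : B <= M).
  { unfold M. pose proof (exp_ineq1_le (b / 2)). pose proof (Rmax_r A (2 * B)). unfold b in *. lra. }
  assert (Hee : e < eps / 4).
  { unfold e. apply Rle_lt_trans with (exp (- / (eps / 4))).
    - apply exp_le. pose proof (Rmax_r A (2 * / (eps / 4))). unfold a. lra.
    - rewrite exp_Ropp. rewrite <- (Rinv_inv (eps / 4)) at 2.
      pose proof (Rinv_0_lt_compat _ He4). apply Rinv_lt_contravar.
      + apply Rmult_lt_0_compat; [lra|apply exp_pos].
      + pose proof (exp_ineq1 (/ (eps / 4)) ltac:(lra)). lra. }
  assert (He0 : 0 < e) by apply exp_pos.
  assert (Hf : forall s, continuous f s) by apply gauss_rnice.
  assert (E : 2 * RInt f e M = RInt f (- M) M - 2 * RInt f 0 e).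
  { rewrite RInt_even; [|exact Hf|intros v; unfold f; f_equal; ring].
    rewrite <- (RInt_Chasles f 0 e M) by now apply ex_RInt_cont. unfold plus; simpl. ring. }
  rewrite E. specialize (HB M M HM HM).
  assert (Hs : Rabs (RInt f 0 e) <= (e - 0) * 1).
  { apply abs_RInt_le_const; [lra|now apply ex_RInt_cont|].
    intros t _. unfold f. rewrite Rabs_pos_eq by (left; apply exp_pos).
    rewrite <- exp_0. apply exp_le. pose proof (pow2_ge_0 t). lra. }
  replace (RInt f (- M) M - 2 * RInt f 0 e - rint f) with
    ((RInt f (- M) M - rint f) + (- (2 * RInt f 0 e))) by ring.
  eapply Rle_lt_trans; [apply Rabs_triang|].
  rewrite Rabs_Ropp, Rabs_mult, (Rabs_pos_eq 2) by lra. lra.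
Qed.

Lemma rint_ge_0 (K d : R) (f : R -> R) : rnice K d f -> (forall v, 0 <= f v) -> 0 <= rint f.
Proof.
  intros Hf H. apply (is_lim_seq_le (fun _ => 0) (fun n => RInt f (- INR n) (INR n)) 0 (rint f)).
  - intros n. pose proof (pos_INR n). apply RInt_ge_0; [lra| |auto]. apply ex_RInt_cont, Hf.
  - apply is_lim_seq_const.
  - eapply rint_lim, Hf.
Qed.

Lemma rint_0 (f : R -> R) : (forall v, f v = 0) -> rint f = 0.
Proof.
  intros H. unfold rint. rewrite (Lim_seq_ext _ (fun _ => 0)); [now rewrite Lim_seq_const|].
  intros n. rewrite (RInt_ext _ (fun _ => 0)) by auto.
  rewrite RInt_const. unfold scal; simpl; unfold mult; simpl. ring.
Qed.

Lemma is_lim_atan_exp_m : is_lim (fun v => atan (exp v)) m_infty 0.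
Proof.
  apply (is_lim_comp atan exp m_infty 0 0).
  - rewrite <- atan_0 at 2. apply is_lim_continuity, continuity_pt_filterlim.
    apply (ex_derive_continuous atan). eexists; apply is_derive_atan.
  - apply is_lim_exp_m.
  - exists 0. intros v _ E. injection E. intros E'. pose proof (exp_pos v). lra.
Qed.

(** The product is $B(\frac12,\frac12)=\int_0^\infty\frac{dt}{\sqrt t\,(1+t)}$, whose integrand has
    the antiderivative $2\arctan\sqrt t$. *)
Lemma gammaint_half_sq : (gammaint (/ 2) * gammaint (/ 2))%C = RtoC PI.
Proof.
  assert (Hr : Re (/ 2) = / 2) by (unfold Re; simpl; field).
  assert (Hh : 0 < Re (/ 2)) by (rewrite Hr; lra).
  transitivity (betaint (/ 2) (/ 2)).
  { rewrite betaint_eq by assumption. replace (/ 2 + / 2)%C with (RtoC 1) by field.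
    rewrite rGamma_1. ring. }
  unfold betaint, kint.
  rewrite (cint_derive _ (fun v => RtoC (2 * atan (exp (v / 2)))) (RtoC PI) 0); [ring|..].
  - intros v. eapply cderive_eq.
    + apply cderive_RtoC. instantiate (1 := exp (v / 2) / (1 + exp v)).
      pose proof (exp_pos v). auto_derive; [exact I|].
      replace (v * / 2) with (v / 2) by reflexivity.
      replace (exp v) with (exp (v / 2) * exp (v / 2)) in * by (rewrite <- exp_plus; f_equal; field).
      field. nra.
    + unfold kernel. pose proof (exp_pos v).
      replace (- (/ 2 + / 2))%C with (- (1))%C by field.
      replace (/ 2 * RtoC v + - (1) * RtoC (ln (1 + exp v)) - RtoC (0 * exp v))%C
        with (RtoC (v / 2 + - ln (1 + exp v))).
      * rewrite Cexp_RtoC, exp_plus, exp_Ropp, exp_ln by lra. reflexivity.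
      * rewrite Rmult_0_l, RtoC_plus, RtoC_opp, RtoC_div by lra. field.
  - apply kernel_cnice_0; [exact Hh|]. unfold Re; simpl. lra.
  - apply has_clim_RtoC; [typeclasses eauto|].
    assert (H0 : is_lim (fun v => 2 * atan (exp (- (v / 2)))) p_infty (Rbar_mult 2 0)).
    { apply is_lim_scal_l.
      apply (is_lim_comp (fun v => atan (exp v)) (fun v => - (v / 2)) p_infty 0 m_infty).
      - apply is_lim_atan_exp_m.
      - intros P [M HM]. exists (- 2 * M). intros v Hv. apply HM. lra.
      - exists 0; intros; discriminate. }
    simpl in H0. rewrite Rmult_0_r in H0.
    pose proof (is_lim_minus' (fun _ => PI) _ p_infty PI 0 (is_lim_const _ _) H0) as H.
    rewrite Rminus_0_r in H.
    apply (is_lim_ext _ (fun v => 2 * atan (exp (v / 2)))) in H; [exact H|].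
    intros v. rewrite exp_Ropp, atan_inv by apply exp_pos. field.
  - apply has_clim_RtoC; [typeclasses eauto|].
    assert (H : is_lim (fun v => 2 * atan (exp (v / 2))) m_infty (Rbar_mult 2 0)).
    { apply is_lim_scal_l.
      apply (is_lim_comp (fun v => atan (exp v)) (fun v => v / 2) m_infty 0 m_infty).
      - apply is_lim_atan_exp_m.
      - intros P [M HM]. exists (2 * M). intros v Hv. apply HM. lra.
      - exists 0; intros; discriminate. }
    simpl in H. rewrite Rmult_0_r in H. exact H.
Qed.

Lemma gauss_integral : rint (fun s => exp (- s ^ 2)) = sqrt PI.
Proof.
  pose proof gammaint_half_sq as H.
  assert (E : gammaint (/ 2) = RtoC (rint (fun s => exp (- s ^ 2)))).
  { rewrite <- rint_gauss_subst.
    assert (Hk : forall v, kernel (/ 2) 0 1 v = RtoC (exp (/ 2 * v - exp v))).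
    { intros v. unfold kernel. rewrite <- Cexp_RtoC. f_equal.
      rewrite Rmult_1_l, RtoC_minus, RtoC_mult, RtoC_inv by lra. ring. }
    unfold gammaint, kint. rewrite (cint_ext _ _ Hk).
    apply C_ext; [reflexivity|]. now apply rint_0. }
  rewrite E, <- RtoC_mult in H. apply RtoC_inj in H.
  (* Only the square is known so far; positivity of the integrand selects the root. *)
  symmetry. rewrite <- H. apply sqrt_square. eapply rint_ge_0; [apply gauss_rnice|].
  intros v. left. apply exp_pos.
Qed.

(** * The integrals as functions of [x]: derivative and limits at the ends *)

Lemma at_right_intro (P : R -> Prop) (e : R) :
  0 < e -> (forall x, 0 < x < e -> P x) -> at_right 0 P.
Proof.
  intros He H. exists (mkposreal e He). intros y Hy Hy0.
  unfold ball in Hy; simpl in Hy; unfold AbsRing_ball, abs, minus, plus, opp in Hy; simpl in Hy.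
  apply H. split; [exact Hy0|]. rewrite Ropp_0, Rplus_0_r in Hy.
  pose proof (Rle_abs y). lra.
Qed.

Lemma p_infty_intro (P : R -> Prop) (M : R) :
  (forall x, M < x -> P x) -> Rbar_locally p_infty P.
Proof. intros H; exists M; exact H. Qed.

(** Differentiation under the integral sign arrives in this form: a quadratic bound on the remainder
    can be integrated. *)
Lemma is_derive_quadratic (f : R -> R) (x l K e : R) :
  0 < e -> (forall h, Rabs h <= e -> Rabs (f (x + h) - f x - h * l) <= K * h ^ 2) ->
  is_derive f x l.
Proof.
  intros He H. apply is_derive_Reals. intros eps Heps.
  assert (HK : 0 <= Rabs K) by apply Rabs_pos.
  assert (Hd : 0 < Rmin e (eps / (Rabs K + 1))).
  { apply Rmin_glb_lt; [exact He|apply Rdiv_lt_0_compat; lra]. }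
  exists (mkposreal _ Hd). intros h Hh0 Hh. simpl in Hh.
  assert (Hh1 : Rabs h <= e) by (eapply Rle_trans; [left; exact Hh|apply Rmin_l]).
  assert (Hh2 : Rabs h < eps / (Rabs K + 1)) by (eapply Rlt_le_trans; [exact Hh|apply Rmin_r]).
  specialize (H h Hh1). pose proof (Rabs_pos_lt h Hh0) as Hhp.
  replace ((f (x + h) - f x) / h - l) with ((f (x + h) - f x - h * l) / h) by (field; exact Hh0).
  rewrite Rabs_div by exact Hh0. apply Rmult_lt_reg_r with (Rabs h); [exact Hhp|].
  unfold Rdiv. rewrite Rmult_assoc, Rinv_l, Rmult_1_r by lra.
  rewrite <- pow2_abs in H. pose proof (Rle_abs K).
  apply Rle_lt_trans with ((Rabs K + 1) * Rabs h * Rabs h); [nra|].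
  apply Rmult_lt_compat_r; [exact Hhp|].
  apply Rmult_lt_compat_l with (r := Rabs K + 1) in Hh2; [|lra].
  replace ((Rabs K + 1) * (eps / (Rabs K + 1))) with eps in Hh2 by (field; lra). exact Hh2.
Qed.

Lemma cderive_quadratic (f : R -> C) (x : R) (l : C) (K e : R) :
  0 < e -> (forall h, Rabs h <= e -> Cmod (f (x + h)%R - f x - RtoC h * l) <= K * h ^ 2) ->
  cderive f x l.
Proof.
  intros He H. split.
  - apply (is_derive_quadratic _ _ _ K e He). intros h Hh. eapply Rle_trans; [|apply (H h Hh)].
    eapply Rle_trans; [|apply Re_le_Cmod]. rewrite !Re_Cminus, re_scal_l. lra.
  - apply (is_derive_quadratic _ _ _ K e He). intros h Hh. eapply Rle_trans; [|apply (H h Hh)].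
    eapply Rle_trans; [|apply Im_le_Cmod]. rewrite !Im_Cminus, im_scal_l. lra.
Qed.

Lemma exp_taylor_1 (u : R) : Rabs (exp u - 1 - u) <= 4 * u ^ 2 * exp (Rabs u).
Proof.
  pose proof (Cexp_minus_1_minus_le (RtoC u)) as H.
  now rewrite Cexp_RtoC, <- !RtoC_minus, !Cmod_R, pow2_abs in H.
Qed.

(** With [t = e^v], the remainder of [e^(-h t)] is at most $4h^2t^2e^{|h|t}$. For [|h| <= x/2] the
    growing factor is paid for by half of [e^(-x t)], which leaves an integrable kernel at [x / 2]
    with [p] raised by two. *)
Lemma cderive_kint (p q : C) (x : R) :
  0 < Re p -> 0 < x -> cderive (kint p q) x (- kint (p + 1) q x).
Proof.
  intros Hp Hx. assert (Hx2 : 0 < x / 2) by lra.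
  assert (Hp1 : 0 < Re (p + 1)) by (rewrite Re_Cplus; simpl; lra).
  assert (Hp2 : 0 < Re (p + 1 + 1)) by (rewrite !Re_Cplus; simpl; lra).
  destruct (kernel_cnice_pos (p + 1 + 1) q (x / 2) Hp2 Hx2) as (K & d & Hdom).
  apply (cderive_quadratic _ _ _ (4 * (4 * K) / d) (x / 2) Hx2). intros h Hh.
  pose proof (Rle_abs h). pose proof (Rle_abs (- h)) as Hh'. rewrite Rabs_Ropp in Hh'.
  assert (Hxh : 0 < x + h) by lra.
  unfold kint.
  replace (cint (kernel p q (x + h)) - cint (kernel p q x) - RtoC h * - cint (kernel (p + 1) q x))%C
    with (cint (fun v => kernel p q (x + h)%R v - kernel p q x v + RtoC h * kernel (p + 1) q x v)%C).
  2: { rewrite cint_plus, cint_minus, cint_scal; auto using cnice_minus, cnice_scal, kernel_cnice_pos.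
       ring. }
  replace (4 * (4 * K) / d * h ^ 2) with (4 * (4 * K * h ^ 2) / d) by (field; apply Rgt_not_eq, Hdom).
  apply cint_bound. destruct Hdom as (_ & Hd & Hdom). split; [|split; [exact Hd|]].
  - intros v. apply ccontinuous_plus; [apply ccontinuous_minus|apply ccontinuous_scal];
      apply kernel_continuous.
  - intros v. specialize (Hdom v). pose proof (exp_pos v) as Hv.
    assert (E : (kernel p q (x + h)%R v - kernel p q x v + RtoC h * kernel (p + 1) q x v =
      kernel p q x v * RtoC (exp (- (h * exp v)) - 1 - - (h * exp v)))%C).
    { rewrite kernel_succ_l. replace (kernel p q (x + h)%R v) with
        (kernel p q x v * RtoC (exp (- (h * exp v))))%C.
      - rewrite !RtoC_minus, RtoC_opp, RtoC_mult. ring.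
      - unfold kernel. rewrite <- Cexp_RtoC, <- Cexp_plus. f_equal.
        rewrite Rmult_plus_distr_r, RtoC_plus, RtoC_opp. ring. }
    rewrite E, Cmod_mult, Cmod_R.
    apply Rle_trans with (4 * h ^ 2 * Cmod (kernel (p + 1 + 1) q (x / 2) v)).
    + rewrite !kernel_succ_l, !Cmod_mult, !Cmod_R, !Rabs_pos_eq with (x := exp v) by lra.
      pose proof (exp_taylor_1 (- (h * exp v))) as T.
      rewrite Rabs_Ropp, Rabs_mult, (Rabs_pos_eq (exp v)) in T by lra.
      assert (E2 : Cmod (kernel p q x v) * exp (Rabs h * exp v) <= Cmod (kernel p q (x / 2) v)).
      { rewrite !Cmod_kernel, <- exp_plus. apply exp_le. nra. }
      pose proof (Cmod_ge_0 (kernel p q x v)).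
      apply Rle_trans with (Cmod (kernel p q x v) * (4 * (- (h * exp v)) ^ 2 * exp (Rabs h * exp v))).
      * apply Rmult_le_compat_l; assumption.
      * replace (Cmod (kernel p q x v) * (4 * (- (h * exp v)) ^ 2 * exp (Rabs h * exp v))) with
          (4 * h ^ 2 * (exp v * (exp v * (Cmod (kernel p q x v) * exp (Rabs h * exp v))))) by ring.
        pose proof (pow2_ge_0 h). apply Rmult_le_compat_l; [lra|].
        do 2 (apply Rmult_le_compat_l; [lra|]). exact E2.
    + replace (4 * K * h ^ 2 * exp (- d * Rabs v)) with (4 * h ^ 2 * (K * exp (- d * Rabs v))) by ring.
      pose proof (pow2_ge_0 h). apply Rmult_le_compat_l; lra.
Qed.

(** The power [x^s] stays inside the exponential. With [s = q] it merges into $(x+e^v)^q$, suited to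
    [x -> 0]; with [s = 0] there remains $(1+e^v/x)^q$, suited to infinity. *)
Lemma kint_scaled (p q s : C) (x : R) :
  0 < x -> 0 < Re p ->
  (Rcpow x (p + s) * kint p q x)%C =
  cint (fun v => Cexp (p * RtoC v + s * RtoC (ln x) + q * RtoC (ln (1 + exp v / x)) - RtoC (exp v))).
Proof.
  intros Hx Hp. pose proof (kernel_cnice_pos p q x Hp Hx) as HN.
  assert (HN' : cnice (fun v => kernel p q x (v + - ln x))).
  { destruct HN as (K & d & HN). pose proof (cdom_K_ge_0 _ _ _ HN).
    exists (K * exp (d * Rabs (ln x))), d. destruct HN as (H1 & H2 & H3).
    split; [|split; [exact H2|]].
    - intros v. apply (ccontinuous_comp _ (fun v => v + - ln x)); [apply H1|].
      apply (is_derive_continuous _ _ 1). auto_derive; [exact I|ring].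
    - intros v. eapply Rle_trans; [apply H3|]. rewrite Rmult_assoc, <- exp_plus.
      apply Rmult_le_compat_l; [exact H|]. apply exp_le.
      assert (Rabs v <= Rabs (v + - ln x) + Rabs (ln x)).
      { replace v with ((v + - ln x) + ln x) at 1 by ring. apply Rabs_triang. }
      nra. }
  unfold kint. rewrite <- (cint_shift _ (- ln x) HN), <- cint_scal by exact HN'.
  apply cint_ext. intros v. unfold Rcpow, kernel. rewrite <- Cexp_plus. f_equal.
  rewrite exp_plus, exp_Ropp, exp_ln by exact Hx.
  replace (x * (exp v * / x)) with (exp v) by (field; lra).
  rewrite RtoC_plus, RtoC_opp. unfold Rdiv. ring.
Qed.

Lemma ccontinuous_kernel_exponent (p q : C) (x v : R) :
  ccontinuous (fun v => p * RtoC v + q * RtoC (ln (1 + exp v)) - RtoC (x * exp v))%C v.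
Proof.
  apply ccontinuous_minus; [apply ccontinuous_plus|].
  - apply ccontinuous_linear.
  - apply ccontinuous_scal, ccontinuous_RtoC. eapply is_derive_continuous, is_derive_ln_1p_exp.
  - apply ccontinuous_RtoC. eapply is_derive_continuous. auto_derive; [exact I|reflexivity].
Qed.

(** The substitution [t = s / x] behind the behaviour at [0] and at infinity. *)
Lemma kint_lim_0_gamma (p q : C) :
  0 < Re p -> Re q <= 0 -> 0 < Re (p + q) ->
  has_clim (fun x => Rcpow x (p + q) * kint p q x)%C (at_right 0) (gammaint (p + q)).
Proof.
  intros Hp Hq Hpq.
  apply (has_clim_ext_loc (at_right 0) (fun x => cint (fun v =>
    Cexp (p * RtoC v + q * RtoC (ln (x + exp v)) - RtoC (exp v))))).
  { apply (at_right_intro _ 1 Rlt_0_1). intros x Hx.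
    rewrite kint_scaled by (try apply Hx; exact Hp). apply cint_ext. intros v. f_equal.
    pose proof (exp_pos v).
    assert (0 < exp v / x) by (apply Rdiv_lt_0_compat; lra).
    replace (x + exp v) with (x * (1 + exp v / x)) by (field; lra).
    rewrite ln_mult, RtoC_plus by lra. ring. }
  unfold gammaint, kint, kernel.
  rewrite (cint_ext (fun v => Cexp ((p + q) * RtoC v + 0 * RtoC (ln (1 + exp v)) - RtoC (1 * exp v))%C)
    (fun v => Cexp ((p + q) * RtoC v - RtoC (exp v))%C)).
  2: { intros v. f_equal. rewrite Rmult_1_l. ring. }
  assert (HN : 0 < 1 <= 1) by lra.
  pose proof (kernel_cdom_pos (p + q) 0 1 1 (Re (p + q)) (Re (p + q)) 0
    ltac:(lra) ltac:(lra) ltac:(simpl; rewrite Rabs_R0; lra) ltac:(lra)) as Hdom.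
  eapply (cint_exp_lim (at_right 0)).
  - apply (at_right_intro _ 1 Rlt_0_1). intros x Hx. split; [|split].
    + intros v. pose proof (exp_pos v). apply ccontinuous_Cexp, ccontinuous_minus.
      * apply ccontinuous_plus; [apply ccontinuous_linear|].
        apply ccontinuous_scal, ccontinuous_RtoC. eapply is_derive_continuous.
        auto_derive; [lra|reflexivity].
      * apply ccontinuous_RtoC. eapply is_derive_continuous, is_derive_exp.
    + apply Hdom.
    + intros v. eapply Rle_trans; [|apply Hdom]. rewrite Cmod_kernel, Cmod_Cexp. apply exp_le.
      rewrite Re_Cminus, !Re_Cplus, !Re_Cmult, !re_RtoC, !im_RtoC.
      pose proof (exp_pos v).
      (* As [Re q <= 0], replacing [x + e^v] by [e^v] only increases the modulus; this is the
         majorant uniform in [x]. *)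
      assert (v <= ln (x + exp v)) by (rewrite <- (ln_exp v) at 1; apply ln_le; lra).
      simpl. rewrite Re_Cplus in *. nra.
  - intros v. apply ccontinuous_minus; [apply ccontinuous_linear|].
    apply ccontinuous_RtoC. eapply is_derive_continuous, is_derive_exp.
  - intros N eps He. pose proof (Cmod_ge_0 q) as Hq0. pose proof (exp_pos N) as HN0.
    apply (at_right_intro _ (eps / ((Cmod q + 1) * exp N))).
    { apply Rdiv_lt_0_compat; [exact He|nra]. }
    intros x Hx v Hv. pose proof (exp_pos v) as Hv0.
    assert (Hr : 0 <= x * exp (- v)) by (pose proof (exp_pos (- v)); nra).
    assert (E : ln (x + exp v) = v + ln (1 + x * exp (- v))).
    { replace (x + exp v) with (exp v * (1 + x * exp (- v))).
      - rewrite ln_mult, ln_exp by lra. reflexivity.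
      - replace (exp v * (1 + x * exp (- v))) with (exp v + x * (exp v * exp (- v))) by ring.
        rewrite <- exp_plus, Rplus_opp_r, exp_0. ring. }
    rewrite E, RtoC_plus.
    replace (p * RtoC v + q * (RtoC v + RtoC (ln (1 + x * exp (- v)))) - RtoC (exp v) -
      ((p + q) * RtoC v - RtoC (exp v)))%C with (q * RtoC (ln (1 + x * exp (- v))))%C by ring.
    rewrite Cmod_mult, Cmod_R, Rabs_pos_eq by (apply ln_1p_exp_ge_0; exact Hr).
    pose proof (ln_1p_le _ Hr). pose proof (ln_1p_exp_ge_0 _ Hr).
    assert (exp (- v) <= exp N).
    { apply exp_le. pose proof (Rle_abs (- v)). rewrite Rabs_Ropp in *. lra. }
    apply Rle_lt_trans with (x * ((Cmod q + 1) * exp N)).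
    + apply Rle_trans with (Cmod q * (x * exp N)); [|nra].
      apply Rmult_le_compat_l; [lra|].
      eapply Rle_trans; [eassumption|]. apply Rmult_le_compat_l; lra.
    + apply Rmult_lt_reg_r with (/ ((Cmod q + 1) * exp N)).
      * apply Rinv_0_lt_compat. nra.
      * rewrite Rmult_assoc, Rinv_r by nra. rewrite Rmult_1_r. apply Hx.
Qed.

(** Watson's lemma to leading order. For [x > 1] the majorant replaces [Re q] by its absolute value
    and [e^v / x] by [e^v]. *)
Lemma kint_lim_infty (p q : C) :
  0 < Re p ->
  has_clim (fun x => Rcpow x p * kint p q x)%C (Rbar_locally p_infty) (gammaint p).
Proof.
  intros Hp.
  apply (has_clim_ext_loc _ (fun x => cint (fun v =>
    Cexp (p * RtoC v + q * RtoC (ln (1 + exp v / x)) - RtoC (exp v))))).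
  { apply (p_infty_intro _ 0). intros x Hx.
    pose proof (kint_scaled p q 0 x Hx Hp) as E. replace (p + 0)%C with p in E by ring.
    rewrite E. apply cint_ext. intros v. f_equal. ring. }
  unfold gammaint, kint, kernel.
  rewrite (cint_ext (fun v => Cexp (p * RtoC v + 0 * RtoC (ln (1 + exp v)) - RtoC (1 * exp v))%C)
    (fun v => Cexp (p * RtoC v - RtoC (exp v))%C)).
  2: { intros v. f_equal. rewrite Rmult_1_l. ring. }
  pose proof (kernel_cdom_pos p (RtoC (Rabs (Re q))) 1 1 (Re p) (Re p) (Rabs (Re q))
    ltac:(lra) ltac:(lra) ltac:(rewrite re_RtoC, Rabs_Rabsolu; lra) ltac:(lra)) as Hdom.
  eapply (cint_exp_lim (Rbar_locally p_infty)).
  - apply (p_infty_intro _ 1). intros x Hx. split; [|split].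
    + intros v. pose proof (exp_pos v).
      assert (0 < exp v / x) by (apply Rdiv_lt_0_compat; lra).
      apply ccontinuous_Cexp, ccontinuous_minus.
      * apply ccontinuous_plus; [apply ccontinuous_linear|].
        apply ccontinuous_scal, ccontinuous_RtoC. eapply is_derive_continuous.
        auto_derive; [lra|reflexivity].
      * apply ccontinuous_RtoC. eapply is_derive_continuous, is_derive_exp.
    + apply Hdom.
    + intros v. eapply Rle_trans; [|apply Hdom]. rewrite Cmod_kernel, Cmod_Cexp. apply exp_le.
      rewrite Re_Cminus, !Re_Cplus, !Re_Cmult, !re_RtoC, !im_RtoC.
      pose proof (exp_pos v).
      assert (H1 : 0 < exp v / x) by (apply Rdiv_lt_0_compat; lra).
      assert (H2 : exp v / x <= exp v).
      { unfold Rdiv. rewrite <- (Rmult_1_r (exp v)) at 2. apply Rmult_le_compat_l; [lra|].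
        rewrite <- Rinv_1. apply Rinv_le_contravar; lra. }
      assert (H3 : ln (1 + exp v / x) <= ln (1 + exp v)) by (apply ln_le; lra).
      pose proof (ln_1p_exp_ge_0 _ (Rlt_le _ _ H1)).
      pose proof (Rle_abs (Re q)). pose proof (Rabs_pos (Re q)).
      assert (Re q * ln (1 + exp v / x) <= Rabs (Re q) * ln (1 + exp v)).
      { apply Rle_trans with (Rabs (Re q) * ln (1 + exp v / x)).
        - apply Rmult_le_compat_r; lra.
        - apply Rmult_le_compat_l; lra. }
      lra.
  - intros v. apply ccontinuous_minus; [apply ccontinuous_linear|].
    apply ccontinuous_RtoC. eapply is_derive_continuous, is_derive_exp.
  - intros N eps He. pose proof (Cmod_ge_0 q) as Hq0. pose proof (exp_pos N) as HN0.
    apply (p_infty_intro _ ((Cmod q + 1) * exp N / eps)).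
    intros x Hx v Hv. pose proof (exp_pos v) as Hv0.
    assert (Hx0 : 0 < x).
    { eapply Rlt_trans; [|exact Hx]. apply Rdiv_lt_0_compat; [nra|exact He]. }
    replace (p * RtoC v + q * RtoC (ln (1 + exp v / x)) - RtoC (exp v) -
      (p * RtoC v - RtoC (exp v)))%C with (q * RtoC (ln (1 + exp v / x)))%C by ring.
    assert (Hr : 0 <= exp v / x) by (apply Rdiv_le_0_compat; lra).
    rewrite Cmod_mult, Cmod_R, Rabs_pos_eq by (apply ln_1p_exp_ge_0; exact Hr).
    pose proof (ln_1p_le _ Hr). pose proof (ln_1p_exp_ge_0 _ Hr).
    assert (exp v <= exp N) by (apply exp_le; pose proof (Rle_abs v); lra).
    assert (Hmul : (Cmod q + 1) * exp N < eps * x).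
    { apply Rmult_lt_compat_l with (r := eps) in Hx; [|exact He].
      replace (eps * ((Cmod q + 1) * exp N / eps)) with ((Cmod q + 1) * exp N) in Hx by (field; lra).
      exact Hx. }
    apply Rle_lt_trans with (Cmod q * (exp v / x)); [apply Rmult_le_compat_l; lra|].
    apply Rmult_lt_reg_r with x; [exact Hx0|].
    replace (Cmod q * (exp v / x) * x) with (Cmod q * exp v) by (field; lra). nra.
Qed.

Lemma kint_lim_0_beta (p q : C) :
  0 < Re p -> Re (p + q) < 0 ->
  has_clim (kint p q) (at_right 0) (kint p q 0).
Proof.
  intros Hp Hpq.
  set (d := Rmin (Re p) (- Re (p + q))).
  assert (Hd : 0 < d <= Re p /\ Re (p + q) <= - d).
  { split; [split|].
    - apply Rmin_glb_lt; lra.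
    - apply Rmin_l.
    - pose proof (Rmin_r (Re p) (- Re (p + q))). unfold d. lra. }
  apply (cint_exp_lim (at_right 0) _ _ (exp (Rabs (Re q))) d).
  - apply (at_right_intro _ 1 Rlt_0_1). intros x Hx. apply kernel_cdom_0; lra.
  - apply ccontinuous_kernel_exponent.
  - intros N eps He. pose proof (exp_pos N) as HN0.
    apply (at_right_intro _ (eps / exp N)); [apply Rdiv_lt_0_compat; assumption|].
    intros x Hx v Hv.
    replace (_ - _)%C with (- RtoC (x * exp v))%C.
    2: { rewrite Rmult_0_l. ring. }
    pose proof (exp_pos v). rewrite Cmod_opp, Cmod_R, Rabs_pos_eq by nra.
    assert (exp v <= exp N) by (apply exp_le; pose proof (Rle_abs v); lra).
    apply Rle_lt_trans with (x * exp N); [nra|].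
    apply Rmult_lt_reg_r with (/ exp N); [now apply Rinv_0_lt_compat|].
    rewrite Rmult_assoc, Rinv_r, Rmult_1_r by lra. apply Hx.
Qed.

(** In [kint a (c - a - 1) x] the parameter [c] enters only through the second exponent, so this
    continuity carries Tricomi's function to [c = 1]. *)
Lemma kint_lim_param {U : Type} (F : (U -> Prop) -> Prop) {FF : ProperFilter F}
  (p q : C) (qf : U -> C) (x : R) :
  0 < Re p -> 0 < x -> has_clim qf F q ->
  has_clim (fun u => kint p (qf u) x) F (kint p q x).
Proof.
  intros Hp Hx Hq.
  eapply (cint_exp_lim F).
  - eapply filter_imp; [|exact (Hq 1 Rlt_0_1)]. intros u Hu. cbv beta in *.
    apply (kernel_cdom_pos p (qf u) x x (Re p) (Re p) (Rabs (Re q) + 1)); try lra.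
    replace (qf u) with (q + (qf u - q))%C by ring. rewrite Re_Cplus.
    eapply Rle_trans; [apply Rabs_triang|]. pose proof (Re_le_Cmod (qf u - q)). lra.
  - apply ccontinuous_kernel_exponent.
  - intros N eps He.
    assert (HN : 0 <= ln (1 + exp N)) by (apply ln_1p_exp_ge_0; left; apply exp_pos).
    assert (He' : 0 < eps / (ln (1 + exp N) + 1)) by (apply Rdiv_lt_0_compat; lra).
    eapply filter_imp; [|exact (Hq _ He')]. intros u Hu v Hv. cbv beta in *.
    replace (_ - _)%C with ((qf u - q) * RtoC (ln (1 + exp v)))%C by ring.
    rewrite Cmod_mult, Cmod_R. pose proof (exp_pos v).
    rewrite Rabs_pos_eq by (apply ln_1p_exp_ge_0; lra).
    assert (Hle : ln (1 + exp v) <= ln (1 + exp N)).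
    { apply ln_le; [lra|]. assert (exp v <= exp N) by (apply exp_le; pose proof (Rle_abs v); lra).
      lra. }
    pose proof (Cmod_ge_0 (qf u - q)). pose proof (ln_1p_exp_ge_0 (exp v) ltac:(lra)).
    apply Rle_lt_trans with (Cmod (qf u - q) * (ln (1 + exp N) + 1)).
    + apply Rmult_le_compat_l; lra.
    + apply Rmult_lt_compat_r with (r := ln (1 + exp N) + 1) in Hu; [|lra].
      replace (eps / (ln (1 + exp N) + 1) * (ln (1 + exp N) + 1)) with eps in Hu by (field; lra).
      exact Hu.
Qed.

(** A power of [x] is traded for one of [1 + t]: with [w = x (1 + t)], [w^th e^(-w/2)] is at most 2,
    so [x^th] acts like [(1 + t)^(-th)] and restores convergence at [x = 0]. The other 2 in the
    constant 4 bounds [e^(x/2)]. *)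
Lemma kint_bound_0 (p q : C) (th : R) :
  0 < Re p -> 0 < th <= 1 -> Re (p + q) < th ->
  exists K, 0 <= K /\ forall x, 0 < x <= 1 -> Rpower x th * Cmod (kint p q x) <= K.
Proof.
  intros Hp Hth Hpq.
  set (d := Rmin (Re p) (th - Re (p + q))).
  assert (Hd : 0 < d <= Re p /\ Re (p + (q - RtoC th)) <= - d).
  { split; [split|].
    - apply Rmin_glb_lt; lra.
    - apply Rmin_l.
    - pose proof (Rmin_r (Re p) (th - Re (p + q))).
      replace (Re (p + (q - RtoC th))) with (Re (p + q) - th)
        by (rewrite !Re_Cplus, Re_Cminus, re_RtoC; ring). unfold d. lra. }
  set (K := 4 * exp (Rabs (Re (q - RtoC th)))).
  assert (HK : 0 <= K) by (unfold K; pose proof (exp_pos (Rabs (Re (q - RtoC th)))); lra).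
  exists (4 * K / d). split; [apply Rdiv_le_0_compat; lra|].
  intros x Hx. pose proof (exp_pos (th * ln x)) as Hpos. change (exp (th * ln x)) with (Rpower x th) in Hpos.
  replace (Rpower x th * Cmod (kint p q x)) with (Cmod (RtoC (Rpower x th) * kint p q x)%C)
    by (rewrite Cmod_mult, Cmod_R, Rabs_pos_eq by lra; reflexivity).
  unfold kint. rewrite <- cint_scal by (apply kernel_cnice_pos; lra).
  apply cint_bound. split; [|split; [apply Hd|]].
  - intros v. apply ccontinuous_scal, kernel_continuous.
  - intros v. rewrite Cmod_mult, Cmod_R, Rabs_pos_eq by lra.
    destruct (kernel_cdom_0 p (q - RtoC th) (x / 2) d) as (_ & _ & Hdom); try lra.
    specialize (Hdom v). unfold K. rewrite Rmult_assoc.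
    apply Rle_trans with (4 * Cmod (kernel p (q - RtoC th) (x / 2) v)); [|lra].
    rewrite !Cmod_kernel. unfold Rpower. rewrite <- exp_plus.
    pose proof (exp_pos v). set (w := x * (1 + exp v)).
    assert (Hw : 0 < w) by (unfold w; nra).
    assert (E : ln w = ln x + ln (1 + exp v)) by (unfold w; rewrite ln_mult; lra).
    assert (Hlog : exp (th * ln w - w / 2) <= 2).
    { destruct (Rle_dec 0 (ln w)) as [Hl|Hl].
      - apply Rle_trans with (exp (ln w - w / 2)); [apply exp_le; nra|].
        unfold Rminus. rewrite exp_plus, exp_ln, exp_Ropp by exact Hw.
        pose proof (exp_ineq1_le (w / 2)). pose proof (exp_pos (w / 2)).
        apply Rmult_le_reg_r with (exp (w / 2)); [lra|].
        rewrite Rmult_assoc, Rinv_l by lra. lra.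
      - apply Rle_trans with 1; [|lra]. rewrite <- exp_0. apply exp_le. nra. }
    assert (Hh : exp (x / 2) <= 2).
    { pose proof exp_le_3 as H3. replace 1 with (/ 2 + / 2) in H3 by field.
      rewrite exp_plus in H3. pose proof (exp_pos (/ 2)).
      apply Rle_trans with (exp (/ 2)); [apply exp_le; lra|nra]. }
    replace (th * ln x + (Re p * v + Re q * ln (1 + exp v) - x * exp v)) with
      ((th * ln w - w / 2) + (x / 2) + (Re p * v + Re (q - RtoC th) * ln (1 + exp v) - x / 2 * exp v)).
    + rewrite !exp_plus. apply Rmult_le_compat_r; [left; apply exp_pos|].
      replace 4 with (2 * 2) by ring.
      apply Rmult_le_compat; try assumption; left; apply exp_pos.
    + rewrite E, Re_Cminus, re_RtoC. unfold w. field.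
Qed.

(** * Kummer's function *)

Definition cseries (A : nat -> C) (x : R) : C :=
  (PSeries (fun k => Re (A k)) x, PSeries (fun k => Im (A k)) x).

(** Infinite radius of convergence in Cauchy-Hadamard form, which passes easily to sums, shifts and
    multiplication of coefficients by the index. *)
Definition entire (A : nat -> C) : Prop :=
  forall r, 0 <= r -> exists M, forall n, Cmod (A n) * r ^ n <= M.

Lemma entire_CV_radius (A : nat -> C) (p : C -> R) :
  (forall z, Rabs (p z) <= Cmod z) -> entire A -> CV_radius (fun k => p (A k)) = p_infty.
Proof.
  intros Hp HA. pose proof (CV_radius_bounded (fun k => p (A k))) as [Hub _].
  assert (H : forall r, 0 <= r -> Rbar_le r (CV_radius (fun k => p (A k)))).
  { intros r Hr. apply Hub. destruct (HA r Hr) as (M & HM). exists M. intros n.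
    rewrite Rabs_mult, (Rabs_pos_eq (r ^ n)) by now apply pow_le.
    eapply Rle_trans; [|apply (HM n)]. apply Rmult_le_compat_r; [now apply pow_le|apply Hp]. }
  destruct (CV_radius (fun k => p (A k))) as [c| |]; [|reflexivity|].
  - exfalso. specialize (H (Rabs c + 1)). simpl in H. pose proof (Rabs_pos c).
    pose proof (Rle_abs c). lra.
  - exfalso. apply (H 0). lra.
Qed.

Lemma entire_inside (A : nat -> C) (p : C -> R) (x : R) :
  (forall z, Rabs (p z) <= Cmod z) -> entire A ->
  Rbar_lt (Rabs x) (CV_radius (fun k => p (A k))).
Proof. intros Hp HA. now rewrite (entire_CV_radius A p Hp HA). Qed.

Lemma entire_ex (A : nat -> C) (p : C -> R) (x : R) :
  (forall z, Rabs (p z) <= Cmod z) -> entire A -> ex_pseries (fun k => p (A k)) x.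
Proof. intros Hp HA. now apply CV_radius_inside, entire_inside. Qed.

Lemma entire_plus (A B : nat -> C) : entire A -> entire B -> entire (fun k => A k + B k)%C.
Proof.
  intros HA HB r Hr. destruct (HA r Hr) as (M & HM). destruct (HB r Hr) as (N & HN).
  exists (M + N). intros n. specialize (HM n). specialize (HN n).
  pose proof (Cmod_triangle (A n) (B n)). pose proof (pow_le r n Hr). nra.
Qed.

Lemma entire_scal (k : C) (A : nat -> C) : entire A -> entire (fun n => k * A n)%C.
Proof.
  intros HA r Hr. destruct (HA r Hr) as (M & HM). exists (Cmod k * M). intros n.
  rewrite Cmod_mult, Rmult_assoc. apply Rmult_le_compat_l; [apply Cmod_ge_0|apply HM].
Qed.

Lemma cseries_plus (A B : nat -> C) (x : R) :
  entire A -> entire B ->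
  cseries (fun k => A k + B k)%C x = (cseries A x + cseries B x)%C.
Proof.
  intros HA HB. apply C_ext; simpl.
  - rewrite <- PSeries_plus by auto using entire_ex, Re_le_Cmod. reflexivity.
  - rewrite <- PSeries_plus by auto using entire_ex, Im_le_Cmod. reflexivity.
Qed.

Lemma cseries_scal (k : C) (A : nat -> C) (x : R) :
  entire A -> cseries (fun n => k * A n)%C x = (k * cseries A x)%C.
Proof.
  intros HA.
  assert (HR := entire_ex A Re x Re_le_Cmod HA). assert (HI := entire_ex A Im x Im_le_Cmod HA).
  apply C_ext; [rewrite Re_Cmult|rewrite Im_Cmult]; simpl;
    rewrite <- !(PSeries_scal _ _ x); rewrite <- ?PSeries_minus, <- ?PSeries_plus;
    try (apply ex_pseries_scal; [apply Rmult_comm|assumption]); reflexivity.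
Qed.

Lemma cseries_ext (A B : nat -> C) (x : R) : (forall k, A k = B k) -> cseries A x = cseries B x.
Proof. intros H. unfold cseries. f_equal; apply PSeries_ext; intros k; now rewrite H. Qed.

Definition cshift (A : nat -> C) (n : nat) : C := match n with O => 0 | S k => A k end.

Lemma entire_shift (A : nat -> C) : entire A -> entire (cshift A).
Proof.
  intros HA r Hr. destruct (HA r Hr) as (M & HM). exists (Rabs M * r).
  pose proof (Rle_abs M).
  intros [|n]; simpl.
  - rewrite Cmod_0, Rmult_0_l. apply Rmult_le_pos; [apply Rabs_pos|exact Hr].
  - specialize (HM n). replace (Cmod (A n) * (r * r ^ n)) with (Cmod (A n) * r ^ n * r) by ring.
    apply Rmult_le_compat_r; [exact Hr|lra].
Qed.

Lemma cseries_shift (A : nat -> C) (x : R) : cseries (cshift A) x = (RtoC x * cseries A x)%C.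
Proof.
  apply C_ext; [rewrite re_scal_l|rewrite im_scal_l]; simpl; rewrite <- PSeries_incr_1;
    apply PSeries_ext; intros [|n]; reflexivity.
Qed.

Lemma cseries_decr (A : nat -> C) (x : R) :
  entire A -> cseries A x = (A 0%nat + RtoC x * cseries (fun n => A (S n)) x)%C.
Proof.
  intros HA. apply C_ext.
  - transitivity (Re (A 0%nat) + x * Re (cseries (fun n => A (S n)) x)).
    + simpl. rewrite PSeries_decr_1 by now apply (entire_ex A Re x Re_le_Cmod). reflexivity.
    + rewrite <- re_scal_l. reflexivity.
  - transitivity (Im (A 0%nat) + x * Im (cseries (fun n => A (S n)) x)).
    + simpl. rewrite PSeries_decr_1 by now apply (entire_ex A Im x Im_le_Cmod). reflexivity.
    + rewrite <- im_scal_l. reflexivity.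
Qed.

Lemma cderive_cseries (A : nat -> C) (x : R) :
  entire A -> cderive (cseries A) x (cseries (fun n => RtoC (INR (S n)) * A (S n))%C x).
Proof.
  intros HA. split.
  - eapply is_derive_eq; [apply is_derive_PSeries, (entire_inside A Re x Re_le_Cmod HA)|].
    apply PSeries_ext. intros n. exact (eq_sym (re_scal_l (INR (S n)) (A (S n)))).
  - eapply is_derive_eq; [apply is_derive_PSeries, (entire_inside A Im x Im_le_Cmod HA)|].
    apply PSeries_ext. intros n. exact (eq_sym (im_scal_l (INR (S n)) (A (S n)))).
Qed.

Definition kummer_coef (a c : C) (k : nat) : C :=
  (pochhammer a k / pochhammer c k / RtoC (INR (fact k)))%C.

Lemma hyp1F1_series (a c : C) (x : R) : hyp1F1 a c (RtoC x) = cseries (kummer_coef a c) x.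
Proof.
  unfold hyp1F1, CSeries, cseries, PSeries. f_equal; apply Series_ext; intros k;
    rewrite <- RtoC_pow.
  - rewrite <- re_scal_r. f_equal. unfold kummer_coef, Cdiv. ring.
  - rewrite <- im_scal_r. f_equal. unfold kummer_coef, Cdiv. ring.
Qed.

Lemma Re_shift_neq_0 (c : C) (k : nat) : 0 < Re c -> (c + RtoC (INR k))%C <> 0%C.
Proof.
  intros Hc. apply Re_neq_0. rewrite Re_Cplus, re_RtoC. pose proof (pos_INR k). lra.
Qed.

Lemma pochhammer_neq_0 (c : C) (k : nat) : 0 < Re c -> pochhammer c k <> 0%C.
Proof.
  intros Hc. induction k as [|k IH]; [exact C1_nz|].
  rewrite pochhammer_S. apply Cmult_neq_0; [exact IH|now apply Re_shift_neq_0].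
Qed.

(** Each quotient [(a + k) / (c + k)] is bounded uniformly in [k]; a geometric bound is enough since
    the factorial dominates it. *)
Lemma kummer_ratio_bound (a c : C) (k : nat) :
  0 < Re c -> Cmod (pochhammer a k / pochhammer c k) <= ((Cmod a + 1) / Rmin (Re c) 1) ^ k.
Proof.
  intros Hc. pose proof (Cmod_ge_0 a) as Ha.
  assert (Hm : 0 < Rmin (Re c) 1) by (apply Rmin_glb_lt; lra).
  induction k as [|k IH].
  - simpl. rewrite Cmod_div, Cmod_1 by exact C1_nz. lra.
  - rewrite !pochhammer_S. pose proof (Re_shift_neq_0 c k Hc) as Hk.
    pose proof (pochhammer_neq_0 c k Hc) as Hp.
    replace (_ / _)%C with (((a + RtoC (INR k)) / (c + RtoC (INR k))) *
      (pochhammer a k / pochhammer c k))%C by (field; auto).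
    rewrite Cmod_mult. simpl pow. apply Rmult_le_compat; auto using Cmod_ge_0.
    rewrite Cmod_div by exact Hk. pose proof (pos_INR k) as Hk0.
    assert (H1 : Cmod (a + RtoC (INR k)) <= (Cmod a + 1) * (1 + INR k)).
    { eapply Rle_trans; [apply Cmod_triangle|]. rewrite Cmod_R, Rabs_pos_eq by lra. nra. }
    assert (H2 : Rmin (Re c) 1 * (1 + INR k) <= Cmod (c + RtoC (INR k))).
    { eapply Rle_trans; [|apply Re_le_Cmod]. rewrite Re_Cplus, re_RtoC, Rabs_pos_eq by lra.
      pose proof (Rmin_l (Re c) 1). pose proof (Rmin_r (Re c) 1). nra. }
    assert (H3 : 0 < Cmod (c + RtoC (INR k))) by now apply Cmod_gt_0.
    apply Rmult_le_reg_r with (Cmod (c + RtoC (INR k))); [exact H3|].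
    unfold Rdiv at 1. rewrite Rmult_assoc, Rinv_l, Rmult_1_r by lra.
    eapply Rle_trans; [exact H1|].
    replace ((Cmod a + 1) * (1 + INR k)) with
      ((Cmod a + 1) / Rmin (Re c) 1 * (Rmin (Re c) 1 * (1 + INR k))) by (field; lra).
    apply Rmult_le_compat_l; [apply Rdiv_le_0_compat; lra|exact H2].
Qed.

Lemma pow_div_fact_le (x : R) (n : nat) : 0 <= x -> x ^ n / INR (fact n) <= exp x.
Proof.
  intros Hx. eapply Rle_trans; [|apply (exp_ge_taylor x n Hx)].
  assert (Hpos : forall k, 0 <= x ^ k / INR (fact k)).
  { intros k. apply Rdiv_le_0_compat; [now apply pow_le|apply INR_fact_lt_0]. }
  destruct n as [|n]; [apply Rle_refl|]. rewrite tech5.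
  assert (0 <= sum_f_R0 (fun k => x ^ k / INR (fact k)) n) by (apply cond_pos_sum, Hpos). lra.
Qed.

Lemma kummer_entire (a c : C) : 0 < Re c -> entire (kummer_coef a c).
Proof.
  intros Hc r Hr. set (K := (Cmod a + 1) / Rmin (Re c) 1).
  assert (HK : 0 <= K).
  { pose proof (Cmod_ge_0 a). apply Rdiv_le_0_compat; [lra|apply Rmin_glb_lt; lra]. }
  exists (exp (K * r)). intros n. unfold kummer_coef.
  rewrite Cmod_div by apply INR_fact_neq_0'. rewrite Cmod_R.
  pose proof (INR_fact_lt_0 n) as Hf. rewrite (Rabs_pos_eq (INR (fact n))) by lra.
  eapply Rle_trans; [|apply (pow_div_fact_le (K * r) n)].
  - rewrite Rpow_mult_distr. unfold Rdiv.
    replace (K ^ n * r ^ n * / INR (fact n)) with (K ^ n * / INR (fact n) * r ^ n) by ring.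
    apply Rmult_le_compat_r; [now apply pow_le|].
    apply Rmult_le_compat_r; [left; now apply Rinv_0_lt_compat|].
    now apply kummer_ratio_bound.
  - now apply Rmult_le_pos.
Qed.

Lemma entire_index (A : nat -> C) : entire A -> entire (fun n => RtoC (INR n) * A n)%C.
Proof.
  intros HA r Hr. destruct (HA (2 * r)) as (M & HM); [lra|]. exists M. intros n.
  eapply Rle_trans; [|apply (HM n)].
  rewrite Cmod_mult, Cmod_R, Rabs_pos_eq, Rpow_mult_distr by apply pos_INR.
  assert (H2 : INR n <= 2 ^ n).
  { clear. induction n as [|n IH]; [simpl; lra|]. rewrite S_INR. simpl.
    pose proof (pow_R1_Rle 2 n ltac:(lra)). lra. }
  pose proof (Cmod_ge_0 (A n)). pose proof (pow_le r n Hr).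
  replace (Cmod (A n) * (2 ^ n * r ^ n)) with (2 ^ n * Cmod (A n) * r ^ n) by ring.
  apply Rmult_le_compat_r; [assumption|]. now apply Rmult_le_compat_r.
Qed.

(** Coefficient form of $xM'=a\,(M(a+1)-M(a))$, from $(a)_k(a+k)=a\,(a+1)_k$. *)
Lemma kummer_coef_raise (a c : C) (k : nat) :
  0 < Re c ->
  (RtoC (INR k) * kummer_coef a c k = a * kummer_coef (a + 1) c k + (- a) * kummer_coef a c k)%C.
Proof.
  intros Hc. unfold kummer_coef.
  assert (E : (a * pochhammer (a + 1) k = pochhammer a k * (a + RtoC (INR k)))%C)
    by (rewrite <- pochhammer_plus_1; apply pochhammer_S).
  transitivity ((a * pochhammer (a + 1) k - a * pochhammer a k) / pochhammer c k / RtoC (INR (fact k)))%C.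
  - rewrite E. field. split; auto using INR_fact_neq_0', pochhammer_neq_0.
  - field. split; auto using INR_fact_neq_0', pochhammer_neq_0.
Qed.

(** Coefficient form of $xM'=(c-a)M(a-1)+(a-c+x)M(a)$; multiplication by [x] appears as [cshift]. *)
Lemma kummer_coef_lower (a c : C) (k : nat) :
  0 < Re c ->
  (RtoC (INR k) * kummer_coef a c k =
   (c - a) * kummer_coef (a - 1) c k + ((a - c) * kummer_coef a c k
     + cshift (kummer_coef a c) k))%C.
Proof.
  intros Hc. destruct k as [|k].
  - unfold kummer_coef; simpl. field.
  - simpl cshift. unfold kummer_coef.
    rewrite (pochhammer_plus_1 (a - 1)). replace (a - 1 + 1)%C with a by ring.
    rewrite !pochhammer_S, fact_simpl, mult_INR, RtoC_mult, S_INR, RtoC_plus.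
    pose proof (pochhammer_neq_0 c k Hc). pose proof (Re_shift_neq_0 c k Hc).
    pose proof (INR_fact_neq_0' k).
    assert ((RtoC (INR k) + 1)%C <> 0%C).
    { apply Re_neq_0. simpl. pose proof (pos_INR k). lra. }
    field. auto.
Qed.

Lemma cseries_x_derive (A : nat -> C) (x : R) :
  entire A ->
  (RtoC x * cseries (fun n => RtoC (INR (S n)) * A (S n)) x =
   cseries (fun n => RtoC (INR n) * A n) x)%C.
Proof.
  intros HA. rewrite (cseries_decr (fun n => RtoC (INR n) * A n)%C x) by now apply entire_index.
  simpl INR at 2. ring.
Qed.

Lemma cderive_hyp1F1 (a c : C) (x : R) :
  0 < Re c -> 0 < x ->
  cderive (fun t => hyp1F1 a c (RtoC t)) x
    (a * (hyp1F1 (a + 1) c (RtoC x) - hyp1F1 a c (RtoC x)) / RtoC x).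
Proof.
  intros Hc Hx. apply (cderive_ext (cseries (kummer_coef a c))).
  { intros t. symmetry. apply hyp1F1_series. }
  pose proof (kummer_entire a c Hc) as HA. pose proof (kummer_entire (a + 1) c Hc) as HA1.
  eapply cderive_eq; [now apply cderive_cseries|].
  assert (Hx0 : RtoC x <> 0%C) by (apply RtoC_neq_0; lra).
  pose proof (cseries_x_derive (kummer_coef a c) x HA) as E.
  rewrite (cseries_ext _ _ x (fun k => kummer_coef_raise a c k Hc)) in E.
  rewrite cseries_plus, !cseries_scal in E by auto using entire_scal.
  rewrite !hyp1F1_series.
  transitivity (RtoC x * cseries (fun n => RtoC (INR (S n)) * kummer_coef a c (S n)) x / RtoC x)%C.
  - field. exact Hx0.
  - rewrite E. field. exact Hx0.
Qed.

(** The two expressions for [x M'], raising and lowering [a], are equated. *)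
Lemma hyp1F1_contiguous (a c : C) (x : R) :
  0 < Re c ->
  ((c - a) * hyp1F1 (a - 1) c (RtoC x) + (2 * a - c + RtoC x) * hyp1F1 a c (RtoC x)
   - a * hyp1F1 (a + 1) c (RtoC x) = 0)%C.
Proof.
  intros Hc. pose proof (kummer_entire a c Hc) as HA.
  pose proof (kummer_entire (a + 1) c Hc) as HA1. pose proof (kummer_entire (a - 1) c Hc) as HA2.
  pose proof (cseries_ext _ _ x (fun k => kummer_coef_raise a c k Hc)) as E1.
  pose proof (cseries_ext _ _ x (fun k => kummer_coef_lower a c k Hc)) as E2.
  rewrite cseries_plus, !cseries_scal in E1 by auto using entire_scal.
  rewrite !cseries_plus, !cseries_scal, cseries_shift in E2
    by auto using entire_scal, entire_plus, entire_shift.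
  rewrite E1 in E2. rewrite !hyp1F1_series.
  set (M := cseries (kummer_coef a c) x) in *. set (Mp := cseries (kummer_coef (a + 1) c) x) in *.
  set (Mm := cseries (kummer_coef (a - 1) c) x) in *.
  transitivity (((c - a) * Mm + ((a - c) * M + RtoC x * M)) - (a * Mp + - a * M))%C; [ring|].
  rewrite E2. ring.
Qed.

(** Existence of the slope is what matters, not its value: in the Wronskian limits [1F1 - 1]
    supplies one power of [x] against the singular integrals. *)
Lemma hyp1F1_0_slope (a c : C) :
  0 < Re c ->
  exists l, has_clim (fun x => (hyp1F1 a c (RtoC x) - 1) / RtoC x)%C (at_right 0) l.
Proof.
  intros Hc. pose proof (kummer_entire a c Hc) as HA.
  set (B := fun n => kummer_coef a c (S n)).
  assert (HB : entire B).
  { intros r Hr. destruct (HA (r + 1)) as (M & HM); [lra|]. exists M. intros n.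
    eapply Rle_trans; [|apply (HM (S n))]. unfold B. apply Rmult_le_compat_l; [apply Cmod_ge_0|].
    pose proof (pow_incr r (r + 1) n ltac:(lra)). pose proof (pow_le (r + 1) n ltac:(lra)).
    simpl. nra. }
  exists (cseries B 0).
  apply (has_clim_ext_loc (at_right 0) (cseries B)).
  { apply (at_right_intro _ 1 Rlt_0_1). intros x Hx.
    rewrite hyp1F1_series, (cseries_decr _ x HA). fold B.
    unfold kummer_coef. simpl.
    assert (RtoC x <> 0%C) by (apply RtoC_neq_0; lra).
    field. assumption. }
  pose proof (cderive_continuous _ _ _ (cderive_cseries B 0 HB)) as [H1 H2].
  intros eps He. assert (He2 : 0 < eps / 2) by lra.
  assert (H1' : locally 0 (fun t => Rabs (Re (cseries B t) - Re (cseries B 0)) < eps / 2))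
    by exact (H1 _ (locally_ball _ (mkposreal _ He2))).
  assert (H2' : locally 0 (fun t => Rabs (Im (cseries B t) - Im (cseries B 0)) < eps / 2))
    by exact (H2 _ (locally_ball _ (mkposreal _ He2))).
  destruct (filter_and _ _ H1' H2') as (d & Hd).
  exists d. intros y Hy _. destruct (Hd y Hy) as [G1 G2].
  eapply Rle_lt_trans; [apply Cmod_le_parts|]. rewrite Re_Cminus, Im_Cminus.
  lra.
Qed.

(** * Tricomi's function as an integral *)

(** First-order form of Kummer's equation, satisfied by the functions of
    parameters [a] and [a + 1] once these are suitably normalized. *)
Definition ksystem (a c : C) (f g : R -> C) : Prop :=
  forall x, 0 < x ->
    cderive f x ((- a * f x + (a - c + 1) * g x) / RtoC x) /\
    cderive g x ((- a * f x + (a - c + 1 + RtoC x) * g x) / RtoC x).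

(** The trace of the matrix of [ksystem] is [(1 - c)/x + 1]; by Abel's formula the weight
    [x^(c-1) e^(-x)] makes the determinant constant. *)
Definition wronskian (c : C) (f1 g1 f2 g2 : R -> C) (x : R) : C :=
  (Rcpow x (c - 1) * RtoC (exp (- x)) * (f1 x * g2 x - f2 x * g1 x))%C.

Lemma cderive_exp_opp (x : R) :
  cderive (fun t => RtoC (exp (- t))) x (- RtoC (exp (- x))).
Proof.
  rewrite <- RtoC_opp. apply cderive_RtoC. auto_derive; [exact I|ring].
Qed.

Lemma wronskian_const (a c : C) (f1 g1 f2 g2 : R -> C) :
  ksystem a c f1 g1 -> ksystem a c f2 g2 ->
  exists k, forall x, 0 < x -> wronskian c f1 g1 f2 g2 x = k.
Proof.
  intros H1 H2.
  assert (Hd : forall x, 0 < x -> cderive (wronskian c f1 g1 f2 g2) x 0).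
  { intros x Hx. destruct (H1 x Hx) as [A1 B1]. destruct (H2 x Hx) as [A2 B2].
    unfold wronskian. eapply cderive_eq.
    - apply cderive_mult; [apply cderive_mult|apply cderive_minus; apply cderive_mult];
        try eassumption.
      + apply cderive_Rcpow, Hx.
      + apply cderive_exp_opp.
    - cbv beta. field. apply RtoC_neq_0. lra. }
  exists (wronskian c f1 g1 f2 g2 1). intros x Hx.
  destruct (Rle_dec x 1) as [Hx1|Hx1].
  - apply cderive_0_const; [exact Hx1|]. intros t Ht. apply Hd. lra.
  - symmetry. apply cderive_0_const; [lra|]. intros t Ht. apply Hd. lra.
Qed.

(** The second component is the same integral with [a + 1] and unchanged [c], as
    [c - (a+1) - 1 = c - a - 2]. Differentiation produces [kint (a + 1) (c - a - 1)], which
    integration by parts eliminates. *)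
Lemma ksystem_kint (a c : C) :
  0 < Re a -> ksystem a c (kint a (c - a - 1)) (kint (a + 1) (c - a - 2)).
Proof.
  intros Ha x Hx.
  assert (Ha1 : 0 < Re (a + 1)) by (rewrite !Re_Cplus, re_RtoC; lra).
  assert (Ha2 : 0 < Re (a + 1 + 1)) by (rewrite !Re_Cplus, re_RtoC; lra).
  assert (Hx0 : RtoC x <> 0%C) by (apply RtoC_neq_0; lra).
  pose proof (kint_ibp a (c - a - 1) x Ha Hx) as E.
  replace (c - a - 1 - 1)%C with (c - a - 2)%C in E by ring.
  assert (E' : (RtoC x * kint (a + 1) (c - a - 1) x =
    a * kint a (c - a - 1) x + (c - a - 1) * kint (a + 1) (c - a - 2) x)%C).
  { apply Ceq_minus. rewrite <- Copp_0, <- E. ring. }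
  split.
  - eapply cderive_eq; [now apply cderive_kint|].
    transitivity (- (RtoC x * kint (a + 1) (c - a - 1) x) / RtoC x)%C; [field; exact Hx0|].
    rewrite E'. field. exact Hx0.
  - eapply cderive_eq; [now apply cderive_kint|].
    assert (E2 : kint (a + 1) (c - a - 1) x =
      (kint (a + 1) (c - a - 2) x + kint (a + 1 + 1) (c - a - 2) x)%C).
    { rewrite <- kint_succ by now apply kernel_cnice_pos. f_equal. ring. }
    replace (kint (a + 1 + 1) (c - a - 2) x) with
      (kint (a + 1) (c - a - 1) x - kint (a + 1) (c - a - 2) x)%C by (rewrite E2; ring).
    transitivity (- (RtoC x * kint (a + 1) (c - a - 1) x
      - RtoC x * kint (a + 1) (c - a - 2) x) / RtoC x)%C; [field; exact Hx0|].
    rewrite E'. field. exact Hx0.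
Qed.

Definition kummer1 (a c : C) (x : R) : C := hyp1F1 a c (RtoC x).

Definition kummer2 (a c : C) (x : R) : C :=
  (Rcpow x (1 - c) * hyp1F1 (a - c + 1) (2 - c) (RtoC x))%C.

(** The factor [a / (a - c + 1)] is the normalization that the first equation of the system forces
    on the second component. *)
Lemma ksystem_kummer1 (a c : C) :
  0 < Re c -> (a - c + 1)%C <> 0%C ->
  ksystem a c (kummer1 a c) (fun x => a / (a - c + 1) * hyp1F1 (a + 1) c (RtoC x))%C.
Proof.
  intros Hc Hac x Hx. assert (Hx0 : RtoC x <> 0%C) by (apply RtoC_neq_0; lra).
  split.
  - eapply cderive_eq; [now apply cderive_hyp1F1|].
    unfold kummer1. field. auto.
  - eapply cderive_eq; [now apply cderive_scal, cderive_hyp1F1|].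
    pose proof (hyp1F1_contiguous (a + 1) c x Hc) as E.
    replace (a + 1 - 1)%C with a in E by ring.
    assert (E' : ((a + 1) * hyp1F1 (a + 1 + 1) c (RtoC x) =
      (c - (a + 1)) * hyp1F1 a c (RtoC x) + (2 * (a + 1) - c + RtoC x) * hyp1F1 (a + 1) c (RtoC x))%C).
    { apply Ceq_minus. rewrite <- Copp_0, <- E. ring. }
    transitivity (a / (a - c + 1) * ((a + 1) * hyp1F1 (a + 1 + 1) c (RtoC x)
      - (a + 1) * hyp1F1 (a + 1) c (RtoC x)) / RtoC x)%C; [field; auto|].
    rewrite E'. unfold kummer1. field. auto.
Qed.

Lemma ksystem_kummer2 (a c : C) :
  Re c < 2 ->
  ksystem a c (kummer2 a c) (fun x => Rcpow x (1 - c) * hyp1F1 (a - c + 2) (2 - c) (RtoC x))%C.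
Proof.
  intros Hc x Hx. assert (Hx0 : RtoC x <> 0%C) by (apply RtoC_neq_0; lra).
  assert (Hc2 : 0 < Re (2 - c)) by (rewrite Re_Cminus, re_RtoC; lra).
  split.
  - eapply cderive_eq.
    + apply cderive_mult; [now apply cderive_Rcpow|now apply cderive_hyp1F1].
    + cbv beta. unfold kummer2. replace (a - c + 1 + 1)%C with (a - c + 2)%C by ring.
      field. exact Hx0.
  - eapply cderive_eq.
    + apply cderive_mult; [now apply cderive_Rcpow|now apply cderive_hyp1F1].
    + cbv beta. unfold kummer2.
      pose proof (hyp1F1_contiguous (a - c + 2) (2 - c) x Hc2) as E.
      replace (a - c + 2 - 1)%C with (a - c + 1)%C in E by ring.
      assert (E' : ((a - c + 2) * hyp1F1 (a - c + 2 + 1) (2 - c) (RtoC x) =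
        (2 - c - (a - c + 2)) * hyp1F1 (a - c + 1) (2 - c) (RtoC x)
        + (2 * (a - c + 2) - (2 - c) + RtoC x) * hyp1F1 (a - c + 2) (2 - c) (RtoC x))%C).
      { apply Ceq_minus. rewrite <- Copp_0, <- E. ring. }
      transitivity ((1 - c) / RtoC x * Rcpow x (1 - c) * hyp1F1 (a - c + 2) (2 - c) (RtoC x) +
        Rcpow x (1 - c) * ((a - c + 2) * hyp1F1 (a - c + 2 + 1) (2 - c) (RtoC x)
          - (a - c + 2) * hyp1F1 (a - c + 2) (2 - c) (RtoC x)) / RtoC x)%C; [field; exact Hx0|].
      rewrite E'. field. exact Hx0.
Qed.

Lemma has_clim_id_0 : has_clim RtoC (at_right 0) 0.
Proof.
  intros eps He. apply (at_right_intro _ eps He). intros x Hx.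
  rewrite <- RtoC_minus, Cmod_R, Rminus_0_r, Rabs_pos_eq by lra. apply Hx.
Qed.

Lemma has_clim_exp_opp_0 : has_clim (fun x => RtoC (exp (- x))) (at_right 0) 1.
Proof.
  intros eps He.
  destruct (cderive_continuous _ _ _ (cderive_exp_opp 0)) as [H _].
  assert (H' : locally 0 (fun t => Rabs (exp (- t) - exp (- 0)) < eps))
    by exact (H _ (locally_ball _ (mkposreal _ He))).
  destruct H' as (d & Hd). exists d. intros y Hy _. specialize (Hd y Hy).
  rewrite Ropp_0, exp_0 in Hd. rewrite <- RtoC_minus, Cmod_R. exact Hd.
Qed.

Lemma hyp1F1_lim_0 (a c : C) :
  0 < Re c -> has_clim (fun x => hyp1F1 a c (RtoC x)) (at_right 0) 1.
Proof.
  intros Hc. destruct (hyp1F1_0_slope a c Hc) as (l & Hl).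
  replace (RtoC 1) with (1 + 0 * l)%C by ring.
  apply (has_clim_ext_loc _ (fun x => 1 + RtoC x * ((hyp1F1 a c (RtoC x) - 1) / RtoC x))%C).
  - apply (at_right_intro _ 1 Rlt_0_1). intros x Hx.
    assert (RtoC x <> 0%C) by (apply RtoC_neq_0; lra). field. assumption.
  - apply has_clim_plus; [typeclasses eauto|apply has_clim_const; typeclasses eauto|].
    apply has_clim_mult; [typeclasses eauto|apply has_clim_id_0|exact Hl].
Qed.

Lemma Rpower_small (th eps : R) :
  0 < th -> 0 < eps -> at_right 0 (fun x => Rpower x th < eps).
Proof.
  intros Hth He. apply (at_right_intro _ (Rpower eps (/ th))); [apply exp_pos|].
  intros x Hx. apply Rlt_le_trans with (Rpower (Rpower eps (/ th)) th).
  - apply Rlt_Rpower_l; [exact Hth|exact Hx].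
  - right. rewrite Rpower_mult, Rinv_l, Rpower_1 by lra. reflexivity.
Qed.

Lemma kint_small_0 (p q s : C) (th : R) :
  0 < Re p -> 0 < th <= 1 -> Re (p + q) < th < Re s ->
  has_clim (fun x => Rcpow x s * kint p q x)%C (at_right 0) 0.
Proof.
  intros Hp Hth Hs. destruct (kint_bound_0 p q th Hp Hth (proj1 Hs)) as (K & HK & HKx).
  intros eps He.
  assert (He' : 0 < eps / (K + 1)) by (apply Rdiv_lt_0_compat; lra).
  assert (Hths : 0 < Re s - th) by lra.
  eapply filter_imp; [|exact (filter_and _ _ (Rpower_small _ _ Hths He')
    (at_right_intro (fun x => 0 < x < 1) 1 Rlt_0_1 (fun x H => H)))].
  intros x [H1 Hx]. cbv beta in *. replace (_ - 0)%C with (Rcpow x s * kint p q x)%C by ring.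
  rewrite Cmod_mult, Cmod_Rcpow. replace (Re s) with ((Re s - th) + th) by ring.
  rewrite Rpower_plus, Rmult_assoc. specialize (HKx x ltac:(lra)).
  pose proof (exp_pos ((Re s - th) * ln x)) as Hp1. fold (Rpower x (Re s - th)) in Hp1.
  apply Rle_lt_trans with (Rpower x (Re s - th) * (K + 1)).
  - apply Rmult_le_compat_l; lra.
  - apply Rmult_lt_compat_r with (r := K + 1) in H1; [|lra].
    replace (eps / (K + 1) * (K + 1)) with eps in H1 by (field; lra). exact H1.
Qed.

(** With both 1F1 replaced by 1, integration by parts collapses the determinant to a multiple of
    [x kint (a+1) (c-a-1) x], whose scaled limit is [gammaint c]. The corrections contain
    [(1F1 - 1) / x] and vanish. *)
Lemma wronskian_kint_kummer1_lim (a c : C) :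
  1 <= Re a -> 0 < Re c < 2 -> (a - c + 1)%C <> 0%C ->
  has_clim (wronskian c (kint a (c - a - 1)) (kint (a + 1) (c - a - 2))
     (kummer1 a c) (fun x => a / (a - c + 1) * hyp1F1 (a + 1) c (RtoC x))%C) (at_right 0)
    (gammaint c / (a - c + 1)).
Proof.
  intros Ha Hc Hac.
  destruct (hyp1F1_0_slope a c (proj1 Hc)) as (l0 & Hl0).
  destruct (hyp1F1_0_slope (a + 1) c (proj1 Hc)) as (l1 & Hl1).
  assert (Ha1 : 0 < Re (a + 1)) by (rewrite !Re_Cplus, re_RtoC; lra).
  assert (K0 : has_clim (fun x => Rcpow x c * kint a (c - a - 1) x)%C (at_right 0) 0).
  (* [Re c / 2] is at most 1 and lies strictly between [Re c - 1] and [Re c], because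
     [0 < Re c < 2]. *)
  { apply (kint_small_0 a (c - a - 1) c (Re c / 2)); [lra|lra|].
    replace (a + (c - a - 1))%C with (c - 1)%C by ring. rewrite Re_Cminus, re_RtoC; lra. }
  assert (K1 : has_clim (fun x => Rcpow x c * kint (a + 1) (c - a - 2) x)%C (at_right 0) 0).
  { apply (kint_small_0 (a + 1) (c - a - 2) c (Re c / 2)); [lra|lra|].
    replace (a + 1 + (c - a - 2))%C with (c - 1)%C by ring. rewrite Re_Cminus, re_RtoC; lra. }
  assert (KG : has_clim (fun x => Rcpow x c * kint (a + 1) (c - a - 1) x)%C (at_right 0) (gammaint c)).
  { assert (Hq : Re (c - a - 1) <= 0) by (rewrite !Re_Cminus, re_RtoC; lra).
    pose proof (kint_lim_0_gamma (a + 1) (c - a - 1) Ha1 Hq) as H.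
    replace (a + 1 + (c - a - 1))%C with c in H by ring. apply H, Hc. }
  replace (gammaint c / (a - c + 1))%C with
    (1 * (/ (a - c + 1) * (gammaint c + (a * (0 * l1) - (a - c + 1) * (0 * l0)))))%C
    by (field; exact Hac).
  eapply has_clim_ext_loc; [typeclasses eauto| |].
  2: { apply has_clim_mult; [typeclasses eauto|apply has_clim_exp_opp_0|].
       apply has_clim_scal; [typeclasses eauto|].
       apply has_clim_plus; [typeclasses eauto|exact KG|].
       apply has_clim_minus; [typeclasses eauto|..];
         (apply has_clim_scal; [typeclasses eauto|]).
       - apply has_clim_mult; [typeclasses eauto|exact K0|exact Hl1].
       - apply has_clim_mult; [typeclasses eauto|exact K1|exact Hl0]. }
  apply (at_right_intro _ 1 Rlt_0_1). intros x Hx.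
  assert (Hx0 : RtoC x <> 0%C) by (apply RtoC_neq_0; lra).
  pose proof (kint_ibp a (c - a - 1) x ltac:(lra) ltac:(lra)) as E.
  replace (c - a - 1 - 1)%C with (c - a - 2)%C in E by ring.
  assert (E' : kint (a + 1) (c - a - 1) x =
    ((a * kint a (c - a - 1) x + (c - a - 1) * kint (a + 1) (c - a - 2) x) / RtoC x)%C).
  { transitivity (RtoC x * kint (a + 1) (c - a - 1) x / RtoC x)%C; [field; exact Hx0|].
    f_equal. apply Ceq_minus. rewrite <- Copp_0, <- E. ring. }
  unfold wronskian, kummer1. rewrite E'.
  replace (Rcpow x c) with (Rcpow x (c - 1) * RtoC x)%C.
  - field. auto.
  - rewrite <- (Rcpow_1 x), <- Rcpow_plus by lra. f_equal. ring.
Qed.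

(** The powers of [x] cancel. With both 1F1 replaced by 1 the difference of the two integrals is
    [kint a (c - a - 2) x], which converges at [x = 0] to a beta integral. *)
Lemma wronskian_kint_kummer2_lim (a c : C) :
  1 <= Re a -> 0 < Re c < 2 ->
  has_clim (wronskian c (kint a (c - a - 1)) (kint (a + 1) (c - a - 2))
     (kummer2 a c) (fun x => Rcpow x (1 - c) * hyp1F1 (a - c + 2) (2 - c) (RtoC x))%C) (at_right 0)
    (betaint a (2 - c)).
Proof.
  intros Ha Hc.
  assert (Hc2 : 0 < Re (2 - c)) by (rewrite Re_Cminus, re_RtoC; lra).
  destruct (hyp1F1_0_slope (a - c + 1) (2 - c) Hc2) as (l0 & Hl0).
  destruct (hyp1F1_0_slope (a - c + 2) (2 - c) Hc2) as (l1 & Hl1).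
  assert (Ha1 : 0 < Re (a + 1)) by (rewrite !Re_Cplus, re_RtoC; lra).
  assert (K0 : has_clim (fun x => RtoC x * kint a (c - a - 1) x)%C (at_right 0) 0).
  { eapply has_clim_ext_loc; [typeclasses eauto| |apply (kint_small_0 a (c - a - 1) 1 (Re c / 2))];
      [|lra|lra|].
    - apply (at_right_intro _ 1 Rlt_0_1). intros x Hx. now rewrite Rcpow_1.
    - replace (a + (c - a - 1))%C with (c - 1)%C by ring. rewrite Re_Cminus, re_RtoC; lra. }
  assert (K1 : has_clim (fun x => RtoC x * kint (a + 1) (c - a - 2) x)%C (at_right 0) 0).
  { eapply has_clim_ext_loc; [typeclasses eauto| |apply (kint_small_0 (a + 1) (c - a - 2) 1 (Re c / 2))];
      [|lra|lra|].
    - apply (at_right_intro _ 1 Rlt_0_1). intros x Hx. now rewrite Rcpow_1.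
    - replace (a + 1 + (c - a - 2))%C with (c - 1)%C by ring. rewrite Re_Cminus, re_RtoC; lra. }
  assert (KB : has_clim (kint a (c - a - 2)) (at_right 0) (betaint a (2 - c))).
  { unfold betaint. replace (- (a + (2 - c)))%C with (c - a - 2)%C by ring.
    apply kint_lim_0_beta; [lra|]. replace (a + (c - a - 2))%C with (c - 2)%C by ring.
    rewrite Re_Cminus, re_RtoC; lra. }
  replace (betaint a (2 - c))%C with
    (1 * (betaint a (2 - c) + (0 * l1 - 0 * l0)))%C by ring.
  eapply has_clim_ext_loc; [typeclasses eauto| |].
  2: { apply has_clim_mult; [typeclasses eauto|apply has_clim_exp_opp_0|].
       apply has_clim_plus; [typeclasses eauto|exact KB|].
       apply has_clim_minus; [typeclasses eauto|..].
       - apply has_clim_mult; [typeclasses eauto|exact K0|exact Hl1].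
       - apply has_clim_mult; [typeclasses eauto|exact K1|exact Hl0]. }
  apply (at_right_intro _ 1 Rlt_0_1). intros x Hx.
  assert (Hx0 : RtoC x <> 0%C) by (apply RtoC_neq_0; lra).
  pose proof (kint_succ a (c - a - 2) x) as E.
  replace (c - a - 2 + 1)%C with (c - a - 1)%C in E by ring.
  assert (E' : kint a (c - a - 2) x = (kint a (c - a - 1) x - kint (a + 1) (c - a - 2) x)%C).
  { rewrite E by (apply kernel_cnice_pos; lra). ring. }
  unfold wronskian, kummer2. rewrite E'.
  replace (Rcpow x (c - 1)) with (/ Rcpow x (1 - c))%C
    by (rewrite <- Rcpow_opp; f_equal; ring).
  pose proof (Rcpow_neq_0 x (1 - c)). field. auto.
Qed.

(** Only the values 1 at the origin enter: [1 - a/(a-c+1)]. The result is nonzero for [c <> 1],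
    where the two Kummer solutions are independent. *)
Lemma wronskian_kummer12_lim (a c : C) :
  0 < Re c < 2 -> (a - c + 1)%C <> 0%C ->
  has_clim (wronskian c
     (kummer1 a c) (fun x => a / (a - c + 1) * hyp1F1 (a + 1) c (RtoC x))%C
     (kummer2 a c) (fun x => Rcpow x (1 - c) * hyp1F1 (a - c + 2) (2 - c) (RtoC x))%C) (at_right 0)
    ((1 - c) / (a - c + 1)).
Proof.
  intros Hc Hac.
  assert (Hc2 : 0 < Re (2 - c)) by (rewrite Re_Cminus, re_RtoC; lra).
  replace ((1 - c) / (a - c + 1))%C with (1 * (1 * 1 - a / (a - c + 1) * (1 * 1)))%C
    by (field; exact Hac).
  eapply has_clim_ext_loc; [typeclasses eauto| |].
  2: { apply has_clim_mult; [typeclasses eauto|apply has_clim_exp_opp_0|].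
       apply has_clim_minus; [typeclasses eauto|..].
       - apply has_clim_mult; [typeclasses eauto|apply (hyp1F1_lim_0 a c), Hc|].
         apply (hyp1F1_lim_0 (a - c + 2) (2 - c)), Hc2.
       - apply has_clim_scal; [typeclasses eauto|].
         apply has_clim_mult; [typeclasses eauto|apply (hyp1F1_lim_0 (a - c + 1) (2 - c)), Hc2|].
         apply (hyp1F1_lim_0 (a + 1) c), Hc. }
  apply (at_right_intro _ 1 Rlt_0_1). intros x Hx.
  unfold wronskian, kummer1, kummer2.
  replace (Rcpow x (c - 1)) with (/ Rcpow x (1 - c))%C
    by (rewrite <- Rcpow_opp; f_equal; ring).
  pose proof (Rcpow_neq_0 x (1 - c)). field. auto.
Qed.

Lemma has_clim_eventually_const {U : Type} (F : (U -> Prop) -> Prop) {FF : ProperFilter F}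
  (f : U -> C) (k l : C) : F (fun u => f u = k) -> has_clim f F l -> k = l.
Proof.
  intros H1 H2. apply (has_clim_unique F f); [|exact H2].
  apply (has_clim_ext_loc F (fun _ => k)); [|apply has_clim_const; typeclasses eauto].
  eapply filter_imp; [|exact H1]. intros u Hu. now symmetry.
Qed.

(** Three solutions of a two-dimensional system are linearly related, with their Wronskians as
    coefficients. The limits at 0 evaluate these constants, and the functional equation of [rGamma]
    brings them to the form in the definition. *)
Lemma tricomi_nonint_kint (a c : C) (x : R) :
  2 <= Re a -> 0 < Re c < 2 -> c <> 1%C -> 0 < x ->
  tricomi_nonint a c x = (rGamma a * kint a (c - a - 1) x)%C.
Proof.
  intros Ha Hc Hc1 Hx.
  assert (Hac : 0 < Re (a - c + 1)) by (rewrite Re_Cplus, Re_Cminus, re_RtoC; lra).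
  assert (Hac0 : (a - c + 1)%C <> 0%C) by (apply Re_neq_0; lra).
  assert (Hc0 : (1 - c)%C <> 0%C) by (intros E; apply Hc1; apply Ceq_minus in E; now rewrite E).
  assert (Ha0 : 0 < Re a) by lra. assert (Ha1 : 1 <= Re a) by lra.
  assert (Hc2 : 0 < Re (2 - c)) by (rewrite Re_Cminus, re_RtoC; lra).
  pose proof (ksystem_kint a c Ha0) as SI. pose proof (ksystem_kummer1 a c (proj1 Hc) Hac0) as S1.
  pose proof (ksystem_kummer2 a c (proj2 Hc)) as S2.
  destruct (wronskian_const _ _ _ _ _ _ SI S1) as (k1 & W1).
  destruct (wronskian_const _ _ _ _ _ _ SI S2) as (k2 & W2).
  destruct (wronskian_const _ _ _ _ _ _ S1 S2) as (k12 & W12).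
  assert (E1 := has_clim_eventually_const (at_right 0) _ _ _
    (at_right_intro _ 1 Rlt_0_1 (fun y Hy => W1 y (proj1 Hy))) (wronskian_kint_kummer1_lim a c Ha1 Hc Hac0)).
  assert (E2 := has_clim_eventually_const (at_right 0) _ _ _
    (at_right_intro _ 1 Rlt_0_1 (fun y Hy => W2 y (proj1 Hy))) (wronskian_kint_kummer2_lim a c Ha1 Hc)).
  assert (E12 := has_clim_eventually_const (at_right 0) _ _ _
    (at_right_intro _ 1 Rlt_0_1 (fun y Hy => W12 y (proj1 Hy))) (wronskian_kummer12_lim a c Hc Hac0)).
  specialize (W1 x Hx). specialize (W2 x Hx). specialize (W12 x Hx).
  (* An algebraic identity between three vectors and their two-by-two minors. *)
  assert (E : (kint a (c - a - 1) x * k12 = kummer1 a c x * k2 - kummer2 a c x * k1)%C).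
  { rewrite <- W1, <- W2, <- W12. unfold wronskian. ring. }
  rewrite E1, E2, E12 in E.
  rewrite betaint_eq, !gammaint_eq in E by (try apply Hc; lra).
  replace (a + (2 - c))%C with (a - c + 1 + 1)%C in E by ring.
  unfold tricomi_nonint, CGamma.
  rewrite (rGamma_succ (1 - c)), (rGamma_succ (c - 1)), (rGamma_succ (a - c + 1)).
  replace (1 - c + 1)%C with (2 - c)%C by ring. replace (c - 1 + 1)%C with c by ring.
  pose proof (rGamma_neq_0 a Ha0). pose proof (rGamma_neq_0 c (proj1 Hc)).
  pose proof (rGamma_neq_0 (2 - c) Hc2).
  assert ((c - 1)%C <> 0%C).
  { intros H'. apply Hc0. transitivity (- (c - 1))%C; [ring|]. rewrite H'. ring. }
  fold (kummer1 a c x).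
  replace (Rcpow x (1 - c) * (/ ((c - 1) * rGamma c) * rGamma a) *
    hyp1F1 (a - c + 1) (2 - c) (RtoC x))%C with
    (kummer2 a c x * (/ ((c - 1) * rGamma c) * rGamma a))%C by (unfold kummer2; ring).
  transitivity (rGamma a * ((a - c + 1) / (1 - c)) *
    (kint a (c - a - 1) x * ((1 - c) / (a - c + 1))))%C; [|field; auto].
  rewrite E. field. repeat split; auto.
Qed.

(** After the reciprocal Gammas are shifted to common arguments, each of the two Kummer terms
    satisfies the relation separately. There is no restriction on [a]: this is the way out of the
    half plane where the integral converges. *)
Lemma tricomi_nonint_contiguous (a c : C) (x : R) :
  0 < Re c < 2 ->
  (tricomi_nonint (a - 1) c x + (c - 2 * a - RtoC x) * tricomi_nonint a c x
   + a * (a - c + 1) * tricomi_nonint (a + 1) c x = 0)%C.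
Proof.
  intros Hc. assert (Hc2 : 0 < Re (2 - c)) by (rewrite Re_Cminus, re_RtoC; lra).
  pose proof (hyp1F1_contiguous a c x (proj1 Hc)) as E1.
  pose proof (hyp1F1_contiguous (a - c + 1) (2 - c) x Hc2) as E2.
  unfold tricomi_nonint.
  replace (a - 1 - c + 1)%C with (a - c)%C by ring.
  replace (a - c + 1 - 1)%C with (a - c)%C in E2 by ring.
  replace (a + 1 - c + 1)%C with (a - c + 1 + 1)%C by ring.
  rewrite (rGamma_succ (a - c)), (rGamma_succ (a - c + 1)).
  rewrite (rGamma_succ (a - 1)). replace (a - 1 + 1)%C with a by ring.
  rewrite (rGamma_succ a).
  set (r := rGamma (a - c + 1 + 1)). set (s := rGamma (a + 1)).
  set (k1 := CGamma (1 - c)). set (k2 := CGamma (c - 1)).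
  set (M1 := hyp1F1 (a - 1) c (RtoC x)) in *. set (M := hyp1F1 a c (RtoC x)) in *.
  set (M2 := hyp1F1 (a + 1) c (RtoC x)) in *.
  set (N1 := hyp1F1 (a - c) (2 - c) (RtoC x)) in *.
  set (N := hyp1F1 (a - c + 1) (2 - c) (RtoC x)) in *.
  set (N2 := hyp1F1 (a - c + 1 + 1) (2 - c) (RtoC x)) in *.
  transitivity (- (k1 * (a - c + 1) * r) * ((c - a) * M1 + (2 * a - c + RtoC x) * M - a * M2)
    - (k2 * Rcpow x (1 - c) * a * s) * ((2 - c - (a - c + 1)) * N1
        + (2 * (a - c + 1) - (2 - c) + RtoC x) * N - (a - c + 1) * N2))%C; [ring|].
  rewrite E1, E2. ring.
Qed.

(** Written with [a - 1], since for [a = 1/2 - mu] this is [mu + 1], the shift in which the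
    derivative of [hfun] is expressed. *)
Lemma cderive_tricomi_nonint (a c : C) (x : R) :
  0 < Re c < 2 -> 0 < x ->
  cderive (tricomi_nonint a c) x
    (((a - c + RtoC x) * tricomi_nonint a c x - tricomi_nonint (a - 1) c x) / RtoC x).
Proof.
  intros Hc Hx. assert (Hc2 : 0 < Re (2 - c)) by (rewrite Re_Cminus, re_RtoC; lra).
  assert (Hx0 : RtoC x <> 0%C) by (apply RtoC_neq_0; lra).
  unfold tricomi_nonint at 1. eapply cderive_eq.
  - apply cderive_plus.
    + apply cderive_scal, cderive_hyp1F1; [apply Hc|exact Hx].
    + apply cderive_mult; [|now apply cderive_hyp1F1].
      apply cderive_mult; [now apply cderive_Rcpow|apply cderive_const].
  - cbv beta.
    pose proof (hyp1F1_contiguous a c x (proj1 Hc)) as E1.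
    pose proof (hyp1F1_contiguous (a - c + 1) (2 - c) x Hc2) as E2.
    unfold tricomi_nonint.
    replace (a - 1 - c + 1)%C with (a - c)%C by ring.
    replace (a - c + 1 - 1)%C with (a - c)%C in E2 by ring.
    rewrite (rGamma_succ (a - c)).
    rewrite (rGamma_succ (a - 1)). replace (a - 1 + 1)%C with a by ring.
    set (r := rGamma (a - c + 1)). set (s := rGamma a).
    set (k1 := CGamma (1 - c)). set (k2 := CGamma (c - 1)).
    set (M1 := hyp1F1 (a - 1) c (RtoC x)) in *. set (M := hyp1F1 a c (RtoC x)) in *.
    set (M2 := hyp1F1 (a + 1) c (RtoC x)) in *.
    set (N1 := hyp1F1 (a - c) (2 - c) (RtoC x)) in *.
    set (N := hyp1F1 (a - c + 1) (2 - c) (RtoC x)) in *.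
    set (N2 := hyp1F1 (a - c + 1 + 1) (2 - c) (RtoC x)) in *.
    assert (E1' : (a * M2 = (c - a) * M1 + (2 * a - c + RtoC x) * M)%C).
    { apply Ceq_minus. rewrite <- Copp_0, <- E1. ring. }
    assert (E2' : ((a - c + 1) * N2 =
      (2 - c - (a - c + 1)) * N1 + (2 * (a - c + 1) - (2 - c) + RtoC x) * N)%C).
    { apply Ceq_minus. rewrite <- Copp_0, <- E2. ring. }
    transitivity ((k1 * r * (a * M2 - a * M) + Rcpow x (1 - c) * (k2 * s) *
      ((1 - c) * N + ((a - c + 1) * N2 - (a - c + 1) * N))) / RtoC x)%C; [field; exact Hx0|].
    rewrite E1', E2'. field. exact Hx0.
Qed.

(** * The parabolic cylinder side *)

(** [hfun mu u = 2^(-mu) e^(-u/2) D_(2 mu) (sqrt (2 u))], see [parabolicD_hfun]. *)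
Definition hfun (mu u : R) : C :=
  (RtoC (Rpower u (/ 2) * exp (- u)) * tricomi_nonint (RtoC (/ 2 - mu)) (RtoC (3 / 2)) u)%C.

Lemma cderive_hfun (mu u : R) :
  0 < u ->
  cderive (hfun mu) u (- (hfun (mu + 1) u + RtoC (mu + / 2) * hfun mu u) / RtoC u).
Proof.
  intros Hu. assert (Hc : 0 < Re (RtoC (3 / 2)) < 2) by (rewrite re_RtoC; lra).
  assert (Hu0 : RtoC u <> 0%C) by (apply RtoC_neq_0; lra).
  unfold hfun at 1. eapply cderive_eq.
  - apply cderive_mult; [|now apply cderive_tricomi_nonint].
    apply cderive_RtoC.
    instantiate (1 := (/ 2 / u - 1) * (Rpower u (/ 2) * exp (- u))).
    unfold Rpower. auto_derive; [lra|]. field. lra.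
  - cbv beta. unfold hfun.
    replace (/ 2 - (mu + 1)) with (/ 2 - mu - 1) by ring.
    rewrite (RtoC_minus (/ 2 - mu) 1).
    set (U := tricomi_nonint (RtoC (/ 2 - mu)) (RtoC (3 / 2)) u).
    set (U1 := tricomi_nonint (RtoC (/ 2 - mu) - RtoC 1) (RtoC (3 / 2)) u).
    set (r := Rpower u (/ 2) * exp (- u)).
    replace (RtoC ((/ 2 / u - 1) * r)) with ((RtoC (/ 2) / RtoC u - 1) * RtoC r)%C
      by (rewrite RtoC_mult, RtoC_minus, RtoC_div by lra; reflexivity).
    replace (RtoC (/ 2 - mu) - RtoC (3 / 2) + RtoC u)%C with (RtoC (- (mu + / 2) - / 2 + u)).
    + rewrite RtoC_plus, RtoC_minus, RtoC_opp. field. exact Hu0.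
    + rewrite <- RtoC_minus, <- RtoC_plus. f_equal. field.
Qed.

Lemma hfun_recurrence (mu u : R) :
  hfun (mu + 2) u =
  (RtoC (u - 2 * mu - 5 / 2) * hfun (mu + 1) u - RtoC ((mu + / 2) * (mu + 1)) * hfun mu u)%C.
Proof.
  assert (Hc : 0 < Re (RtoC (3 / 2)) < 2) by (rewrite re_RtoC; lra).
  pose proof (tricomi_nonint_contiguous (RtoC (- / 2 - mu)) (RtoC (3 / 2)) u Hc) as E.
  unfold hfun.
  replace (RtoC (/ 2 - (mu + 2))) with (RtoC (- / 2 - mu) - 1)%C
    by (rewrite <- RtoC_minus; f_equal; field).
  replace (RtoC (/ 2 - mu)) with (RtoC (- / 2 - mu) + 1)%C
    by (rewrite <- RtoC_plus; f_equal; field).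
  replace (/ 2 - (mu + 1)) with (- / 2 - mu) by field.
  set (U1 := tricomi_nonint (RtoC (- / 2 - mu) - 1) (RtoC (3 / 2)) u) in *.
  set (U := tricomi_nonint (RtoC (- / 2 - mu)) (RtoC (3 / 2)) u) in *.
  set (U2 := tricomi_nonint (RtoC (- / 2 - mu) + 1) (RtoC (3 / 2)) u) in *.
  set (r := Rpower u (/ 2) * exp (- u)).
  assert (E1 : U1 = (RtoC (u - 2 * mu - 5 / 2) * U - RtoC ((mu + / 2) * (mu + 1)) * U2)%C).
  { apply Ceq_minus. rewrite <- E.
    replace (RtoC (u - 2 * mu - 5 / 2)) with (- (RtoC (3 / 2) - 2 * RtoC (- / 2 - mu) - RtoC u))%C
      by (rewrite <- RtoC_mult, <- !RtoC_minus, <- RtoC_opp; f_equal; field).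
    replace (RtoC ((mu + / 2) * (mu + 1))) with
      (RtoC (- / 2 - mu) * (RtoC (- / 2 - mu) - RtoC (3 / 2) + 1))%C
      by (rewrite <- !RtoC_minus, <- RtoC_plus, <- RtoC_mult; f_equal; field).
    ring. }
  rewrite E1. ring.
Qed.

(** [hfun] decays like a power of [u] times [e^(-u)]; a quarter of the exponent is given up to
    absorb powers. Bounds are asked for away from 0 because the arguments [x cosh^2 (y/2)] stay
    above [x]. *)
Definition tame (f : R -> C) : Prop :=
  (forall u, 0 < u -> ccontinuous f u) /\
  forall u0, 0 < u0 -> exists K, forall u, u0 <= u -> Cmod (f u) <= K * exp (- (3 / 4 * u)).

Lemma tame_plus (f g : R -> C) : tame f -> tame g -> tame (fun u => f u + g u)%C.
Proof.
  intros [Hf1 Hf2] [Hg1 Hg2]. split.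
  - intros u Hu. apply ccontinuous_plus; auto.
  - intros u0 Hu0. destruct (Hf2 u0 Hu0) as (K & HK). destruct (Hg2 u0 Hu0) as (L & HL).
    exists (K + L). intros u Hu. eapply Rle_trans; [apply Cmod_triangle|].
    specialize (HK u Hu). specialize (HL u Hu). lra.
Qed.

Lemma tame_scal (k : C) (f : R -> C) : tame f -> tame (fun u => k * f u)%C.
Proof.
  intros [Hf1 Hf2]. split.
  - intros u Hu. apply ccontinuous_scal; auto.
  - intros u0 Hu0. destruct (Hf2 u0 Hu0) as (K & HK). exists (Cmod k * K). intros u Hu.
    rewrite Cmod_mult, Rmult_assoc. apply Rmult_le_compat_l; [apply Cmod_ge_0|auto].
Qed.

Lemma tame_ext (f g : R -> C) : (forall u, 0 < u -> f u = g u) -> tame f -> tame g.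
Proof.
  intros E [Hf1 Hf2]. split.
  - intros u Hu. destruct (Hf1 u Hu) as [H1 H2].
    assert (Hloc : locally u (fun t => f t = g t)).
    { exists (mkposreal u Hu). intros t Ht. apply E.
      unfold ball in Ht; simpl in Ht; unfold AbsRing_ball, abs, minus, plus, opp in Ht; simpl in Ht.
      apply Rabs_def2 in Ht. lra. }
    split; [apply (continuous_ext_loc _ (fun t => Re (f t)))
           |apply (continuous_ext_loc _ (fun t => Im (f t)))]; try assumption;
      (eapply filter_imp; [|exact Hloc]); intros t Ht; cbv beta in *; now rewrite Ht.
  - intros u0 Hu0. destruct (Hf2 u0 Hu0) as (K & HK). exists K. intros u Hu.
    rewrite <- E by lra. auto.
Qed.

Lemma pow_exp_bound (n : nat) : exists K, forall u, 0 <= u -> (1 + u) ^ n <= K * exp (u / 4).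
Proof.
  destruct n as [|n].
  - exists 1. intros u Hu. simpl. rewrite Rmult_1_l, <- exp_0. apply exp_le. lra.
  (* Chosen so that [exp (u / m)], raised to the power [S n], is [exp (u / 4)]. *)
  - set (m := 4 * INR (S n)).
    assert (Hm : 4 <= m) by (unfold m; rewrite S_INR; pose proof (pos_INR n); lra).
    exists (m ^ S n). intros u Hu.
    replace (exp (u / 4)) with (exp (u / m) ^ S n).
    + rewrite <- Rpow_mult_distr. apply pow_incr. split; [lra|].
      pose proof (exp_ineq1_le (u / m)).
      apply Rle_trans with (m * (1 + u / m)); [|apply Rmult_le_compat_l; lra].
      replace (m * (1 + u / m)) with (m + u) by (field; lra). lra.
    + rewrite <- (Rpower_pow (S n) (exp (u / m))) by apply exp_pos.
      unfold Rpower. rewrite ln_exp. f_equal. unfold m. field.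
      rewrite S_INR. pose proof (pos_INR n). lra.
Qed.

(** For [a = 1/2 - mu] the condition [mu <= -3/2] is [Re a >= 2], and at [c = 3/2] the exponent
    [c - a - 1] is [mu] itself. *)
Lemma hfun_kint (mu u : R) :
  mu <= - 3 / 2 -> 0 < u ->
  hfun mu u = (RtoC (Rpower u (/ 2) * exp (- u)) *
    (rGamma (RtoC (/ 2 - mu)) * kint (RtoC (/ 2 - mu)) (RtoC mu) u))%C.
Proof.
  intros Hmu Hu. unfold hfun. rewrite tricomi_nonint_kint.
  - replace (RtoC (3 / 2) - RtoC (/ 2 - mu) - 1)%C with (RtoC mu); [reflexivity|].
    rewrite <- !RtoC_minus. f_equal. field.
  - rewrite re_RtoC. lra.
  - rewrite re_RtoC. lra.
  - intros E. apply RtoC_inj in E. lra.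
  - exact Hu.
Qed.

Lemma kint_bounded (p q : C) (u0 : R) :
  0 < Re p -> 0 < u0 -> exists K, forall u, u0 <= u -> Cmod (kint p q u) <= K.
Proof.
  intros Hp Hu0. eexists. intros u Hu. apply cint_bound.
  apply (kernel_cdom_pos p q u u0 (Re p) (Re p) (Rabs (Re q))); lra.
Qed.

(** Induction on the number of unit steps down to [mu <= -3/2], where the integral gives the bound;
    each use of the recurrence costs one power of [1 + u]. *)
Lemma hfun_poly_bound (n : nat) (mu u0 : R) :
  mu - INR n <= - 3 / 2 -> 0 < u0 ->
  exists K m, 0 <= K /\ forall u, u0 <= u -> Cmod (hfun mu u) <= K * (1 + u) ^ m * exp (- u).
Proof.
  revert mu. induction n as [n IH] using (well_founded_induction lt_wf). intros mu Hmu Hu0.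
  destruct (Rle_dec mu (- 3 / 2)) as [Hb|Hb].
  - assert (Hp : 0 < Re (RtoC (/ 2 - mu))) by (rewrite re_RtoC; lra).
    destruct (kint_bounded (RtoC (/ 2 - mu)) (RtoC mu) u0 Hp Hu0) as (K & HK).
    set (r := Cmod (rGamma (RtoC (/ 2 - mu)))). assert (Hr : 0 <= r) by apply Cmod_ge_0.
    exists (r * Rabs K), 1%nat. split; [apply Rmult_le_pos; [exact Hr|apply Rabs_pos]|].
    intros u Hu. rewrite hfun_kint, !Cmod_mult, Cmod_R by lra. fold r.
    rewrite Rabs_pos_eq by (apply Rmult_le_pos; left; apply exp_pos).
    specialize (HK u Hu). pose proof (Rle_abs K).
    assert (Hs : Rpower u (/ 2) <= 1 + u).
    { unfold Rpower. apply Rle_trans with (exp (ln (1 + u))).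
      - apply exp_le. assert (ln u <= ln (1 + u)) by (apply ln_le; lra).
        assert (0 <= ln (1 + u)) by (apply ln_1p_exp_ge_0; lra). lra.
      - rewrite exp_ln; lra. }
    pose proof (exp_pos (- u)). rewrite pow_1.
    replace (r * Rabs K * (1 + u) * exp (- u)) with ((1 + u) * exp (- u) * (r * Rabs K)) by ring.
    apply Rmult_le_compat.
    + apply Rmult_le_pos; left; apply exp_pos.
    + apply Rmult_le_pos; [exact Hr|apply Cmod_ge_0].
    + apply Rmult_le_compat_r; lra.
    + apply Rmult_le_compat_l; lra.
  - destruct n as [|n].
    { simpl in Hmu. lra. }
    rewrite S_INR in Hmu.
    (* [n] only bounds the number of steps, so the same value serves [mu - 1] and [mu - 2]. *)
    destruct (IH n ltac:(lia) (mu - 1) ltac:(lra) Hu0) as (K1 & m1 & HK1 & H1).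
    destruct (IH n ltac:(lia) (mu - 2) ltac:(lra) Hu0) as (K2 & m2 & HK2 & H2).
    set (A := Rabs (- 2 * (mu - 2) - 5 / 2) + 1).
    set (B := Rabs ((mu - 2 + / 2) * (mu - 1))).
    exists (A * K1 + B * K2), (S (m1 + m2)).
    assert (HA : 1 <= A) by (unfold A; pose proof (Rabs_pos (- 2 * (mu - 2) - 5 / 2)); lra).
    assert (HB : 0 <= B) by apply Rabs_pos.
    split; [nra|].
    intros u Hu. replace (hfun mu u) with (hfun (mu - 2 + 2) u) by (f_equal; ring).
    rewrite hfun_recurrence. replace (mu - 2 + 1) with (mu - 1) by ring.
    eapply Rle_trans; [apply Cmod_minus_le|]. rewrite !Cmod_mult, !Cmod_R.
    specialize (H1 u Hu). specialize (H2 u Hu).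
    fold B.
    assert (HAu : Rabs (u - 2 * (mu - 2) - 5 / 2) <= A * (1 + u)).
    { replace (u - 2 * (mu - 2) - 5 / 2) with (u + (- 2 * (mu - 2) - 5 / 2)) by ring.
      eapply Rle_trans; [apply Rabs_triang|]. rewrite (Rabs_pos_eq u) by lra. unfold A.
      pose proof (Rabs_pos (- 2 * (mu - 2) - 5 / 2)). nra. }
    assert (Hp1 : (1 + u) ^ m1 * (1 + u) <= (1 + u) ^ S (m1 + m2)).
    { rewrite Rmult_comm. change ((1 + u) * (1 + u) ^ m1) with ((1 + u) ^ S m1).
      apply Rle_pow; [lra|lia]. }
    assert (Hp2 : (1 + u) ^ m2 <= (1 + u) ^ S (m1 + m2)) by (apply Rle_pow; [lra|lia]).
    pose proof (exp_pos (- u)) as He.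
    pose proof (pow_le (1 + u) m1 ltac:(lra)). pose proof (pow_le (1 + u) m2 ltac:(lra)).
    apply Rle_trans with (A * (1 + u) * (K1 * (1 + u) ^ m1 * exp (- u)) +
      B * (K2 * (1 + u) ^ m2 * exp (- u))).
    + apply Rplus_le_compat; apply Rmult_le_compat; try assumption; try apply Rabs_pos;
        try apply Cmod_ge_0; lra.
    + replace ((A * K1 + B * K2) * (1 + u) ^ S (m1 + m2) * exp (- u)) with
        (A * K1 * exp (- u) * (1 + u) ^ S (m1 + m2) + B * K2 * exp (- u) * (1 + u) ^ S (m1 + m2))
        by ring.
      apply Rplus_le_compat.
      * replace (A * (1 + u) * (K1 * (1 + u) ^ m1 * exp (- u))) with
          (A * K1 * exp (- u) * ((1 + u) ^ m1 * (1 + u))) by ring.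
        apply Rmult_le_compat_l; [|exact Hp1].
        apply Rmult_le_pos; [|lra]. apply Rmult_le_pos; lra.
      * replace (B * (K2 * (1 + u) ^ m2 * exp (- u))) with
          (B * K2 * exp (- u) * (1 + u) ^ m2) by ring.
        apply Rmult_le_compat_l; [|exact Hp2].
        apply Rmult_le_pos; [|lra]. apply Rmult_le_pos; lra.
Qed.

Lemma tame_hfun (mu : R) : tame (hfun mu).
Proof.
  split.
  - intros u Hu. eapply cderive_continuous, cderive_hfun, Hu.
  - intros u0 Hu0.
    destruct (nfloor_ex (Rabs mu + 2)) as (n & Hn); [pose proof (Rabs_pos mu); lra|].
    destruct (hfun_poly_bound (S n) mu u0) as (K & m & HK & H); [|exact Hu0|].
    { rewrite S_INR. pose proof (Rle_abs mu). lra. }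
    destruct (pow_exp_bound m) as (L & HL).
    exists (K * L). intros u Hu. eapply Rle_trans; [apply H, Hu|].
    specialize (HL u ltac:(lra)).
    replace (- (3 / 4 * u)) with (u / 4 + - u) by field. rewrite exp_plus.
    replace (K * L * (exp (u / 4) * exp (- u))) with (K * (L * exp (u / 4)) * exp (- u)) by ring.
    apply Rmult_le_compat_r; [left; apply exp_pos|]. apply Rmult_le_compat_l; assumption.
Qed.

(** * The Fourier integral over [y]: decay, derivative in [x], recurrence in [mu] *)

Lemma is_derive_cosh_half (y : R) : is_derive (fun y => cosh (y / 2)) y (sinh (y / 2) / 2).
Proof. unfold cosh, sinh. auto_derive; [exact I|]. unfold Rdiv. field. Qed.

Lemma is_derive_sinh_half (y : R) : is_derive (fun y => sinh (y / 2)) y (cosh (y / 2) / 2).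
Proof. unfold cosh, sinh. auto_derive; [exact I|]. unfold Rdiv. field. Qed.

Lemma cosh2_sinh2 (t : R) : cosh t ^ 2 = 1 + sinh t ^ 2.
Proof.
  unfold cosh, sinh. assert (E : exp t * exp (- t) = 1).
  { rewrite <- exp_plus, Rplus_opp_r. apply exp_0. }
  transitivity (exp t * exp (- t) + ((exp t - exp (- t)) / 2) ^ 2); [field|].
  now rewrite E.
Qed.

Lemma cosh_ge_1 (t : R) : 1 <= cosh t.
Proof.
  unfold cosh. pose proof (exp_ineq1_le t). pose proof (exp_ineq1_le (- t)). lra.
Qed.

Lemma sinh_ge (t : R) : 0 <= t -> t <= sinh t.
Proof.
  intros Ht. destruct (MVT_gen sinh 0 t cosh) as (c & Hc & E).
  - intros x _. unfold sinh, cosh. auto_derive; [exact I|]. field.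
  - intros x _. apply continuity_pt_filterlim, (is_derive_continuous sinh x (cosh x)).
    unfold sinh, cosh. auto_derive; [exact I|]. field.
  - rewrite sinh_0 in E. pose proof (cosh_ge_1 c). nra.
Qed.

Lemma sinh_opp (t : R) : sinh (- t) = - sinh t.
Proof. unfold sinh. rewrite Ropp_involutive. field. Qed.

Lemma sinh2_ge (t : R) : t ^ 2 <= sinh t ^ 2.
Proof.
  destruct (Rle_dec 0 t) as [Ht|Ht].
  - apply pow_incr. split; [exact Ht|now apply sinh_ge].
  - replace (t ^ 2) with ((- t) ^ 2) by ring.
    replace (sinh t ^ 2) with (sinh (- t) ^ 2) by (rewrite sinh_opp; ring).
    apply pow_incr. split; [lra|apply sinh_ge; lra].
Qed.

Lemma cosh2_ge (y : R) : 1 + y ^ 2 / 4 <= cosh (y / 2) ^ 2.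
Proof. rewrite cosh2_sinh2. pose proof (sinh2_ge (y / 2)). nra. Qed.

(** The profile is even in [y], so the cosine carries the whole Fourier transform. [f] is left
    general because the same integral is needed for derivatives of [hfun] and for its shifts in
    [mu]. *)
Definition jkernel (f : R -> C) (tau x y : R) : C :=
  (f (x * cosh (y / 2) ^ 2)%R * RtoC (cos (tau * y)))%C.

Definition jint (f : R -> C) (tau x : R) : C := cint (jkernel f tau x).

Lemma is_derive_xcosh2 (x y : R) :
  is_derive (fun y => x * cosh (y / 2) ^ 2) y (x * (cosh (y / 2) * sinh (y / 2))).
Proof.
  eapply is_derive_eq.
  - apply (is_derive_Rmult (fun _ => x) (fun y => cosh (y / 2) ^ 2)).
    + exact (is_derive_const (K := R_AbsRing) (V := R_NormedModule) x y).
    + apply (is_derive_ext (fun y => cosh (y / 2) * cosh (y / 2))); [intros t; simpl; ring|].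
      apply is_derive_Rmult; apply is_derive_cosh_half.
  - unfold zero; simpl. field.
Qed.

Lemma is_derive_cos_scal (tau y : R) :
  is_derive (fun y => cos (tau * y)) y (- tau * sin (tau * y)).
Proof. auto_derive; [exact I|]. ring. Qed.

Lemma is_derive_sin_scal (tau y : R) :
  is_derive (fun y => sin (tau * y)) y (tau * cos (tau * y)).
Proof. auto_derive; [exact I|]. ring. Qed.

Lemma Rabs_cos_le (t : R) : Rabs (cos t) <= 1.
Proof. apply Rabs_le. apply COS_bound. Qed.

Lemma Rabs_sin_le (t : R) : Rabs (sin t) <= 1.
Proof. apply Rabs_le. apply SIN_bound. Qed.

(** [cosh^2 (y/2) >= 1 + y^2/4] gives Gaussian decay in [y], weakened to [e^(-|y|)]. The factor
    [e^(-k x)] is kept: it becomes the decay of [jint] in [x]. *)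
Lemma exp_cosh_decay (k x y : R) :
  0 < k -> 0 < x ->
  exp (- (k * (x * cosh (y / 2) ^ 2))) <= exp (/ (k * x)) * exp (- (k * x)) * exp (- (1) * Rabs y).
Proof.
  intros Hk Hx. rewrite <- !exp_plus. apply exp_le.
  pose proof (cosh2_ge y) as H. rewrite <- (pow2_abs y) in H.
  pose proof (quad_bound 1 (k * x) (Rabs y) ltac:(apply Rmult_lt_0_compat; assumption)) as Hq.
  replace (1 ^ 2 / (k * x)) with (/ (k * x)) in Hq by (field; lra).
  assert (Hkx : 0 < k * x) by (apply Rmult_lt_0_compat; assumption).
  assert (k * x * (1 + Rabs y ^ 2 / 4) <= k * x * cosh (y / 2) ^ 2)
    by (apply Rmult_le_compat_l; lra).
  lra.
Qed.

Lemma jkernel_continuous (f : R -> C) (tau x y : R) :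
  tame f -> 0 < x -> ccontinuous (jkernel f tau x) y.
Proof.
  intros [Hf _] Hx. apply ccontinuous_mult.
  - apply (ccontinuous_comp f (fun y => x * cosh (y / 2) ^ 2)).
    + apply Hf. pose proof (cosh2_ge y). pose proof (pow2_ge_0 y). nra.
    + eapply is_derive_continuous, is_derive_xcosh2.
  - apply ccontinuous_RtoC. eapply is_derive_continuous, is_derive_cos_scal.
Qed.

Lemma xcosh2_ge (x y : R) : 0 < x -> x <= x * cosh (y / 2) ^ 2.
Proof.
  intros Hx. pose proof (cosh2_ge y). pose proof (pow2_ge_0 y).
  rewrite <- (Rmult_1_r x) at 1. apply Rmult_le_compat_l; lra.
Qed.

Lemma jkernel_cdom (f : R -> C) (tau x0 : R) :
  tame f -> 0 < x0 ->
  exists K, forall x, x0 <= x -> cdom (K * exp (- (3 / 4 * x))) 1 (jkernel f tau x).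
Proof.
  intros Hf Hx0. destruct (proj2 Hf x0 Hx0) as (K & HK).
  exists (K * exp (/ (3 / 4 * x0))). intros x Hx.
  assert (HK0 : 0 <= K).
  { specialize (HK x0 (Rle_refl _)). pose proof (Cmod_ge_0 (f x0)).
    pose proof (exp_pos (- (3 / 4 * x0))). nra. }
  split; [|split; [lra|]].
  - intros y. apply jkernel_continuous; [exact Hf|lra].
  - intros y. unfold jkernel. rewrite Cmod_mult, Cmod_R.
    pose proof (xcosh2_ge x y ltac:(lra)) as Hw.
    specialize (HK (x * cosh (y / 2) ^ 2) ltac:(lra)).
    pose proof (Rabs_cos_le (tau * y)). pose proof (Rabs_pos (cos (tau * y))).
    pose proof (exp_cosh_decay (3 / 4) x y ltac:(lra) ltac:(lra)) as Hd.
    apply Rle_trans with (K * exp (- (3 / 4 * (x * cosh (y / 2) ^ 2))) * 1).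
    + apply Rmult_le_compat; auto using Cmod_ge_0.
    + rewrite Rmult_1_r, !Rmult_assoc. apply Rmult_le_compat_l; [exact HK0|].
      eapply Rle_trans; [exact Hd|]. rewrite Rmult_assoc. apply Rmult_le_compat_r.
      * apply Rmult_le_pos; left; apply exp_pos.
      * apply exp_le. apply Rinv_le_contravar; lra.
Qed.

Lemma jkernel_cnice (f : R -> C) (tau x : R) : tame f -> 0 < x -> cnice (jkernel f tau x).
Proof.
  intros Hf Hx. destruct (jkernel_cdom f tau x Hf Hx) as (K & HK).
  do 2 eexists. apply (HK x (Rle_refl _)).
Qed.

Lemma jint_plus (f g : R -> C) (tau x : R) :
  tame f -> tame g -> 0 < x ->
  jint (fun u => f u + g u)%C tau x = (jint f tau x + jint g tau x)%C.
Proof.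
  intros Hf Hg Hx. unfold jint. rewrite <- cint_plus by now apply jkernel_cnice.
  apply cint_ext. intros y. unfold jkernel. ring.
Qed.

Lemma jint_scal (k : C) (f : R -> C) (tau x : R) :
  tame f -> 0 < x -> jint (fun u => k * f u)%C tau x = (k * jint f tau x)%C.
Proof.
  intros Hf Hx. unfold jint. rewrite <- cint_scal by now apply jkernel_cnice.
  apply cint_ext. intros y. unfold jkernel. ring.
Qed.

Lemma ctaylor_1 (f f1 f2 : R -> C) (B u h : R) :
  (forall t, Rabs (t - u) <= Rabs h ->
     cderive f t (f1 t) /\ cderive f1 t (f2 t) /\ Cmod (f2 t) <= B) ->
  Cmod (f (u + h)%R - f u - RtoC h * f1 u) <= 4 * B * h ^ 2.
Proof.
  intros H.
  assert (Hu : Rabs (u + h - u) = Rabs h) by (f_equal; ring).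
  pose proof (cmean_value (fun t => f t - RtoC (t - u) * f1 u)%C (fun t => f1 t - f1 u)%C
    (2 * B * Rabs h) u (u + h)) as Hm. cbv beta in Hm.
  replace (u + h - u) with h in Hm by ring. rewrite Rminus_diag in Hm.
  replace (f (u + h)%R - f u - RtoC h * f1 u)%C with
    (f (u + h)%R - RtoC h * f1 u - (f u - RtoC 0 * f1 u))%C by ring.
  replace (4 * B * h ^ 2) with (2 * (2 * B * Rabs h) * Rabs h)
    by (rewrite <- (pow2_abs h); ring).
  apply Hm. intros t Ht. split.
  - eapply cderive_eq.
    + apply (cderive_minus f (fun t => RtoC (t - u) * f1 u)%C); [exact (proj1 (H t Ht))|].
      apply (cderive_mult (fun t => RtoC (t - u)) (fun _ => f1 u)); [|apply cderive_const].
      apply cderive_RtoC. instantiate (1 := 1). auto_derive; [exact I|ring].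
    + cbv beta. ring.
  - eapply Rle_trans.
    + apply (cmean_value f1 f2 B u t). intros s Hs.
      destruct (H s ltac:(lra)) as (_ & H1 & H2). now split.
    + assert (0 <= B).
      { destruct (H u) as (_ & _ & H2); [rewrite Rminus_diag, Rabs_R0; apply Rabs_pos|].
        pose proof (Cmod_ge_0 (f2 u)). lra. }
      apply Rmult_le_compat_l; lra.
Qed.

(** On [f (x cosh^2 (y/2))] the operators [x d/dx] and [u d/du] agree, so the derivative is an
    integral of the same kind with [u f1(u)] in place of [f]. *)
Lemma cderive_jint (f f1 f2 : R -> C) (tau x : R) :
  (forall u, 0 < u -> cderive f u (f1 u)) -> (forall u, 0 < u -> cderive f1 u (f2 u)) ->
  tame f -> tame (fun u => RtoC u * f1 u)%C -> tame (fun u => RtoC (u ^ 2) * f2 u)%C ->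
  0 < x ->
  cderive (jint f tau) x (jint (fun u => RtoC u * f1 u)%C tau x / RtoC x).
Proof.
  intros H1 H2 T0 T1 T2 Hx. assert (Hx2 : 0 < x / 2) by lra.
  assert (Hx0 : RtoC x <> 0%C) by (apply RtoC_neq_0; lra).
  destruct (proj2 T2 (x / 2) Hx2) as (K & HK).
  assert (HK0 : 0 <= K).
  { specialize (HK (x / 2) (Rle_refl _)).
    pose proof (Cmod_ge_0 (RtoC ((x / 2) ^ 2) * f2 (x / 2))).
    pose proof (exp_pos (- (3 / 4 * (x / 2)))). nra. }
  (* For [|h| <= x/2] the intermediate points stay above half of [x cosh^2 (y/2)]. This halves the
     rate [3/4] to [3/8] and gives a factor 4 from [1/t^2]; the other 4 comes from [ctaylor_1]. *)
  set (L := 16 * K / x ^ 2 * exp (/ (3 / 8 * x))).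
  apply (cderive_quadratic _ _ _ (4 * L) (x / 2) Hx2). intros h Hh.
  assert (Hh' : - (x / 2) <= h <= x / 2) by (apply Rabs_le_between; exact Hh).
  unfold jint.
  replace (_ - RtoC h * _)%C with
    (cint (fun y => jkernel f tau (x + h) y - jkernel f tau x y
      - RtoC h / RtoC x * jkernel (fun u => RtoC u * f1 u)%C tau x y)%C).
  2: { assert (N1 : cnice (jkernel f tau (x + h))) by (apply jkernel_cnice; [exact T0|lra]).
       assert (N2 : cnice (jkernel f tau x)) by now apply jkernel_cnice.
       assert (N3 : cnice (jkernel (fun u => RtoC u * f1 u)%C tau x)) by now apply jkernel_cnice.
       rewrite !cint_minus, cint_scal; auto using cnice_minus, cnice_scal.
       field. exact Hx0. }
  replace (4 * L * h ^ 2) with (4 * (L * h ^ 2) / 1) by field.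
  apply cint_bound. split; [|split; [lra|]].
  - intros y. apply ccontinuous_minus; [apply ccontinuous_minus|apply ccontinuous_scal];
      apply jkernel_continuous; auto; lra.
  - intros y. set (c := cosh (y / 2) ^ 2).
    assert (Hc : 1 <= c).
    { unfold c. pose proof (cosh2_ge y). pose proof (pow2_ge_0 y). lra. }
    unfold jkernel. fold c.
    assert (E : (f ((x + h) * c)%R * RtoC (cos (tau * y)) - f (x * c)%R * RtoC (cos (tau * y)) -
      RtoC h / RtoC x * (RtoC (x * c) * f1 (x * c)%R * RtoC (cos (tau * y))) =
      (f (x * c + h * c)%R - f (x * c)%R - RtoC (h * c) * f1 (x * c)%R) * RtoC (cos (tau * y)))%C).
    { replace ((x + h) * c) with (x * c + h * c) by ring.
      rewrite !RtoC_mult. field. exact Hx0. }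
    rewrite E, Cmod_mult, Cmod_R. clear E.
    assert (Hxc : 0 < x * c) by nra.
    pose proof (ctaylor_1 f f1 f2 (K * exp (- (3 / 8 * (x * c))) * (4 / (x * c) ^ 2)) (x * c) (h * c)) as T.
    pose proof (Rabs_cos_le (tau * y)). pose proof (Rabs_pos (cos (tau * y))).
    apply Rle_trans with (4 * (K * exp (- (3 / 8 * (x * c))) * (4 / (x * c) ^ 2)) * (h * c) ^ 2 * 1).
    + apply Rmult_le_compat; auto using Cmod_ge_0. apply T. clear T.
      intros t Ht. rewrite Rabs_mult, (Rabs_pos_eq c) in Ht by lra.
      assert (Htl : x * c / 2 <= t).
      { apply Rabs_le_between in Ht. assert (Rabs h * c <= x / 2 * c) by (apply Rmult_le_compat_r; lra).
        lra. }
      assert (Ht0 : 0 < t) by lra. split; [now apply H1|split; [now apply H2|]].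
      assert (Htx : x / 2 <= t) by nra.
      specialize (HK t Htx). rewrite Cmod_mult, Cmod_R, Rabs_pos_eq in HK by apply pow2_ge_0.
      assert (Ht2 : 0 < t ^ 2) by nra.
      apply Rmult_le_reg_l with (t ^ 2); [exact Ht2|]. eapply Rle_trans; [exact HK|].
      assert (He : exp (- (3 / 4 * t)) <= exp (- (3 / 8 * (x * c)))) by (apply exp_le; lra).
      replace (t ^ 2 * (K * exp (- (3 / 8 * (x * c))) * (4 / (x * c) ^ 2))) with
        (K * exp (- (3 / 8 * (x * c))) * (4 * t ^ 2 / (x * c) ^ 2)) by (field; lra).
      rewrite <- (Rmult_1_r (K * exp (- (3 / 4 * t)))).
      apply Rmult_le_compat; [|lra| |].
      * apply Rmult_le_pos; [exact HK0|left; apply exp_pos].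
      * apply Rmult_le_compat_l; assumption.
      * apply Rmult_le_reg_r with ((x * c) ^ 2); [nra|].
        replace (4 * t ^ 2 / (x * c) ^ 2 * (x * c) ^ 2) with (4 * t ^ 2) by (field; lra). nra.
    + pose proof (exp_cosh_decay (3 / 8) x y ltac:(lra) Hx) as Hd. fold c in Hd.
      replace (4 * (K * exp (- (3 / 8 * (x * c))) * (4 / (x * c) ^ 2)) * (h * c) ^ 2 * 1) with
        (16 * K / x ^ 2 * h ^ 2 * exp (- (3 / 8 * (x * c)))) by (field; lra).
      unfold L.
      replace (16 * K / x ^ 2 * exp (/ (3 / 8 * x)) * h ^ 2 * exp (- (1) * Rabs y)) with
        (16 * K / x ^ 2 * h ^ 2 * (exp (/ (3 / 8 * x)) * exp (- (1) * Rabs y))) by ring.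
      apply Rmult_le_compat_l.
      * apply Rmult_le_pos; [apply Rdiv_le_0_compat; nra|apply pow2_ge_0].
      * eapply Rle_trans; [exact Hd|]. apply Rmult_le_compat_r; [left; apply exp_pos|].
        rewrite <- (Rmult_1_r (exp (/ (3 / 8 * x)))) at 2.
        apply Rmult_le_compat_l; [left; apply exp_pos|]. rewrite <- exp_0. apply exp_le. lra.
Qed.

(** [u d/du] applied to [hfun mu]; [theta2_hfun] is its second iterate. Written as combinations of
    shifts in [mu], both are visibly [tame]. *)
Definition theta_hfun (mu u : R) : C := (- (hfun (mu + 1) u + RtoC (mu + / 2) * hfun mu u))%C.

Definition theta2_hfun (mu u : R) : C :=
  (hfun (mu + 2) u + (RtoC (2 * mu + 2) * hfun (mu + 1) u + RtoC ((mu + / 2) ^ 2) * hfun mu u))%C.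

Lemma tame_theta_hfun (mu : R) : tame (theta_hfun mu).
Proof.
  apply (tame_ext (fun u => - (1) * (hfun (mu + 1) u + RtoC (mu + / 2) * hfun mu u))%C).
  - intros u _. unfold theta_hfun. ring.
  - apply tame_scal, tame_plus; [|apply tame_scal]; apply tame_hfun.
Qed.

Lemma tame_theta2_hfun (mu : R) : tame (theta2_hfun mu).
Proof.
  apply tame_plus; [|apply tame_plus; apply tame_scal]; apply tame_hfun.
Qed.

Lemma cderive_hfun_theta (mu u : R) :
  0 < u -> cderive (hfun mu) u (theta_hfun mu u / RtoC u).
Proof. apply cderive_hfun. Qed.

Lemma cderive_theta_hfun (mu u : R) :
  0 < u -> cderive (theta_hfun mu) u (theta2_hfun mu u / RtoC u).
Proof.
  intros Hu. assert (Hu0 : RtoC u <> 0%C) by (apply RtoC_neq_0; lra).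
  unfold theta_hfun. eapply cderive_eq.
  - apply cderive_opp, cderive_plus; [|apply cderive_scal]; now apply cderive_hfun.
  - unfold theta2_hfun. replace (mu + 1 + 1) with (mu + 2) by ring.
    replace (RtoC ((mu + / 2) ^ 2)) with (RtoC (mu + / 2) * RtoC (mu + / 2))%C
      by (rewrite <- RtoC_mult; f_equal; ring).
    replace (RtoC (2 * mu + 2)) with (RtoC (mu + 1 + / 2) + RtoC (mu + / 2))%C
      by (rewrite <- RtoC_plus; f_equal; field).
    field. exact Hu0.
Qed.

(** In the integration by parts this combination comes multiplied by
    [1 - tanh^2 (y/2) = 1 / cosh^2 (y/2)]; with [u = x cosh^2 (y/2)] only the constant [x] is left
    of the factor [u]. *)
Lemma theta_hfun_ode (mu u : R) :
  (theta2_hfun mu u - RtoC (/ 2) * theta_hfun mu u)%C = (RtoC u * hfun (mu + 1) u)%C.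
Proof.
  unfold theta2_hfun, theta_hfun. rewrite hfun_recurrence.
  rewrite !RtoC_plus, !RtoC_minus, !RtoC_mult, !RtoC_pow, !RtoC_plus, !RtoC_div by lra.
  rewrite !RtoC_inv by lra. field.
Qed.

Lemma cderive_hfun_quot (mu u : R) :
  0 < u ->
  cderive (fun u => theta_hfun mu u / RtoC u)%C u
    ((theta2_hfun mu u - theta_hfun mu u) / RtoC (u ^ 2)).
Proof.
  intros Hu. assert (Hu0 : RtoC u <> 0%C) by (apply RtoC_neq_0; lra).
  apply (cderive_ext_loc (fun u => theta_hfun mu u * RtoC (/ u))%C).
  - exists (mkposreal u Hu). intros t Ht.
    unfold ball in Ht; simpl in Ht; unfold AbsRing_ball, abs, minus, plus, opp in Ht; simpl in Ht.
    apply Rabs_def2 in Ht. rewrite RtoC_inv by lra. reflexivity.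
  - eapply cderive_eq.
    + apply cderive_mult; [now apply cderive_theta_hfun|].
      apply cderive_RtoC. instantiate (1 := - / u ^ 2). auto_derive; [lra|]. field. lra.
    + cbv beta. rewrite RtoC_opp, !RtoC_inv, !RtoC_pow by nra. field. exact Hu0.
Qed.

Lemma jint_ext (f g : R -> C) (tau x : R) :
  0 < x -> (forall u, 0 < u -> f u = g u) -> jint f tau x = jint g tau x.
Proof.
  intros Hx E. apply cint_ext. intros y. unfold jkernel. rewrite E; [reflexivity|].
  pose proof (xcosh2_ge x y Hx). lra.
Qed.

Lemma cderive_jint_hfun (mu tau x : R) :
  0 < x ->
  cderive (jint (hfun mu) tau) x
    (- (jint (hfun (mu + 1)) tau x + RtoC (mu + / 2) * jint (hfun mu) tau x) / RtoC x).
Proof.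
  intros Hx.
  assert (E1 : forall u, 0 < u -> theta_hfun mu u = (RtoC u * (theta_hfun mu u / RtoC u))%C).
  { intros u Hu. assert (Hu0 : RtoC u <> 0%C) by (apply RtoC_neq_0; lra). field. exact Hu0. }
  eapply cderive_eq.
  - apply (cderive_jint (hfun mu) (fun u => theta_hfun mu u / RtoC u)%C
      (fun u => (theta2_hfun mu u - theta_hfun mu u) / RtoC (u ^ 2))%C tau x).
    + intros u Hu. now apply cderive_hfun_theta.
    + intros u Hu. now apply cderive_hfun_quot.
    + apply tame_hfun.
    + apply (tame_ext (theta_hfun mu)); [exact E1|apply tame_theta_hfun].
    + apply (tame_ext (fun u => theta2_hfun mu u + - (1) * theta_hfun mu u)%C).
      * intros u Hu. assert (RtoC (u ^ 2) <> 0%C) by (apply RtoC_neq_0; nra). field. assumption.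
      * apply tame_plus; [apply tame_theta2_hfun|apply tame_scal, tame_theta_hfun].
    + exact Hx.
  - f_equal. rewrite <- (jint_ext _ _ tau x Hx E1).
    rewrite (jint_ext (theta_hfun mu)
      (fun u => - (1) * (hfun (mu + 1) u + RtoC (mu + / 2) * hfun mu u))%C tau x Hx).
    2: { intros u _. unfold theta_hfun. ring. }
    rewrite jint_scal, jint_plus, jint_scal by
      (auto using tame_hfun, tame_plus, tame_scal). ring.
Qed.

Lemma cnice_trig (f : R -> C) (r : R -> R) (x : R) :
  tame f -> 0 < x -> (forall y, continuous r y) -> (forall y, Rabs (r y) <= 1) ->
  cnice (fun y => f (x * cosh (y / 2) ^ 2)%R * RtoC (r y))%C.
Proof.
  intros Hf Hx Hr1 Hr2. destruct (jkernel_cdom f 0 x Hf Hx) as (K & HK).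
  destruct (HK x (Rle_refl _)) as (Hc & Hd & HB).
  assert (E : forall y, jkernel f 0 x y = f (x * cosh (y / 2) ^ 2)).
  { intros y. unfold jkernel. rewrite Rmult_0_l, cos_0. ring. }
  exists (K * exp (- (3 / 4 * x))), 1. split; [|split; [lra|]].
  - intros y. apply ccontinuous_mult.
    + destruct (Hc y) as [H1 H2]. split.
      * apply (continuous_ext (fun t => Re (jkernel f 0 x t))); [intros t; now rewrite E|exact H1].
      * apply (continuous_ext (fun t => Im (jkernel f 0 x t))); [intros t; now rewrite E|exact H2].
    + apply ccontinuous_RtoC, Hr1.
  - intros y. rewrite Cmod_mult, Cmod_R. specialize (HB y). rewrite E in HB.
    pose proof (Cmod_ge_0 (f (x * cosh (y / 2) ^ 2))). specialize (Hr2 y).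
    pose proof (Rabs_pos (r y)). nra.
Qed.

(** [tanh (y/2)], the logarithmic derivative of [x cosh^2 (y/2)]: [d/dy] acts on a function of that
    argument as [th2] times [u d/du]. *)
Definition th2 (y : R) : R := sinh (y / 2) / cosh (y / 2).

Lemma th2_bound (y : R) : Rabs (th2 y) <= 1.
Proof.
  unfold th2. pose proof (cosh_ge_1 (y / 2)). rewrite Rabs_div, (Rabs_pos_eq (cosh _)) by lra.
  apply Rmult_le_reg_r with (cosh (y / 2)); [lra|].
  unfold Rdiv. rewrite Rmult_assoc, Rinv_l, Rmult_1_r, Rmult_1_l by lra.
  unfold sinh, cosh. pose proof (exp_pos (y / 2)). pose proof (exp_pos (- (y / 2))).
  apply Rabs_le. lra.
Qed.

Lemma is_derive_th2 (y : R) : is_derive th2 y ((1 - th2 y ^ 2) / 2).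
Proof.
  pose proof (cosh_ge_1 (y / 2)). unfold th2. eapply is_derive_eq.
  - apply is_derive_div; [apply is_derive_sinh_half|apply is_derive_cosh_half|lra].
  - cbv beta. field. lra.
Qed.

Lemma cderive_xcosh2 (f f1 : R -> C) (x y : R) :
  0 < x -> (forall u, 0 < u -> cderive f u (f1 u / RtoC u)) ->
  cderive (fun y => f (x * cosh (y / 2) ^ 2)%R) y
    (RtoC (th2 y) * f1 (x * cosh (y / 2) ^ 2)%R).
Proof.
  intros Hx Hf. pose proof (xcosh2_ge x y Hx). pose proof (cosh_ge_1 (y / 2)).
  eapply cderive_eq.
  - apply (cderive_comp f (fun y => x * cosh (y / 2) ^ 2)); [apply Hf; lra|apply is_derive_xcosh2].
  - assert (RtoC (cosh (y / 2)) <> 0%C) by (apply RtoC_neq_0; lra).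
    assert (RtoC x <> 0%C) by (apply RtoC_neq_0; lra).
    unfold th2. rewrite RtoC_div, !RtoC_mult, RtoC_pow by lra. field. auto.
Qed.

(** Two integrations by parts against [cos (tau y)]. *)
Lemma jint_hfun_recurrence (mu tau x : R) :
  0 < x ->
  jint (hfun (mu + 2)) tau x =
  (RtoC (x - 2 * mu - 2) * jint (hfun (mu + 1)) tau x
   - RtoC (tau ^ 2 + (mu + / 2) ^ 2) * jint (hfun mu) tau x)%C.
Proof.
  intros Hx.
  set (W := fun y => x * cosh (y / 2) ^ 2).
  assert (Hmain : cint (fun y => jkernel (theta2_hfun mu) tau x y
     + (- RtoC x * jkernel (hfun (mu + 1)) tau x y + RtoC (tau ^ 2) * jkernel (hfun mu) tau x y))%C = 0%C).
  (* Both integrations by parts at once: the two sine terms in the derivative of this function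
     cancel. *)
  { apply (cint_derive_0 _ (fun y => theta_hfun mu (W y) * RtoC (th2 y * cos (tau * y))
      + RtoC tau * (hfun mu (W y) * RtoC (sin (tau * y))))%C).
    - intros y. pose proof (xcosh2_ge x y Hx) as HW. fold (W y) in HW.
      eapply cderive_eq.
      + apply cderive_plus.
        * apply cderive_mult.
          -- apply (cderive_xcosh2 (theta_hfun mu) (theta2_hfun mu) x y Hx).
             intros u Hu. now apply cderive_theta_hfun.
          -- apply cderive_RtoC, is_derive_Rmult; [apply is_derive_th2|apply is_derive_cos_scal].
        * apply cderive_scal, cderive_mult.
          -- apply (cderive_xcosh2 (hfun mu) (theta_hfun mu) x y Hx).
             intros u Hu. now apply cderive_hfun_theta.
          -- apply cderive_RtoC, is_derive_sin_scal.
      + cbv beta. fold (W y). unfold jkernel. fold (W y).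
        (* The remaining [tanh^2] is removed by means of the differential equation, leaving
           coefficients constant in [y]. *)
        assert (E : (RtoC x * hfun (mu + 1) (W y))%C =
          (RtoC (1 - th2 y ^ 2) * (theta2_hfun mu (W y) - RtoC (/ 2) * theta_hfun mu (W y)))%C).
        { rewrite theta_hfun_ode. rewrite Cmult_assoc, <- RtoC_mult. f_equal. f_equal.
          unfold W, th2. pose proof (cosh_ge_1 (y / 2)). pose proof (cosh2_sinh2 (y / 2)) as Hcs.
          replace ((1 - (sinh (y / 2) / cosh (y / 2)) ^ 2) * (x * cosh (y / 2) ^ 2)) with
            (x * (cosh (y / 2) ^ 2 - sinh (y / 2) ^ 2)) by (field; lra).
          rewrite Hcs. ring. }
        replace (- RtoC x * (hfun (mu + 1) (W y) * RtoC (cos (tau * y))))%C with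
          (- (RtoC x * hfun (mu + 1) (W y)) * RtoC (cos (tau * y)))%C by ring.
        rewrite E. rewrite !RtoC_plus, !RtoC_mult, !RtoC_opp, !RtoC_div, !RtoC_minus, !RtoC_inv by lra.
        rewrite !RtoC_pow. field.
    - apply cnice_plus; [|apply cnice_scal]; apply cnice_trig; try assumption.
      + apply tame_theta_hfun.
      + intros y. eapply is_derive_continuous, is_derive_Rmult;
          [apply is_derive_th2|apply is_derive_cos_scal].
      + intros y. rewrite Rabs_mult. pose proof (th2_bound y). pose proof (Rabs_cos_le (tau * y)).
        pose proof (Rabs_pos (th2 y)). pose proof (Rabs_pos (cos (tau * y))). nra.
      + apply tame_hfun.
      + intros y. eapply is_derive_continuous, is_derive_sin_scal.
      + intros y. apply Rabs_sin_le.
    - apply cnice_plus; [|apply cnice_plus; apply cnice_scal]; apply jkernel_cnice; try assumption.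
      + apply tame_theta2_hfun.
      + apply tame_hfun.
      + apply tame_hfun. }
  assert (N1 : cnice (jkernel (theta2_hfun mu) tau x)) by (apply jkernel_cnice; [apply tame_theta2_hfun|exact Hx]).
  assert (N2 : forall m, cnice (jkernel (hfun m) tau x)) by (intros m; apply jkernel_cnice; [apply tame_hfun|exact Hx]).
  rewrite !cint_plus, !cint_scal in Hmain by auto using cnice_plus, cnice_scal.
  fold (jint (theta2_hfun mu) tau x) in Hmain. fold (jint (hfun (mu + 1)) tau x) in Hmain.
  fold (jint (hfun mu) tau x) in Hmain.
  unfold theta2_hfun in Hmain.
  rewrite !jint_plus, !jint_scal in Hmain by auto using tame_hfun, tame_plus, tame_scal.
  apply Ceq_minus. rewrite <- Hmain.
  rewrite !RtoC_minus, !RtoC_plus, !RtoC_mult. ring.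
Qed.

(** * Laplace's method for the Fourier integral *)

Lemma sinh_le_mul_cosh (t : R) : 0 <= t -> sinh t <= t * cosh t.
Proof.
  intros Ht.
  destruct (MVT_gen (fun t => t * cosh t - sinh t) 0 t (fun t => t * sinh t)) as (c & Hc & E).
  - intros x _. unfold sinh, cosh. auto_derive; [exact I|]. field.
  - intros x _. apply continuity_pt_filterlim,
      (is_derive_continuous (fun t => t * cosh t - sinh t) x (x * sinh x)).
    unfold sinh, cosh. auto_derive; [exact I|]. field.
  - rewrite Rmin_left, Rmax_right in Hc by exact Ht. rewrite sinh_0, Rmult_0_l in E.
    pose proof (sinh_ge c ltac:(lra)).
    assert (0 <= c * sinh c * (t - 0)) by (apply Rmult_le_pos; nra). lra.
Qed.

(** From [sinh t <= t cosh t] one gets [sinh^2 t - t^2 <= t^2 sinh^2 t]. The 9 is the square of the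
    bound 3 for [cosh] on [[0, 1]]. Hence [x sinh^2 (s / sqrt x)] tends to [s^2]. *)
Lemma sinh2_le (t : R) : Rabs t <= 1 -> sinh t ^ 2 <= 9 * t ^ 2 /\ sinh t ^ 2 - t ^ 2 <= 9 * t ^ 4.
Proof.
  assert (H : forall t, 0 <= t <= 1 -> sinh t ^ 2 <= 9 * t ^ 2 /\ sinh t ^ 2 - t ^ 2 <= 9 * t ^ 4).
  { clear t. intros t Ht. pose proof (sinh_le_mul_cosh t ltac:(lra)) as H1.
    pose proof (sinh_ge t ltac:(lra)) as H2. pose proof (cosh_ge_1 t) as H3.
    assert (H4 : cosh t <= 3).
    { unfold cosh. assert (exp t <= exp 1) by (apply exp_le; lra).
      assert (exp (- t) <= exp 1) by (apply exp_le; lra). pose proof exp_le_3. lra. }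
    assert (H5 : sinh t ^ 2 <= (t * cosh t) ^ 2) by (apply pow_incr; lra).
    assert (H6 : sinh t ^ 2 <= 9 * t ^ 2).
    { eapply Rle_trans; [exact H5|]. replace ((t * cosh t) ^ 2) with (cosh t ^ 2 * t ^ 2) by ring.
      apply Rmult_le_compat_r; [apply pow2_ge_0|]. nra. }
    split; [exact H6|].
    replace ((t * cosh t) ^ 2) with (t ^ 2 * cosh t ^ 2) in H5 by ring.
    rewrite (cosh2_sinh2 t) in H5.
    assert (t ^ 2 * sinh t ^ 2 <= t ^ 2 * (9 * t ^ 2))
      by (apply Rmult_le_compat_l; [apply pow2_ge_0|exact H6]).
    replace (9 * t ^ 4) with (t ^ 2 * (9 * t ^ 2)) by ring. lra. }
  intros Ht. destruct (Rle_dec 0 t) as [H0|H0].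
  - apply H. rewrite Rabs_pos_eq in Ht by exact H0. lra.
  - specialize (H (- t)). rewrite sinh_opp in H. rewrite Rabs_left in Ht by lra.
    replace ((- sinh t) ^ 2) with (sinh t ^ 2) in H by ring.
    replace ((- t) ^ 2) with (t ^ 2) in H by ring.
    replace ((- t) ^ 4) with (t ^ 4) in H by ring. apply H. lra.
Qed.

Lemma exp_opp_diff (p q : R) : 0 <= q <= p -> Rabs (exp (- p) - exp (- q)) <= p - q.
Proof.
  intros H. replace (- p) with (- q + - (p - q)) by ring. rewrite exp_plus.
  pose proof (exp_ineq1_le (- (p - q))). pose proof (exp_pos (- (p - q))).
  assert (exp (- (p - q)) <= 1) by (rewrite <- exp_0; apply exp_le; lra).
  assert (exp (- q) <= 1) by (rewrite <- exp_0; apply exp_le; lra).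
  pose proof (exp_pos (- q)). rewrite Rabs_left1 by nra. nra.
Qed.

Lemma cos_minus_1_le (t : R) : Rabs (cos t - 1) <= Rabs t.
Proof.
  pose proof (bounded_variation cos (fun t => - sin t) 1 0 t) as H.
  rewrite cos_0, Rminus_0_r, Rmult_1_l in H. apply H. intros s _. split.
  - apply is_derive_cos.
  - rewrite Rabs_Ropp. apply Rabs_sin_le.
Qed.

Lemma div_sqrt_small (K e : R) : 0 < e -> Rbar_locally p_infty (fun x => K / sqrt x < e).
Proof.
  intros He. apply (p_infty_intro _ (((Rabs K + 1) / e) ^ 2)). intros x Hx.
  assert (Hk : 0 < (Rabs K + 1) / e).
  { apply Rdiv_lt_0_compat; [|exact He]. pose proof (Rabs_pos K). lra. }
  assert (Hs : (Rabs K + 1) / e < sqrt x).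
  { rewrite <- (sqrt_pow2 ((Rabs K + 1) / e)) by lra. apply sqrt_lt_1; [apply pow2_ge_0| |exact Hx].
    pose proof (pow2_ge_0 ((Rabs K + 1) / e)). lra. }
  apply Rmult_lt_reg_r with (sqrt x); [lra|].
  replace (K / sqrt x * sqrt x) with K by (field; lra).
  apply Rmult_lt_compat_l with (r := e) in Hs; [|exact He].
  replace (e * ((Rabs K + 1) / e)) with (Rabs K + 1) in Hs by (field; lra).
  pose proof (Rle_abs K). lra.
Qed.

(** [hfun] divided by its leading behaviour [u^mu e^(-u)] (see [hfun_kfun]), with the integral
    substituted for [hfun]. *)
Definition kfun (mu u : R) : C :=
  (Rcpow u (RtoC (/ 2 - mu)) * (rGamma (RtoC (/ 2 - mu)) * kint (RtoC (/ 2 - mu)) (RtoC mu) u))%C.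

Lemma kfun_lim (mu : R) :
  mu <= - 3 / 2 -> has_clim (kfun mu) (Rbar_locally p_infty) 1.
Proof.
  intros Hmu. assert (Hp : 0 < Re (RtoC (/ 2 - mu))) by (rewrite re_RtoC; lra).
  rewrite <- (gammaint_rGamma _ Hp), Cmult_comm.
  apply (has_clim_ext _ (fun u => rGamma (RtoC (/ 2 - mu)) *
    (Rcpow u (RtoC (/ 2 - mu)) * kint (RtoC (/ 2 - mu)) (RtoC mu) u))%C).
  - intros u. unfold kfun. ring.
  - apply has_clim_scal; [typeclasses eauto|]. now apply kint_lim_infty.
Qed.

Lemma hfun_kfun (mu u : R) :
  mu <= - 3 / 2 -> 0 < u -> hfun mu u = (RtoC (Rpower u mu * exp (- u)) * kfun mu u)%C.
Proof.
  intros Hmu Hu. rewrite hfun_kint by assumption. unfold kfun. rewrite Rcpow_RtoC.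
  replace (Rpower u (/ 2)) with (Rpower u mu * Rpower u (/ 2 - mu))
    by (rewrite <- Rpower_plus; f_equal; ring).
  rewrite !RtoC_mult. ring.
Qed.

(** Laplace's method, after the substitution [y = 2 s / sqrt x]. *)
Lemma jint_hfun_lim (mu tau : R) :
  mu <= - 3 / 2 ->
  has_clim (fun x => RtoC (Rpower x (/ 2 - mu) * exp x) * jint (hfun mu) tau x)%C
    (Rbar_locally p_infty) (RtoC (2 * sqrt PI)).
Proof.
  intros Hmu.
  (* The rescaled integrand: [cosh^2 = 1 + sinh^2] lets the prefactor [e^x] cancel, and the 2 comes
     from [dy = 2 ds / sqrt x]. What is left is close to a Gaussian times three factors tending to
     1. *)
  set (Phi := fun x s : R =>
    (RtoC (2 * (exp (- (x * sinh (s / sqrt x) ^ 2)) *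
       (Rpower (cosh (s / sqrt x) ^ 2) mu * cos (tau * (2 * (s / sqrt x))))))
     * kfun mu (x * cosh (s / sqrt x) ^ 2))%C).
  assert (HPhi : forall x, 0 < x ->
    (forall s, ccontinuous (Phi x) s) /\
    (RtoC (Rpower x (/ 2 - mu) * exp x) * jint (hfun mu) tau x)%C = cint (Phi x)).
  { intros x Hx. assert (Hr : 0 < sqrt x) by now apply sqrt_lt_R0.
    assert (Hk : 0 < 2 / sqrt x) by (apply Rdiv_lt_0_compat; lra).
    pose proof (jkernel_cnice (hfun mu) tau x (tame_hfun mu) Hx) as HN.
    assert (EPhi : forall s, Phi x s = (RtoC (Rpower x (/ 2 - mu) * exp x) *
      (RtoC (2 / sqrt x) * jkernel (hfun mu) tau x (2 / sqrt x * s + 0)%R))%C).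
    { intros s. unfold Phi, jkernel.
      replace ((2 / sqrt x * s + 0) / 2) with (s / sqrt x) by (field; lra).
      replace (2 / sqrt x * s + 0) with (2 * (s / sqrt x)) by (field; lra).
      set (t := s / sqrt x). pose proof (cosh_ge_1 t) as Hc. pose proof (cosh2_sinh2 t) as Hcs.
      assert (Hc2 : 0 < cosh t ^ 2) by nra.
      rewrite (hfun_kfun mu (x * cosh t ^ 2)) by (try assumption; apply Rmult_lt_0_compat; lra).
      replace (Rpower (x * cosh t ^ 2) mu) with (Rpower x mu * Rpower (cosh t ^ 2) mu)
        by (rewrite Rpower_mult_distr by assumption; reflexivity).
      replace (exp (- (x * cosh t ^ 2))) with (exp (- x) * exp (- (x * sinh t ^ 2)))
        by (rewrite <- exp_plus, Hcs; f_equal; ring).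
      replace (Rpower x (/ 2 - mu)) with (sqrt x * / Rpower x mu).
      2: { rewrite <- Rpower_sqrt, <- Rpower_Ropp, <- Rpower_plus by exact Hx. f_equal. }
      rewrite (exp_Ropp x). pose proof (exp_pos x). pose proof (exp_pos (mu * ln x)) as Hpp.
      change (exp (mu * ln x)) with (Rpower x mu) in Hpp.
      transitivity (RtoC (sqrt x * / Rpower x mu * exp x * (2 / sqrt x) *
        (Rpower x mu * Rpower (cosh t ^ 2) mu * (/ exp x * exp (- (x * sinh t ^ 2)))) *
         cos (tau * (2 * t))) * kfun mu (x * cosh t ^ 2))%C.
      - f_equal. f_equal. field. lra.
      - rewrite !RtoC_mult. ring. }
    split.
    - intros s.
      assert (Hcont : ccontinuous (fun s => RtoC (Rpower x (/ 2 - mu) * exp x) *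
        (RtoC (2 / sqrt x) * jkernel (hfun mu) tau x (2 / sqrt x * s + 0)%R))%C s).
      { apply ccontinuous_scal, ccontinuous_scal.
        apply (ccontinuous_comp _ (fun s => 2 / sqrt x * s + 0)).
        - apply jkernel_continuous; [apply tame_hfun|exact Hx].
        - apply (is_derive_continuous _ _ (2 / sqrt x)). auto_derive; [exact I|ring]. }
      destruct Hcont as [H1 H2]. split.
      + eapply (continuous_ext (fun s => Re (RtoC (Rpower x (/ 2 - mu) * exp x) *
          (RtoC (2 / sqrt x) * jkernel (hfun mu) tau x (2 / sqrt x * s + 0)%R))%C)); [|exact H1].
        intros t. now rewrite EPhi.
      + eapply (continuous_ext (fun s => Im (RtoC (Rpower x (/ 2 - mu) * exp x) *
          (RtoC (2 / sqrt x) * jkernel (hfun mu) tau x (2 / sqrt x * s + 0)%R))%C)); [|exact H2].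
        intros t. now rewrite EPhi.
    - rewrite (cint_ext _ _ EPhi). unfold jint.
      rewrite <- (cint_scale_shift _ (2 / sqrt x) 0 Hk HN) at 1.
      symmetry. apply cint_scal. apply cnice_scal.
      destruct HN as (K & d & Hc & Hd & HB). exists K, (d * (2 / sqrt x)).
      split; [|split; [apply Rmult_lt_0_compat; assumption|]].
      + intros s. apply (ccontinuous_comp _ (fun s => 2 / sqrt x * s + 0)); [apply Hc|].
        apply (is_derive_continuous _ _ (2 / sqrt x)). auto_derive; [exact I|ring].
      + intros s. eapply Rle_trans; [apply HB|]. rewrite Rplus_0_r, Rabs_mult, (Rabs_pos_eq (2 / sqrt x)) by lra.
        right. f_equal. f_equal. ring. }
  assert (Eg : cint (fun s => RtoC (2 * exp (- s ^ 2))) = RtoC (2 * sqrt PI)).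
  { rewrite <- gauss_integral. apply C_ext.
    - change (rint (fun s => 2 * exp (- s ^ 2)) = 2 * rint (fun s => exp (- s ^ 2))).
      pose proof (rint_lin _ _ _ _ _ _ 2 0 gauss_rnice gauss_rnice) as E.
      rewrite Rmult_0_l, Rplus_0_r in E. rewrite <- E. apply rint_ext. intros v. ring.
    - now apply rint_0. }
  rewrite <- Eg.
  apply (has_clim_ext_loc _ (fun x => cint (Phi x))).
  { apply (p_infty_intro _ 0). intros x Hx. symmetry. now apply HPhi. }
  pose proof (kfun_lim mu Hmu) as Hk.
  (* Majorants for all [s]: [sinh^2 t >= t^2] compares with the Gaussian, and the power of [cosh] is
     at most 1 because [mu] is negative. *)
  assert (Hcommon : forall x s, 0 < x ->
    s ^ 2 <= x * sinh (s / sqrt x) ^ 2 /\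
    0 < Rpower (cosh (s / sqrt x) ^ 2) mu <= 1 /\ x <= x * cosh (s / sqrt x) ^ 2).
  { intros x s Hx. assert (Hr : 0 < sqrt x) by now apply sqrt_lt_R0.
    set (t := s / sqrt x).
    assert (Hst : s ^ 2 = x * t ^ 2).
    { unfold t. rewrite <- (sqrt_sqrt x) at 1 by lra. field. lra. }
    pose proof (sinh2_ge t). pose proof (cosh2_sinh2 t). pose proof (pow2_ge_0 (sinh t)).
    split; [rewrite Hst; apply Rmult_le_compat_l; lra|split; [split; [apply exp_pos|]|]].
    - unfold Rpower. rewrite <- exp_0. apply exp_le.
      assert (0 <= ln (cosh t ^ 2)) by (rewrite <- ln_1; apply ln_le; lra). nra.
    - rewrite <- (Rmult_1_r x) at 1. apply Rmult_le_compat_l; lra. }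
  (* 8 is the product of the Jacobian 2, the constant 2 of [gauss_rnice] and the bound 2 for [kfun]
     at large argument. *)
  eapply (cint_lim (Rbar_locally p_infty) Phi _ 8 1).
  - destruct (Hk 1 Rlt_0_1) as (U & HU).
    apply (p_infty_intro _ (Rmax 0 U)). intros x Hx.
    assert (Hx0 : 0 < x) by (eapply Rle_lt_trans; [apply Rmax_l|exact Hx]).
    assert (HxU : U < x) by (eapply Rle_lt_trans; [apply Rmax_r|exact Hx]).
    split; [apply HPhi, Hx0|split; [lra|]]. intros s.
    destruct (Hcommon x s Hx0) as (H1 & H2 & H3).
    unfold Phi. set (t := s / sqrt x) in *. rewrite Cmod_mult, Cmod_R.
    assert (Hkm : Cmod (kfun mu (x * cosh t ^ 2)) <= 2).
    { specialize (HU (x * cosh t ^ 2) ltac:(lra)).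
      replace (kfun mu (x * cosh t ^ 2)) with (1 + (kfun mu (x * cosh t ^ 2) - 1))%C by ring.
      eapply Rle_trans; [apply Cmod_triangle|]. rewrite Cmod_1. lra. }
    rewrite !Rabs_mult, (Rabs_pos_eq 2), (Rabs_pos_eq (exp _)), (Rabs_pos_eq (Rpower _ _))
      by (try lra; left; apply exp_pos).
    pose proof (Rabs_cos_le (tau * (2 * t))). pose proof (Rabs_pos (cos (tau * (2 * t)))).
    destruct gauss_rnice as (_ & _ & HG). specialize (HG s).
    rewrite Rabs_pos_eq in HG by (left; apply exp_pos).
    assert (He : exp (- (x * sinh t ^ 2)) <= exp (- s ^ 2)) by (apply exp_le; lra).
    pose proof (exp_pos (- (x * sinh t ^ 2))).
    assert (Rpower (cosh t ^ 2) mu * Rabs (cos (tau * (2 * t))) <= 1) by nra.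
    assert (0 <= Rpower (cosh t ^ 2) mu * Rabs (cos (tau * (2 * t)))) by (apply Rmult_le_pos; lra).
    apply Rle_trans with (2 * (2 * exp (- (1) * Rabs s) * 1) * 2); [|lra].
    apply Rmult_le_compat; try lra; try apply Cmod_ge_0.
    + apply Rmult_le_pos; [lra|]. apply Rmult_le_pos; lra.
    + apply Rmult_le_compat_l; [lra|]. apply Rmult_le_compat; lra.
  - intros s. apply ccontinuous_RtoC. eapply is_derive_continuous. auto_derive; [exact I|reflexivity].
  - intros N eps He. assert (He8 : 0 < eps / 8) by lra.
    destruct (Hk (eps / 8) He8) as (U & HU).
    assert (HU' : Rbar_locally p_infty (fun x => U < x)) by (exists U; auto).
    assert (Hpos : Rbar_locally p_infty (fun x => 1 < x)) by (exists 1; auto).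
    set (M := Rabs N + 1). assert (HM : 1 <= M) by (unfold M; pose proof (Rabs_pos N); lra).
    eapply filter_imp; [|exact (filter_and _ _ HU' (filter_and _ _ Hpos
      (filter_and _ _ (div_sqrt_small M 1 Rlt_0_1)
      (filter_and _ _ (div_sqrt_small (9 * M ^ 4) (eps / 8) He8)
      (filter_and _ _ (div_sqrt_small (Rabs mu * (9 * M ^ 2)) (eps / 8) He8)
        (div_sqrt_small (Rabs tau * (2 * M)) (eps / 8) He8))))))].
    intros x (HxU & Hx1 & S1 & S2 & S3 & S4) s Hs. cbv beta in *.
    assert (Hr : 1 < sqrt x) by (rewrite <- sqrt_1; apply sqrt_lt_1; lra).
    assert (HsM : Rabs s <= M) by (unfold M; pose proof (Rle_abs N); lra).
    destruct (Hcommon x s ltac:(lra)) as (H1 & H2 & H3).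
    unfold Phi. set (t := s / sqrt x) in *.
    assert (Hst : s ^ 2 = x * t ^ 2).
    { unfold t. rewrite <- (sqrt_sqrt x) at 1 by lra. field. lra. }
    assert (Htabs : Rabs t = Rabs s / sqrt x)
      by (unfold t; rewrite Rabs_div, (Rabs_pos_eq (sqrt x)) by lra; reflexivity).
    assert (Ht : Rabs t <= M / sqrt x).
    { rewrite Htabs. apply Rmult_le_compat_r; [left; apply Rinv_0_lt_compat; lra|exact HsM]. }
    assert (Ht1 : Rabs t <= 1) by lra.
    destruct (sinh2_le t Ht1) as [B1 B2].
    assert (Ht2 : t ^ 2 <= M ^ 2 / sqrt x).
    { rewrite <- (pow2_abs t). apply Rle_trans with ((M / sqrt x) ^ 2).
      - apply pow_incr. split; [apply Rabs_pos|exact Ht].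
      - replace ((M / sqrt x) ^ 2) with (M ^ 2 / sqrt x * / sqrt x) by (field; lra).
        rewrite <- (Rmult_1_r (M ^ 2 / sqrt x)) at 2. apply Rmult_le_compat_l.
        + apply Rdiv_le_0_compat; [apply pow2_ge_0|lra].
        + rewrite <- Rinv_1. apply Rinv_le_contravar; lra. }
    set (A := exp (- (x * sinh t ^ 2))). set (B := Rpower (cosh t ^ 2) mu).
    set (D := cos (tau * (2 * t))). set (k := kfun mu (x * cosh t ^ 2)).
    assert (EA : Rabs (A - exp (- s ^ 2)) < eps / 8).
    { eapply Rle_lt_trans; [apply exp_opp_diff; split; [apply pow2_ge_0|exact H1]|].
      eapply Rle_lt_trans; [|exact S2]. rewrite Hst.
      apply Rle_trans with (x * (9 * t ^ 4)).
      - replace (x * sinh t ^ 2 - x * t ^ 2) with (x * (sinh t ^ 2 - t ^ 2)) by ring.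
        apply Rmult_le_compat_l; lra.
      - replace (x * (9 * t ^ 4)) with (9 * (s ^ 2 * t ^ 2)) by (rewrite Hst; ring).
        replace (9 * M ^ 4 / sqrt x) with (9 * (M ^ 2 * (M ^ 2 / sqrt x))) by (field; lra).
        apply Rmult_le_compat_l; [lra|]. apply Rmult_le_compat; try apply pow2_ge_0; [|exact Ht2].
        rewrite <- (pow2_abs s). apply pow_incr. split; [apply Rabs_pos|exact HsM]. }
    assert (EB : Rabs (B - 1) < eps / 8).
    { eapply Rle_lt_trans; [|exact S3]. rewrite Rabs_left1 by (unfold B; lra).
      assert (Hl : ln (cosh t ^ 2) <= sinh t ^ 2).
      { rewrite cosh2_sinh2. apply ln_1p_le, pow2_ge_0. }
      pose proof (exp_ineq1_le (mu * ln (cosh t ^ 2))) as Hexp.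
      change (exp (mu * ln (cosh t ^ 2))) with B in Hexp.
      assert (Hm : - mu * ln (cosh t ^ 2) <= - mu * (9 * t ^ 2)) by (apply Rmult_le_compat_l; lra).
      rewrite (Rabs_left mu) by lra.
      apply Rle_trans with (- mu * (9 * t ^ 2)); [lra|].
      replace (- mu * (9 * M ^ 2) / sqrt x) with (- mu * (9 * (M ^ 2 / sqrt x))) by (field; lra).
      apply Rmult_le_compat_l; lra. }
    assert (ED : Rabs (D - 1) < eps / 8).
    { eapply Rle_lt_trans; [apply cos_minus_1_le|]. eapply Rle_lt_trans; [|exact S4].
      rewrite !Rabs_mult, (Rabs_pos_eq 2) by lra.
      replace (Rabs tau * (2 * M) / sqrt x) with (Rabs tau * (2 * (M / sqrt x))) by (field; lra).
      apply Rmult_le_compat_l; [apply Rabs_pos|]. lra. }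
    assert (Ek : Cmod (k - 1) < eps / 8) by (apply HU; lra).
    assert (HA : Rabs A <= 1).
    { unfold A. rewrite Rabs_pos_eq by (left; apply exp_pos). rewrite <- exp_0. apply exp_le.
      pose proof (pow2_ge_0 s). lra. }
    assert (HB : Rabs B <= 1) by (rewrite Rabs_pos_eq; unfold B; lra).
    assert (HD : Rabs D <= 1) by apply Rabs_cos_le.
    (* Telescoping over the four factors, each within [eps / 8] of its limit; the outer 2 makes the
       total less than [eps]. *)
    replace (RtoC (2 * (A * (B * D))) * k - RtoC (2 * exp (- s ^ 2)))%C with
      (2 * (RtoC (A * B * D) * (k - 1) + RtoC (A * B * (D - 1) + A * (B - 1) + (A - exp (- s ^ 2)))))%C.
    2: { rewrite !RtoC_plus, !RtoC_mult, !RtoC_minus. ring. }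
    rewrite Cmod_mult, Cmod_R, (Rabs_pos_eq 2) by lra.
    assert (HABD : Cmod (RtoC (A * B * D) * (k - 1)) <= eps / 8).
    { rewrite Cmod_mult, Cmod_R, !Rabs_mult. pose proof (Cmod_ge_0 (k - 1)).
      pose proof (Rabs_pos A). pose proof (Rabs_pos B). pose proof (Rabs_pos D).
      assert (Rabs A * Rabs B <= 1 * 1) by (apply Rmult_le_compat; lra).
      assert (Rabs A * Rabs B * Rabs D <= 1 * 1 * 1) by (apply Rmult_le_compat; [apply Rmult_le_pos; lra|lra|lra|lra]).
      nra. }
    assert (HR : Rabs (A * B * (D - 1) + A * (B - 1) + (A - exp (- s ^ 2))) < eps / 8 + eps / 8 + eps / 8).
    { eapply Rle_lt_trans; [apply Rabs_triang|]. apply Rplus_le_lt_compat; [|exact EA].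
      eapply Rle_trans; [apply Rabs_triang|]. rewrite !Rabs_mult.
      pose proof (Rabs_pos A). pose proof (Rabs_pos B). pose proof (Rabs_pos (D - 1)).
      pose proof (Rabs_pos (B - 1)).
      apply Rplus_le_compat.
      - assert (Rabs A * Rabs B <= 1 * 1) by (apply Rmult_le_compat; lra). nra.
      - nra. }
    pose proof (Cmod_triangle (RtoC (A * B * D) * (k - 1))
      (RtoC (A * B * (D - 1) + A * (B - 1) + (A - exp (- s ^ 2))))) as HT.
    rewrite (Cmod_R (_ + _ + _)) in HT. lra.
Qed.

(** * Identification of the Fourier integral with Tricomi's function *)

(** Raising [a] with [c] fixed is lowering [mu] by one, and the factor [a] normalizes the second
    component. The recurrence for [jint] fits the system because
    [a (a - c + 1) = tau^2 + (mu - 1/2)^2] for imaginary [nu]. *)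
Lemma ksystem_jint (mu tau : R) (nu a c : C) :
  nu = (Ci * RtoC tau)%C -> a = (RtoC (/ 2 - mu) + nu)%C -> c = (1 + 2 * nu)%C ->
  ksystem a c (fun x => RtoC (exp x) * Rcpow x (- nu) * jint (hfun mu) tau x)%C
    (fun x => a * (RtoC (exp x) * Rcpow x (- nu) * jint (hfun (mu - 1)) tau x))%C.
Proof.
  intros Hnu Ha Hc x Hx. assert (Hx0 : RtoC x <> 0%C) by (apply RtoC_neq_0; lra).
  assert (Hnu2 : (nu * nu)%C = RtoC (- tau ^ 2)).
  { rewrite Hnu. apply C_ext; simpl; ring. }
  assert (Hpre : cderive (fun x => RtoC (exp x) * Rcpow x (- nu))%C x
    ((1 - nu / RtoC x) * (RtoC (exp x) * Rcpow x (- nu)))).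
  { eapply cderive_eq.
    - apply cderive_mult; [apply cderive_RtoC, is_derive_exp|now apply cderive_Rcpow].
    - cbv beta. field. exact Hx0. }
  pose proof (jint_hfun_recurrence (mu - 1) tau x Hx) as ER.
  replace (mu - 1 + 2) with (mu + 1) in ER by ring.
  replace (mu - 1 + 1) with mu in ER by ring.
  assert (EAC : (a * (a - c + 1))%C = RtoC (tau ^ 2 + (mu - 1 + / 2) ^ 2)).
  { rewrite Ha, Hc.
    replace ((RtoC (/ 2 - mu) + nu) * (RtoC (/ 2 - mu) + nu - (1 + 2 * nu) + 1))%C with
      (RtoC (/ 2 - mu) * RtoC (/ 2 - mu) - nu * nu)%C by ring.
    rewrite Hnu2, <- RtoC_mult, <- RtoC_minus. f_equal. field. }
  split.
  - eapply cderive_eq.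
    + apply cderive_mult; [exact Hpre|now apply cderive_jint_hfun].
    + cbv beta. rewrite ER.
      set (J := jint (hfun mu) tau x). set (J1 := jint (hfun (mu - 1)) tau x).
      set (P := (RtoC (exp x) * Rcpow x (- nu))%C).
      replace ((- a * (P * J) + (a - c + 1) * (a * (P * J1))) / RtoC x)%C with
        (P * (- a * J + a * (a - c + 1) * J1) / RtoC x)%C by (field; exact Hx0).
      rewrite EAC, Ha.
      replace (RtoC (x - 2 * (mu - 1) - 2)) with (RtoC x - RtoC (mu + / 2) + RtoC (/ 2 - mu))%C
        by (rewrite <- RtoC_minus, <- RtoC_plus; f_equal; field).
      field. exact Hx0.
  - eapply cderive_eq.
    + apply cderive_scal, cderive_mult; [exact Hpre|now apply cderive_jint_hfun].
    + cbv beta. replace (mu - 1 + 1) with mu by ring.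
      set (J := jint (hfun mu) tau x). set (J1 := jint (hfun (mu - 1)) tau x).
      set (P := (RtoC (exp x) * Rcpow x (- nu))%C).
      assert (E2 : (a - c + 1)%C = (- RtoC (mu - 1 + / 2) - nu)%C).
      { rewrite Ha, Hc. replace (/ 2 - mu) with (- (mu - 1 + / 2)) by field.
        rewrite RtoC_opp. ring. }
      rewrite E2. field. exact Hx0.
Qed.

Lemma exp_34_lim : filterlim (fun x => exp (- (3 / 4 * x))) (Rbar_locally p_infty) (locally 0).
Proof.
  apply (is_lim_comp exp (fun x => - (3 / 4 * x)) p_infty 0 m_infty).
  - apply is_lim_exp_m.
  - intros P [M HM]. exists (- M * 4 / 3). intros v Hv. apply HM. lra.
  - exists 0; intros; discriminate.
Qed.

Lemma jint_decay (f : R -> C) (tau : R) :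
  tame f ->
  exists K, 0 <= K /\ forall x, 1 <= x -> Cmod (jint f tau x) <= K * exp (- (3 / 4 * x)).
Proof.
  intros Hf. destruct (jkernel_cdom f tau 1 Hf Rlt_0_1) as (K & HK).
  exists (4 * Rabs K). split; [pose proof (Rabs_pos K); lra|].
  intros x Hx. eapply Rle_trans; [apply cint_bound, HK, Hx|].
  pose proof (Rle_abs K). pose proof (exp_pos (- (3 / 4 * x))).
  replace (4 * (K * exp (- (3 / 4 * x))) / 1) with (4 * K * exp (- (3 / 4 * x))) by field.
  apply Rmult_le_compat_r; lra.
Qed.

(** For [Re c = 1] the power of [x] has modulus 1. The weight [e^(-x)] cancels the growth [e^x] of
    the first pair, which leaves [e^(-3x/4)]. *)
Lemma wronskian_lim_0 (c : C) (f1 g1 f2 g2 : R -> C) (K : R) :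
  Re c = 1 -> 0 <= K ->
  (forall x, 1 <= x -> Cmod (f1 x) <= K * (exp x * exp (- (3 / 4 * x))) /\
    Cmod (g1 x) <= K * (exp x * exp (- (3 / 4 * x))) /\ Cmod (f2 x) <= K /\ Cmod (g2 x) <= K) ->
  has_clim (wronskian c f1 g1 f2 g2) (Rbar_locally p_infty) 0.
Proof.
  intros Hc HK H.
  apply (has_clim_0_bound _ _ (fun x => 2 * K ^ 2 * exp (- (3 / 4 * x)))).
  - apply (p_infty_intro _ 1). intros x Hx. destruct (H x ltac:(lra)) as (H1 & H2 & H3 & H4).
    unfold wronskian. rewrite !Cmod_mult, Cmod_Rcpow, Re_Cminus, re_RtoC, Hc, Rminus_diag, Rpower_O by lra.
    rewrite Cmod_R, Rabs_pos_eq, Rmult_1_l by (left; apply exp_pos).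
    pose proof (exp_pos x) as He. pose proof (exp_pos (- (3 / 4 * x))) as He'.
    set (E := exp x * exp (- (3 / 4 * x))) in *. assert (HE : 0 < E) by (apply Rmult_lt_0_compat; assumption).
    assert (Hd : Cmod (f1 x * g2 x - f2 x * g1 x) <= 2 * K ^ 2 * E).
    { eapply Rle_trans; [apply Cmod_minus_le|]. rewrite !Cmod_mult.
      pose proof (Cmod_ge_0 (f1 x)). pose proof (Cmod_ge_0 (g1 x)).
      pose proof (Cmod_ge_0 (f2 x)). pose proof (Cmod_ge_0 (g2 x)).
      assert (Cmod (f1 x) * Cmod (g2 x) <= K * E * K) by (apply Rmult_le_compat; assumption).
      assert (Cmod (f2 x) * Cmod (g1 x) <= K * (K * E)) by (apply Rmult_le_compat; assumption).
      replace (2 * K ^ 2 * E) with (K * E * K + K * (K * E)) by ring. lra. }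
    apply Rle_trans with (exp (- x) * (2 * K ^ 2 * E)).
    + apply Rmult_le_compat_l; [left; apply exp_pos|exact Hd].
    + right. unfold E. rewrite exp_Ropp. field. lra.
  - replace 0 with (2 * K ^ 2 * 0) by ring.
    apply (is_lim_scal_l (fun x => exp (- (3 / 4 * x))) (2 * K ^ 2) p_infty 0), exp_34_lim.
Qed.

(** Both functions decay at infinity relative to the growing solution, which forces proportionality;
    comparing their leading asymptotics gives the factor. *)
Lemma kint_jint (mu tau x : R) (nu a c : C) :
  nu = (Ci * RtoC tau)%C -> a = (RtoC (/ 2 - mu) + nu)%C -> c = (1 + 2 * nu)%C ->
  mu <= - 3 / 2 -> 0 < x ->
  (gammaint a * (RtoC (exp x) * Rcpow x (- nu) * jint (hfun mu) tau x))%C =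
  (RtoC (2 * sqrt PI) * kint a (c - a - 1) x)%C.
Proof.
  intros Hnu Ha Hc Hmu Hx.
  pose proof (ksystem_jint mu tau nu a c Hnu Ha Hc) as Sf.
  set (f := fun x => (RtoC (exp x) * Rcpow x (- nu) * jint (hfun mu) tau x)%C) in *.
  set (g := fun x => (a * (RtoC (exp x) * Rcpow x (- nu) * jint (hfun (mu - 1)) tau x))%C) in *.
  assert (Rnu : Re nu = 0) by (rewrite Hnu; simpl; ring).
  assert (Ra : Re a = / 2 - mu) by (rewrite Ha, Re_Cplus, re_RtoC, Rnu; ring).
  assert (Rc : Re c = 1) by (rewrite Hc, Re_Cplus, Re_Cmult, !re_RtoC, Rnu, im_RtoC; ring).
  assert (Ra0 : 0 < Re a) by lra. assert (Ra1 : 1 <= Re a) by lra.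
  assert (Rc02 : 0 < Re c < 2) by lra.
  assert (Hac : (a - c + 1)%C <> 0%C)
    by (apply Re_neq_0; rewrite Re_Cplus, Re_Cminus, re_RtoC; lra).
  pose proof (ksystem_kint a c Ra0) as SI.
  pose proof (ksystem_kummer1 a c (proj1 Rc02) Hac) as S1.
  destruct (wronskian_const _ _ _ _ _ _ Sf SI) as (k0 & W0).
  destruct (wronskian_const _ _ _ _ _ _ SI S1) as (k1 & W1).
  destruct (wronskian_const _ _ _ _ _ _ Sf S1) as (k2 & W2).
  assert (E1 := has_clim_eventually_const (at_right 0) _ _ _
    (at_right_intro _ 1 Rlt_0_1 (fun y Hy => W1 y (proj1 Hy))) (wronskian_kint_kummer1_lim a c Ra1 Rc02 Hac)).
  assert (Hk1 : k1 <> 0%C).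
  { rewrite E1. unfold Cdiv. apply Cmult_neq_0; [apply gammaint_neq_0, Rc02|].
    intros E. apply C1_nz. rewrite <- (Cinv_r _ Hac), E. ring. }
  assert (E0 : k0 = 0%C).
  { destruct (jint_decay (hfun mu) tau (tame_hfun mu)) as (Kf & HKf & Bf).
    destruct (jint_decay (hfun (mu - 1)) tau (tame_hfun (mu - 1))) as (Kg & HKg & Bg).
    destruct (kint_bounded a (c - a - 1) 1 Ra0 Rlt_0_1) as (KI & BI).
    assert (Ra2 : 0 < Re (a + 1)) by (rewrite Re_Cplus, re_RtoC; lra).
    destruct (kint_bounded (a + 1) (c - a - 2) 1 Ra2 Rlt_0_1) as (KI' & BI').
    set (K := Kf + Cmod a * Kg + Rabs KI + Rabs KI').
    pose proof (Cmod_ge_0 a). pose proof (Rabs_pos KI). pose proof (Rabs_pos KI').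
    assert (HaKg : 0 <= Cmod a * Kg) by (apply Rmult_le_pos; assumption).
    assert (HK : 0 <= K) by (unfold K; lra).
    apply (has_clim_eventually_const (Rbar_locally p_infty) _ _ _
      (p_infty_intro _ 0 (fun y Hy => W0 y Hy))).
    apply (wronskian_lim_0 c _ _ _ _ K Rc HK). intros y Hy.
    assert (Hpre : Cmod (RtoC (exp y) * Rcpow y (- nu)) = exp y).
    { rewrite Cmod_mult, Cmod_R, Cmod_Rcpow, Re_Copp, Rnu, Ropp_0, Rpower_O by lra.
      rewrite Rabs_pos_eq by (left; apply exp_pos). ring. }
    pose proof (exp_pos y). pose proof (exp_pos (- (3 / 4 * y))).
    assert (He : 0 < exp y * exp (- (3 / 4 * y))) by (apply Rmult_lt_0_compat; assumption).
    specialize (Bf y Hy). specialize (Bg y Hy). specialize (BI y Hy). specialize (BI' y Hy).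
    pose proof (Rle_abs KI). pose proof (Rle_abs KI').
    repeat split.
    - unfold f. rewrite Cmod_mult, Hpre.
      apply Rle_trans with (exp y * (Kf * exp (- (3 / 4 * y)))); [apply Rmult_le_compat_l; lra|].
      replace (exp y * (Kf * exp (- (3 / 4 * y)))) with (Kf * (exp y * exp (- (3 / 4 * y)))) by ring.
      apply Rmult_le_compat_r; [lra|unfold K; lra].
    - unfold g. rewrite (Cmod_mult a), Cmod_mult, Hpre.
      apply Rle_trans with (Cmod a * (exp y * (Kg * exp (- (3 / 4 * y))))).
      + apply Rmult_le_compat_l; [assumption|]. apply Rmult_le_compat_l; lra.
      + replace (Cmod a * (exp y * (Kg * exp (- (3 / 4 * y))))) with
          (Cmod a * Kg * (exp y * exp (- (3 / 4 * y)))) by ring.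
        apply Rmult_le_compat_r; [lra|unfold K; lra].
    - unfold K; lra.
    - unfold K; lra. }
  (* Dividing by the integral would require that it has no zero. Wronskians with [kummer1] give
     proportionality with constants instead, and [k1] is nonzero by its limit at 0. *)
  assert (EK : forall y, 0 < y -> (f y * k1 = kint a (c - a - 1) y * k2)%C).
  { intros y Hy. rewrite <- (W1 y Hy), <- (W2 y Hy).
    assert (E : (f y * kint (a + 1) (c - a - 2) y - kint a (c - a - 1) y * g y = 0)%C).
    { specialize (W0 y Hy). rewrite E0 in W0. unfold wronskian in W0.
      set (D := (f y * kint (a + 1) (c - a - 2) y - kint a (c - a - 1) y * g y)%C) in *.
      assert (HP : (Rcpow y (c - 1) * RtoC (exp (- y)))%C <> 0%C).
      { apply Cmult_neq_0; [apply Rcpow_neq_0|]. apply RtoC_neq_0. pose proof (exp_pos (- y)). lra. }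
      transitivity (Rcpow y (c - 1) * RtoC (exp (- y)) * D / (Rcpow y (c - 1) * RtoC (exp (- y))))%C.
      - field. split; [|apply Rcpow_neq_0]. apply RtoC_neq_0. pose proof (exp_pos (- y)). lra.
      - rewrite W0. field. split; [|apply Rcpow_neq_0]. apply RtoC_neq_0. pose proof (exp_pos (- y)). lra. }
    unfold wronskian. apply Ceq_minus.
    match goal with |- ?L = _ => transitivity (- (Rcpow y (c - 1) * RtoC (exp (- y)) * kummer1 a c y) *
      (f y * kint (a + 1) (c - a - 2) y - kint a (c - a - 1) y * g y))%C end; [ring|].
    rewrite E. ring. }
  (* After multiplication by [y^a], [f] tends to [2 sqrt PI] by Laplace's method and the integral
     tends to [gammaint a]. *)
  assert (EL : (RtoC (2 * sqrt PI) * k1 = gammaint a * k2)%C).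
  { pose proof (jint_hfun_lim mu tau Hmu) as L1. pose proof (kint_lim_infty a (c - a - 1) Ra0) as L2.
    apply (has_clim_unique (Rbar_locally p_infty) (fun y => Rcpow y a * kint a (c - a - 1) y * k2)%C).
    - apply (has_clim_ext_loc _ (fun y => RtoC (Rpower y (/ 2 - mu) * exp y) * jint (hfun mu) tau y * k1)%C).
      + apply (p_infty_intro _ 0). intros y Hy.
        rewrite <- (Cmult_assoc (Rcpow y a)), <- (EK y Hy). unfold f.
        rewrite Ha, Rcpow_plus, Rcpow_RtoC, Rcpow_opp, RtoC_mult.
        pose proof (Rcpow_neq_0 y nu). field. assumption.
      + apply has_clim_mult; [typeclasses eauto|exact L1|apply has_clim_const; typeclasses eauto].
    - apply has_clim_mult; [typeclasses eauto|exact L2|apply has_clim_const; typeclasses eauto]. }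
  change (gammaint a * f x = RtoC (2 * sqrt PI) * kint a (c - a - 1) x)%C.
  transitivity (gammaint a * (f x * k1) / k1)%C; [field; exact Hk1|].
  rewrite (EK x Hx).
  transitivity (gammaint a * k2 * kint a (c - a - 1) x / k1)%C; [field; exact Hk1|].
  rewrite <- EL. field. exact Hk1.
Qed.

(** What [tricomi a c x] turns out to be at [a = 1/2 - mu + i tau], [c = 1 + 2 i tau]. *)
Definition tricomi_value (mu tau x : R) : C :=
  (RtoC (/ (2 * sqrt PI)) *
    (RtoC (exp x) * Rcpow x (- (Ci * RtoC tau)) * jint (hfun mu) tau x))%C.

(** The filter covers both the value at [c] itself and the limit defining
    Tricomi's function at [c = 1]. *)
Lemma tricomi_nonint_lim (F : (R -> Prop) -> Prop) {FF : ProperFilter F} (n : nat) (mu tau x : R) :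
  has_clim RtoC F 0 -> F (fun t => (1 + 2 * (Ci * RtoC tau) + RtoC t)%C <> 1%C) ->
  mu - INR n <= - 3 / 2 -> 0 < x ->
  has_clim (fun t => tricomi_nonint (RtoC (/ 2 - mu) + Ci * RtoC tau)
    (1 + 2 * (Ci * RtoC tau) + RtoC t) x) F (tricomi_value mu tau x).
Proof.
  intros HF HF1 Hmu Hx.
  assert (Hre : F (fun t => 0 < Re (1 + 2 * (Ci * RtoC tau) + RtoC t) < 2)).
  { eapply filter_imp; [|exact (HF 1 Rlt_0_1)]. intros t Ht. cbv beta in Ht.
    replace (RtoC t - 0)%C with (RtoC t) in Ht by ring. rewrite Cmod_R in Ht.
    apply Rabs_def2 in Ht. simpl. lra. }
  revert mu Hmu. induction n as [n IH] using (well_founded_induction lt_wf). intros mu Hmu.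
  set (nu := (Ci * RtoC tau)%C) in *. set (c := (1 + 2 * nu)%C) in *.
  assert (Rnu : Re nu = 0) by (unfold nu; simpl; ring).
  destruct (Rle_dec mu (- 3 / 2)) as [Hb|Hb].
  - set (a := (RtoC (/ 2 - mu) + nu)%C).
    assert (Ra : Re a = / 2 - mu) by (unfold a; rewrite Re_Cplus, re_RtoC, Rnu; ring).
    pose proof (kint_jint mu tau x nu a c eq_refl eq_refl eq_refl Hb Hx) as E.
    assert (Ra0 : 0 < Re a) by lra.
    (* Off [c = 1] the 1F1 formula equals the integral, which is continuous in the exponent. *)
    apply (has_clim_ext_loc F (fun t => rGamma a * kint a (c - a - 1 + RtoC t) x)%C).
    + eapply filter_imp; [|exact (filter_and _ _ HF1 Hre)]. intros t [H1 H2].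
      rewrite tricomi_nonint_kint by (assumption || lra). f_equal. f_equal. ring.
    + replace (tricomi_value mu tau x) with (rGamma a * kint a (c - a - 1) x)%C.
      * apply has_clim_scal; [typeclasses eauto|].
        apply (kint_lim_param F); [exact Ra0|exact Hx|].
        replace (c - a - 1)%C with (c - a - 1 + 0)%C at 1 by ring.
        apply has_clim_plus; [typeclasses eauto|apply has_clim_const; typeclasses eauto|exact HF].
      * assert (Hpi : 0 < sqrt PI) by apply sqrt_lt_R0, PI_RGT_0.
        assert (Hp0 : RtoC (2 * sqrt PI) <> 0%C) by (apply RtoC_neq_0; lra).
        unfold tricomi_value. fold nu. rewrite RtoC_inv by lra.
        transitivity (rGamma a * (RtoC (2 * sqrt PI) * kint a (c - a - 1) x) / RtoC (2 * sqrt PI))%C;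
          [field; exact Hp0|].
        rewrite <- E.
        transitivity (gammaint a * rGamma a * (RtoC (exp x) * Rcpow x (- nu) * jint (hfun mu) tau x)
          / RtoC (2 * sqrt PI))%C; [field; exact Hp0|].
        rewrite gammaint_rGamma by exact Ra0. field. exact Hp0.
  - destruct n as [|n].
    { simpl in Hmu. lra. }
    rewrite S_INR in Hmu.
    assert (IH1 := IH n ltac:(lia) (mu - 1) ltac:(lra)).
    assert (IH2 := IH n ltac:(lia) (mu - 2) ltac:(lra)).
    set (a := (RtoC (/ 2 - (mu - 1)) + nu)%C) in *.
    replace (RtoC (/ 2 - (mu - 2)) + nu)%C with (a + 1)%C in IH2
      by (unfold a; rewrite !RtoC_minus; ring).
    replace (RtoC (/ 2 - mu) + nu)%C with (a - 1)%C
      by (unfold a; rewrite !RtoC_minus; ring).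
    (* The contiguous relation is applied at the perturbed [c + t], before the limit is taken. *)
    apply (has_clim_ext_loc F (fun t =>
      - (c - 2 * a - RtoC x + RtoC t) * tricomi_nonint a (c + RtoC t) x
      - a * (a - c + 1 - RtoC t) * tricomi_nonint (a + 1) (c + RtoC t) x)%C).
    + eapply filter_imp; [|exact Hre]. intros t Ht.
      pose proof (tricomi_nonint_contiguous a (c + RtoC t) x Ht) as E.
      symmetry. apply Ceq_minus. rewrite <- E. ring.
    + replace (tricomi_value mu tau x) with
        (- (c - 2 * a - RtoC x + 0) * tricomi_value (mu - 1) tau x
         - a * (a - c + 1 - 0) * tricomi_value (mu - 2) tau x)%C.
      * assert (Hc1 : has_clim (fun t => - (c - 2 * a - RtoC x + RtoC t))%C F
          (- (c - 2 * a - RtoC x + 0))%C).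
        { apply (has_clim_ext _ (fun t => - (1) * (c - 2 * a - RtoC x + RtoC t))%C).
          - intros t. ring.
          - replace (- (c - 2 * a - RtoC x + 0))%C with (- (1) * (c - 2 * a - RtoC x + 0))%C by ring.
            apply has_clim_scal; [typeclasses eauto|].
            apply has_clim_plus; [typeclasses eauto|apply has_clim_const; typeclasses eauto|exact HF]. }
        apply has_clim_minus; [typeclasses eauto| |].
        -- apply has_clim_mult; [typeclasses eauto|exact Hc1|exact IH1].
        -- apply has_clim_mult; [typeclasses eauto| |exact IH2].
           apply has_clim_scal; [typeclasses eauto|].
           apply has_clim_minus; [typeclasses eauto|apply has_clim_const; typeclasses eauto|exact HF].
      (* The limiting coefficients are those of the recurrence for [jint], so the proposed values
         satisfy the same relation. *)
      * unfold tricomi_value. fold nu.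
        pose proof (jint_hfun_recurrence (mu - 2) tau x Hx) as ER.
        replace (mu - 2 + 2) with mu in ER by ring. replace (mu - 2 + 1) with (mu - 1) in ER by ring.
        rewrite ER.
        replace (RtoC (tau ^ 2 + (mu - 2 + / 2) ^ 2)) with (a * (a - c + 1 - 0))%C.
        2: { unfold a, c.
             assert (Hnu2 : (nu * nu)%C = RtoC (- tau ^ 2)) by (unfold nu; apply C_ext; simpl; ring).
             transitivity (RtoC (/ 2 - (mu - 1)) * RtoC (/ 2 - (mu - 1)) - nu * nu)%C; [ring|].
             rewrite Hnu2, <- RtoC_mult, <- RtoC_minus. f_equal. field. }
        replace (RtoC (x - 2 * (mu - 2) - 2)) with (- (c - 2 * a - RtoC x + 0))%C.
        2: { unfold a, c. transitivity (RtoC x + 2 * RtoC (/ 2 - (mu - 1)) - 1)%C; [ring|].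
             rewrite <- RtoC_mult, <- RtoC_plus, <- RtoC_minus. f_equal. field. }
        ring.
Qed.

(** [C_lim] at a real point varies only the real part, so a limit over real [t] determines it. *)
Lemma C_lim_eq (f : C -> C) (r : R) (l : C) :
  has_clim (fun t : R => f (t, 0)) (locally' r) l -> C_lim f (RtoC r) = l.
Proof.
  intros H.
  assert (FF : Filter (locally' r))
    by exact (@filter_filter _ _ (Rbar_locally'_filter (Finite r))).
  assert (HR : is_lim (fun t => fst (f (t, 0))) r (fst l)) by exact (has_clim_Re _ _ _ H).
  assert (HI : is_lim (fun t => snd (f (t, 0))) r (snd l)) by exact (has_clim_Im _ _ _ H).
  unfold C_lim. cbn [fst snd RtoC].
  rewrite (is_lim_unique _ _ _ HR), (is_lim_unique _ _ _ HI). symmetry. apply surjective_pairing.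
Qed.

Lemma tricomi_value_eq (mu tau x : R) :
  0 < x ->
  tricomi (RtoC (/ 2 - mu) + Ci * RtoC tau) (1 + 2 * (Ci * RtoC tau)) x = tricomi_value mu tau x.
Proof.
  intros Hx.
  destruct (nfloor_ex (Rabs mu + 2)) as (n & Hn); [pose proof (Rabs_pos mu); lra|].
  assert (Hmu : mu - INR (S n) <= - 3 / 2) by (rewrite S_INR; pose proof (Rle_abs mu); lra).
  unfold tricomi. destruct excluded_middle_informative as [[k Hk]|Hk].
  (* [1 + 2 i tau] is an integer only for [tau = 0]: of the Whittaker functions in the identity,
     only the one outside the series is defined by a limit. *)
  - assert (Ht : tau = 0).
    { apply (f_equal Im) in Hk. simpl in Hk. lra. }
    subst tau. clear Hk k.
    replace (1 + 2 * (Ci * RtoC 0))%C with (RtoC 1) by ring.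
    assert (Hlim : has_clim (fun t => tricomi_nonint (RtoC (/ 2 - mu) + Ci * RtoC 0)
      (1 + 2 * (Ci * RtoC 0) + RtoC t) x) (locally' 0) (tricomi_value mu 0 x)).
    { pose proof (Rbar_locally'_filter (Finite 0) : ProperFilter (locally' 0)) as FF0.
      apply (tricomi_nonint_lim (locally' 0) (S n)); auto.
      - intros eps He. exists (mkposreal eps He). intros t Ht _.
        rewrite <- RtoC_minus, Cmod_R. exact Ht.
      - exists (mkposreal 1 Rlt_0_1). intros t _ Ht E. apply Ht.
        apply (f_equal Re) in E. simpl in E. lra. }
    assert (Hlim1 : has_clim (fun t => tricomi_nonint (RtoC (/ 2 - mu) + Ci * RtoC 0) (t, 0) x)
      (locally' 1) (tricomi_value mu 0 x)).
    { intros eps He. destruct (Hlim eps He) as (d & Hd). exists d.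
      cut (forall t : R, Rabs (t - 1) < d -> t <> 1 -> Cmod (tricomi_nonint
        (RtoC (/ 2 - mu) + Ci * RtoC 0) (t, 0) x - tricomi_value mu 0 x) < eps); [auto|].
      intros t Ht Ht1.
      specialize (Hd (t - 1)). cbv beta in Hd.
      replace (1 + 2 * (Ci * RtoC 0) + RtoC (t - 1))%C with ((t, 0) : C) in Hd
        by (apply C_ext; simpl; ring).
      apply Hd; [|lra].
      change (Rabs (t - 1 - 0) < d). rewrite Rminus_0_r. exact Ht. }
    exact (C_lim_eq (fun c' => tricomi_nonint (RtoC (/ 2 - mu) + Ci * RtoC 0) c' x) 1 _ Hlim1).
  - assert (Ht : tau <> 0).
    { intros ->. apply Hk. exists 1%Z. ring. }
    (* A limit along [at_point 0] is the value at [t = 0]. *)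
    assert (Hlim := tricomi_nonint_lim (at_point 0) (S n) mu tau x).
    assert (Hz : has_clim RtoC (at_point 0) 0).
    { intros eps He. unfold at_point. replace (RtoC 0 - 0)%C with (RtoC 0) by ring.
      now rewrite Cmod_0. }
    assert (H1 : at_point 0 (fun t => (1 + 2 * (Ci * RtoC tau) + RtoC t)%C <> 1%C)).
    { intros E. apply (f_equal Im) in E. simpl in E. apply Ht. lra. }
    specialize (Hlim Hz H1 Hmu Hx).
    refine (has_clim_eventually_const (at_point 0) _ _ _ _ Hlim).
    unfold at_point. replace (1 + 2 * (Ci * RtoC tau) + RtoC 0)%C with (1 + 2 * (Ci * RtoC tau))%C by ring.
    reflexivity.
Qed.

(** The power [x^nu] in [W] cancels [x^(-nu)] in Tricomi's function, so the prefactor does not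
    depend on [tau] and can be taken out of the series. *)
Lemma whittakerW_jint (mu tau x : R) :
  0 < x ->
  whittakerW (RtoC mu) (Ci * RtoC tau) x =
  (RtoC (exp (x / 2) * sqrt x / (2 * sqrt PI)) * jint (hfun mu) tau x)%C.
Proof.
  intros Hx. unfold whittakerW.
  replace (/ 2 + Ci * RtoC tau - RtoC mu)%C with (RtoC (/ 2 - mu) + Ci * RtoC tau)%C
    by (rewrite RtoC_minus, RtoC_inv by lra; ring).
  replace (2 * (Ci * RtoC tau) + 1)%C with (1 + 2 * (Ci * RtoC tau))%C by ring.
  rewrite tricomi_value_eq by exact Hx. unfold tricomi_value.
  assert (Hpi : 0 < sqrt PI) by apply sqrt_lt_R0, PI_RGT_0.
  rewrite Rcpow_plus, Rcpow_opp. pose proof (Rcpow_neq_0 x (Ci * RtoC tau)) as Hn.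
  replace (Rcpow x (/ 2)) with (RtoC (sqrt x)).
  2: { rewrite <- RtoC_inv, Rcpow_RtoC by lra. now rewrite Rpower_sqrt. }
  transitivity (RtoC (exp (- x / 2) * exp x * sqrt x * / (2 * sqrt PI)) * jint (hfun mu) tau x)%C.
  - rewrite !RtoC_mult. field. exact Hn.
  - f_equal. f_equal. rewrite <- exp_plus. replace (- x / 2 + x) with (x / 2) by field.
    unfold Rdiv. ring.
Qed.

Lemma parabolicD_hfun (mu z : R) :
  0 < z ->
  parabolicD (RtoC (2 * mu)) z = (RtoC (Rpower 2 mu * exp (z ^ 2 / 4)) * hfun mu (z ^ 2 / 2))%C.
Proof.
  intros Hz. unfold parabolicD, whittakerW.
  assert (Hu : 0 < z ^ 2 / 2) by (apply Rdiv_lt_0_compat; [apply pow_lt; exact Hz|lra]).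
  replace (RtoC (2 * mu) / 2)%C with (RtoC mu) by (rewrite RtoC_mult; field).
  replace (/ 2 + / 4 - (RtoC mu + / 4))%C with (RtoC (/ 2 - mu))
    by (rewrite RtoC_minus, RtoC_inv by lra; ring).
  replace (2 * / 4 + 1)%C with (RtoC (3 / 2)) by (rewrite RtoC_div by lra; field).
  replace (/ 4 + / 2)%C with (RtoC (3 / 4)) by (rewrite RtoC_div by lra; field).
  replace (RtoC mu + / 4)%C with (RtoC (mu + / 4)) by (rewrite RtoC_plus, RtoC_inv by lra; reflexivity).
  rewrite !Rcpow_RtoC.
  (* The value [c = 3/2] is not an integer. *)
  unfold tricomi. destruct excluded_middle_informative as [[k Hk]|_].
  { exfalso. apply RtoC_inj in Hk. assert (H : IZR (2 * k) = 3) by (rewrite mult_IZR; lra).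
    apply eq_IZR in H. lia. }
  unfold hfun. set (u := z ^ 2 / 2) in *.
  set (U := tricomi_nonint (RtoC (/ 2 - mu)) (RtoC (3 / 2)) u).
  transitivity (RtoC (Rpower 2 (mu + / 4) * Rpower z (- / 2) * exp (- u / 2) * Rpower u (3 / 4)) * U)%C.
  - rewrite !RtoC_mult. ring.
  - replace (z ^ 2 / 4) with (u / 2) by (unfold u; field).
    replace (Rpower 2 (mu + / 4) * Rpower z (- / 2) * exp (- u / 2) * Rpower u (3 / 4)) with
      (Rpower 2 mu * exp (u / 2) * (Rpower u (/ 2) * exp (- u))).
    + rewrite !RtoC_mult. ring.
    + unfold Rpower. rewrite <- !exp_plus. f_equal.
      assert (Hl : ln u = 2 * ln z - ln 2).
      { unfold u. unfold Rdiv. rewrite ln_mult, ln_Rinv by (try lra; apply pow_lt; exact Hz).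
        simpl. rewrite Rmult_1_r, ln_mult by exact Hz. ring. }
      rewrite Hl. field.
Qed.

(** * Poisson summation *)

(** The bound of [sum_f_R0] is inclusive, so the frequencies are [1] to [N + 1]; hence the
    half-integer [N + 3/2] in [dirichlet_sin]. *)
Definition dirichlet (N : nat) (y : R) : R :=
  1 + 2 * sum_f_R0 (fun k => cos (INR (S k) * y)) N.

Definition dirichlet_int (N : nat) (y : R) : R :=
  y + 2 * sum_f_R0 (fun k => sin (INR (S k) * y) / INR (S k)) N.

Lemma is_derive_dirichlet_int (N : nat) (y : R) :
  is_derive (dirichlet_int N) y (dirichlet N y).
Proof.
  unfold dirichlet_int, dirichlet. apply is_derive_Rplus; [apply (is_derive_id (K := R_AbsRing))|].
  assert (H : is_derive (fun y => sum_f_R0 (fun k => sin (INR (S k) * y) / INR (S k)) N) y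
    (sum_f_R0 (fun k => cos (INR (S k) * y)) N)).
  { induction N as [|N IH].
    - simpl. auto_derive; [exact I|]. field.
    - rewrite tech5. apply (is_derive_ext (fun y =>
        sum_f_R0 (fun k => sin (INR (S k) * y) / INR (S k)) N + sin (INR (S (S N)) * y) / INR (S (S N)))).
      { intros t. now rewrite tech5. }
      apply is_derive_Rplus; [exact IH|].
      assert (INR (S (S N)) <> 0) by (apply not_0_INR; lia).
      revert H. generalize (INR (S (S N))). intros r Hr. auto_derive; [exact I|]. field. exact Hr. }
  eapply is_derive_eq.
  - apply (is_derive_Rmult (fun _ => 2)); [|exact H].
    exact (is_derive_const (K := R_AbsRing) (V := R_NormedModule) 2 y).
  - unfold zero; simpl. ring.
Qed.

Lemma dirichlet_continuous (N : nat) (y : R) : continuous (dirichlet N) y.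
Proof.
  unfold dirichlet. apply (continuous_plus (fun _ => 1)); [apply continuous_const|].
  apply (continuous_scal_r 2 (fun y => sum_f_R0 (fun k => cos (INR (S k) * y)) N)).
  induction N as [|N IH].
  - simpl. eapply is_derive_continuous. auto_derive; [exact I|reflexivity].
  - apply (continuous_ext (fun y => sum_f_R0 (fun k => cos (INR (S k) * y)) N + cos (INR (S (S N)) * y))).
    { intros t. now rewrite tech5. }
    apply (continuous_plus (fun y => sum_f_R0 (fun k => cos (INR (S k) * y)) N)); [exact IH|].
    eapply is_derive_continuous, is_derive_cos_scal.
Qed.

Lemma dirichlet_sin (N : nat) (y : R) :
  dirichlet N y * sin (y / 2) = sin ((INR N + 3 / 2) * y).
Proof.
  unfold dirichlet. induction N as [|N IH].
  - simpl. replace (1 * y) with (y / 2 + y / 2) by field.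
    replace ((0 + 3 / 2) * y) with ((y / 2 + y / 2) + y / 2) by field.
    rewrite (sin_plus (y / 2 + y / 2)), cos_plus, sin_plus.
    pose proof (sin2_cos2 (y / 2)) as H. unfold Rsqr in H.
    set (s := sin (y / 2)) in *. set (c := cos (y / 2)) in *.
    replace (c * c) with (1 - s * s) by lra. ring_simplify. replace (c ^ 2) with (1 - s ^ 2) by (simpl; lra). ring.
  - rewrite tech5, Rmult_plus_distr_l, <- Rplus_assoc, Rmult_plus_distr_r, IH.
    rewrite !S_INR. set (r := (INR N + 1 + 1) * y).
    replace ((INR N + 3 / 2) * y) with (r - y / 2) by (unfold r; field).
    replace ((INR N + 1 + 3 / 2) * y) with (r + y / 2) by (unfold r; field).
    rewrite sin_plus, sin_minus. ring.
Qed.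

Lemma dirichlet_even (N : nat) (y : R) : dirichlet N (- y) = dirichlet N y.
Proof.
  unfold dirichlet. f_equal. f_equal. apply sum_eq. intros k _.
  rewrite <- (cos_neg (INR (S k) * y)). f_equal. ring.
Qed.

Lemma dirichlet_period (N : nat) (m : nat) (y : R) :
  dirichlet N (2 * PI * INR m + y) = dirichlet N y.
Proof.
  unfold dirichlet. f_equal. f_equal. apply sum_eq. intros k _.
  rewrite <- (cos_period (INR (S k) * y) (S k * m)). f_equal. rewrite mult_INR. ring.
Qed.

Lemma dirichlet_int_0 (N : nat) : dirichlet_int N 0 = 0.
Proof.
  unfold dirichlet_int. rewrite (sum_eq _ (fun _ => 0)).
  - rewrite sum_cte. ring.
  - intros k _. rewrite Rmult_0_r, sin_0. unfold Rdiv. ring.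
Qed.

Lemma dirichlet_int_PI (N : nat) : dirichlet_int N PI = PI.
Proof.
  unfold dirichlet_int. rewrite (sum_eq _ (fun _ => 0)).
  - rewrite sum_cte. ring.
  - intros k _. replace (sin (INR (S k) * PI)) with 0; [unfold Rdiv; ring|].
    symmetry. apply sin_eq_0_1. exists (Z.of_nat (S k)). now rewrite INR_IZR_INZ.
Qed.

Lemma dirichlet_bound (N : nat) (y : R) : Rabs (dirichlet N y) <= 2 * INR N + 3.
Proof.
  unfold dirichlet.
  assert (H : Rabs (sum_f_R0 (fun k => cos (INR (S k) * y)) N) <= INR N + 1).
  { eapply Rle_trans; [apply Rabs_triang_gen|].
    eapply Rle_trans; [apply (sum_Rle _ (fun _ => 1)); intros; apply Rabs_cos_le|].
    rewrite sum_cte, S_INR. lra. }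
  eapply Rle_trans; [apply Rabs_triang|]. rewrite Rabs_R1, Rabs_mult, (Rabs_pos_eq 2) by lra. lra.
Qed.

Lemma PI_gt_3 : 3 < PI. Proof. pose proof PI2_3_2. lra. Qed.

Lemma sin_half_pos (y : R) : 0 < y <= PI -> 0 < sin (y / 2).
Proof. intros H. apply sin_gt_0; lra. Qed.

(** Comparison of [dirichlet_int] with its limit [PI]: the derivative of
    [dirichlet_int + cos (l t) / (l sin (t/2))] is dominated by that of
    [1 / (l sin (t/2))]. *)
Lemma dirichlet_int_PI_bound (N : nat) (y : R) :
  0 < y <= PI ->
  Rabs (dirichlet_int N y - PI) <= 2 / ((INR N + 3 / 2) * sin (y / 2)).
Proof.
  intros Hy. set (l := INR N + 3 / 2).
  assert (Hl : 0 < l) by (unfold l; pose proof (pos_INR N); lra).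
  (* The signs [e = 1] and [e = -1] give the two halves of an absolute value. [F] below decreases
     since [e cos + 1 >= 0]; the term [sin (l t) / sin (t/2)] cancels the Dirichlet kernel. *)
  assert (Hsgn : forall e, e = 1 \/ e = -1 ->
    e * (dirichlet_int N PI + cos (l * PI) / (l * sin (PI / 2)) -
     (dirichlet_int N y + cos (l * y) / (l * sin (y / 2)))) <=
    / (l * sin (y / 2)) - / (l * sin (PI / 2))).
  { intros e He.
    set (F := fun t => e * (dirichlet_int N t + cos (l * t) / (l * sin (t / 2)))
       + / (l * sin (t / 2))).
    assert (HF : forall t, y <= t <= PI -> is_derive F t
      (- (e * cos (l * t) + 1) * cos (t / 2) / (2 * l * sin (t / 2) ^ 2))).
    { intros t Ht. pose proof (sin_half_pos t ltac:(lra)) as Hs.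
      eapply is_derive_eq.
      - apply is_derive_Rplus; [apply (is_derive_Rmult (fun _ => e)); [|apply is_derive_Rplus]|].
        + exact (is_derive_const (K := R_AbsRing) (V := R_NormedModule) e t).
        + apply is_derive_dirichlet_int.
        + instantiate (1 := - sin (l * t) / sin (t / 2) - cos (l * t) * cos (t / 2) / (2 * l * sin (t / 2) ^ 2)).
          auto_derive; [apply Rgt_not_eq, Rmult_lt_0_compat; assumption|].
          unfold Rdiv in *. field. split; lra.
        + instantiate (1 := - cos (t / 2) / (2 * l * sin (t / 2) ^ 2)).
          auto_derive; [apply Rgt_not_eq, Rmult_lt_0_compat; assumption|].
          unfold Rdiv in *. field. split; lra.
      - pose proof (dirichlet_sin N t) as HD. fold l in HD. rewrite <- HD.
        unfold zero; simpl. field. split; lra. }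
    destruct (MVT_gen F y PI
      (fun t => - (e * cos (l * t) + 1) * cos (t / 2) / (2 * l * sin (t / 2) ^ 2))) as (c & Hc & E).
    - intros t Ht. rewrite Rmin_left, Rmax_right in Ht by lra. apply HF. lra.
    - intros t Ht. rewrite Rmin_left, Rmax_right in Ht by lra.
      apply continuity_pt_filterlim. exact (is_derive_continuous F t _ (HF t Ht)).
    - rewrite Rmin_left, Rmax_right in Hc by lra.
      assert (Hcos : 0 <= cos (c / 2)) by (apply cos_ge_0; lra).
      pose proof (sin_half_pos c ltac:(lra)) as Hs.
      assert (He1 : 0 <= e * cos (l * c) + 1) by (pose proof (COS_bound (l * c)); destruct He; subst; lra).
      assert (0 <= (e * cos (l * c) + 1) * cos (c / 2) / (2 * l * sin (c / 2) ^ 2) * (PI - y)).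
      { apply Rmult_le_pos; [|lra]. apply Rdiv_le_0_compat; [now apply Rmult_le_pos|].
        apply Rmult_lt_0_compat; [lra|now apply pow_lt]. }
      replace (- (e * cos (l * c) + 1) * cos (c / 2) / (2 * l * sin (c / 2) ^ 2) * (PI - y)) with
        (- ((e * cos (l * c) + 1) * cos (c / 2) / (2 * l * sin (c / 2) ^ 2) * (PI - y))) in E
        by (unfold Rdiv; ring).
      unfold F in E. lra. }
  pose proof (sin_half_pos y Hy) as Hs.
  rewrite dirichlet_int_PI, sin_PI2, Rmult_1_r in Hsgn.
  pose proof (Hsgn 1 (or_introl eq_refl)) as H1. pose proof (Hsgn (-1) (or_intror eq_refl)) as H2.
  assert (Hls : 0 < l * sin (y / 2)) by now apply Rmult_lt_0_compat.
  pose proof (Rinv_0_lt_compat _ Hls) as Hi. pose proof (Rinv_0_lt_compat _ Hl) as Hil.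
  unfold Rdiv in *. set (i := / (l * sin (y * / 2))) in *. set (j := / l) in *.
  pose proof (COS_bound (l * y)). pose proof (COS_bound (l * PI)).
  assert (- i <= cos (l * y) * i <= i) by nra.
  assert (- j <= cos (l * PI) * j <= j) by nra.
  apply Rabs_le. lra.
Qed.

Lemma sin_ge_half (x : R) : 0 <= x <= 1 -> x / 2 <= sin x.
Proof.
  intros Hx. destruct (MVT_gen sin 0 x cos) as (c & Hc & E).
  - intros t _. apply is_derive_sin.
  - intros t _. apply continuity_sin.
  - rewrite Rmin_left, Rmax_right in Hc by lra. rewrite sin_0 in E.
    assert (H : cos (PI / 3) <= cos c) by (pose proof PI_gt_3; apply cos_decr_1; lra).
    rewrite cos_PI3 in H. nra.
Qed.

(** Boundedness uniform in [N], across the Gibbs overshoot. Up to [y = 1/l] the derivative is at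
    most [2 l]; beyond it [l sin (y/2) >= 1/4], and [2 / (1/4) = 8]. *)
Lemma dirichlet_int_bounded (N : nat) (y : R) : 0 <= y <= PI -> Rabs (dirichlet_int N y - PI) <= 8.
Proof.
  intros Hy. set (l := INR N + 3 / 2).
  assert (Hl : 1 < l) by (unfold l; pose proof (pos_INR N); lra).
  pose proof PI_4. pose proof PI_gt_3.
  assert (Hil : 0 < / l < 1).
  { split; [apply Rinv_0_lt_compat; lra|]. rewrite <- Rinv_1. apply Rinv_lt_contravar; lra. }
  destruct (Rle_dec y (/ l)) as [H1|H1].
  - pose proof (bounded_variation (dirichlet_int N) (dirichlet N) (2 * l) 0 y) as H2.
    rewrite dirichlet_int_0, !Rminus_0_r in H2.
    assert (H3 : Rabs (dirichlet_int N y) <= 2 * l * Rabs y).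
    { apply H2. intros t _. split; [apply is_derive_dirichlet_int|].
      eapply Rle_trans; [apply dirichlet_bound|]. unfold l. lra. }
    rewrite (Rabs_pos_eq y) in H3 by lra.
    assert (H4 : l * y <= l * / l) by (apply Rmult_le_compat_l; lra). rewrite Rinv_r in H4 by lra.
    unfold Rminus. eapply Rle_trans; [apply Rabs_triang|].
    rewrite Rabs_Ropp, (Rabs_pos_eq PI) by lra. lra.
  - eapply Rle_trans; [apply dirichlet_int_PI_bound; lra|]. fold l.
    assert (H2 : / l / 2 / 2 <= sin (y / 2)).
    { apply Rle_trans with (sin (/ l / 2)); [apply sin_ge_half; lra|].
      apply sin_incr_1; lra. }
    assert (H3 : / 4 <= l * sin (y / 2)).
    { apply Rle_trans with (l * (/ l / 2 / 2)); [right; field; lra|]. apply Rmult_le_compat_l; lra. }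
    apply Rmult_le_reg_r with (l * sin (y / 2)); [lra|].
    unfold Rdiv. rewrite Rmult_assoc, Rinv_l by lra. lra.
Qed.

(** [N0] is chosen before [psi]: this uniformity lets the errors of infinitely many cells be
    added. *)
Lemma dirichlet_int_L1 (eps : R) :
  0 < eps -> exists N0, forall N, (N0 <= N)%nat -> forall (psi : R -> R) (B : R),
    (forall y, continuous psi y) -> (forall y, 0 <= y <= PI -> Rabs (psi y) <= B) ->
    Rabs (RInt (fun y => psi y * (dirichlet_int N y - PI)) 0 PI) <= B * eps.
Proof.
  intros He. pose proof PI_gt_3. pose proof PI_4.
  (* On [[0, th]] the uniform bound 8 contributes at most [B eps / 2]; the rest, of length at most 4
     with integrand at most [B eps / 8], contributes as much again. *)
  set (th := Rmin 1 (eps / 16)).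
  assert (Hth : 0 < th <= 1 /\ th <= eps / 16).
  { split; [split; [apply Rmin_glb_lt; lra|apply Rmin_l]|apply Rmin_r]. }
  pose proof (sin_half_pos th ltac:(lra)) as Hs.
  destruct (nfloor_ex (16 / (eps * sin (th / 2)))) as (N0 & HN0).
  { apply Rdiv_le_0_compat; [lra|]. now apply Rmult_lt_0_compat. }
  exists N0. intros N HN psi B Hc HB.
  assert (HB0 : 0 <= B) by (pose proof (HB 0 ltac:(lra)); pose proof (Rabs_pos (psi 0)); lra).
  assert (Hcont : forall y, continuous (fun y => psi y * (dirichlet_int N y - PI)) y).
  { intros y. apply (continuous_mult (K := R_AbsRing) psi (fun y => dirichlet_int N y - PI)); [apply Hc|].
    apply (continuous_minus (dirichlet_int N) (fun _ => PI)); [|apply continuous_const].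
    eapply is_derive_continuous, is_derive_dirichlet_int. }
  rewrite <- (RInt_Chasles _ 0 th PI) by now apply ex_RInt_cont.
  eapply Rle_trans; [apply Rabs_triang|].
  assert (H1 : Rabs (RInt (fun y => psi y * (dirichlet_int N y - PI)) 0 th) <= (th - 0) * (B * 8)).
  { apply abs_RInt_le_const; [lra|now apply ex_RInt_cont|]. intros t Ht. rewrite Rabs_mult.
    apply Rmult_le_compat; try apply Rabs_pos; [apply HB; lra|apply dirichlet_int_bounded; lra]. }
  assert (H2 : Rabs (RInt (fun y => psi y * (dirichlet_int N y - PI)) th PI) <= (PI - th) * (B * (eps / 8))).
  { apply abs_RInt_le_const; [lra|now apply ex_RInt_cont|]. intros t Ht. rewrite Rabs_mult.
    apply Rmult_le_compat; try apply Rabs_pos; [apply HB; lra|].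
    eapply Rle_trans; [apply dirichlet_int_PI_bound; lra|].
    assert (Hsin : sin (th / 2) <= sin (t / 2)) by (apply sin_incr_1; lra).
    assert (HNl : 16 / (eps * sin (th / 2)) <= INR N + 3 / 2).
    { apply le_INR in HN. lra. }
    assert (Hle : 16 / eps <= (INR N + 3 / 2) * sin (t / 2)).
    { apply Rle_trans with (16 / (eps * sin (th / 2)) * sin (th / 2)); [right; field; lra|].
      apply Rmult_le_compat; try lra. apply Rdiv_le_0_compat; [lra|]. now apply Rmult_lt_0_compat. }
    assert (H16 : 0 < 16 / eps) by (apply Rdiv_lt_0_compat; lra).
    apply Rle_trans with (2 / (16 / eps)).
    - unfold Rdiv at 1 3. apply Rmult_le_compat_l; [lra|]. apply Rinv_le_contravar; assumption.
    - right. field. lra. }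
  assert (H3 : (th - 0) * (B * 8) <= B * (eps / 2)).
  { replace ((th - 0) * (B * 8)) with (B * (th * 8)) by ring. apply Rmult_le_compat_l; lra. }
  assert (H4 : (PI - th) * (B * (eps / 8)) <= 4 * (B * (eps / 8))).
  { apply Rmult_le_compat_r; [apply Rmult_le_pos; lra|lra]. }
  lra.
Qed.

(** Integration by parts against [dirichlet_int N - PI], which vanishes at [PI] and equals [- PI] at
    0, so the boundary term is [PI f(0)]. *)
Lemma dirichlet_half_cell (eps : R) :
  0 < eps -> exists N0, forall N, (N0 <= N)%nat -> forall (f f1 : R -> R) (B : R),
    (forall y, is_derive f y (f1 y)) -> (forall y, continuous f1 y) ->
    (forall y, 0 <= y <= PI -> Rabs (f1 y) <= B) ->
    Rabs (RInt (fun y => f y * dirichlet N y) 0 PI - PI * f 0) <= B * eps.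
Proof.
  intros He. destruct (dirichlet_int_L1 eps He) as (N0 & HN0). exists N0.
  intros N HN f f1 B Hf Hc HB. specialize (HN0 N HN f1 B Hc HB).
  assert (Hfc : forall y, continuous f y) by (intros y; eapply is_derive_continuous, Hf).
  assert (HSc : forall y, continuous (fun y => dirichlet_int N y - PI) y).
  { intros y. apply (continuous_minus (dirichlet_int N) (fun _ => PI)); [|apply continuous_const].
    eapply is_derive_continuous, is_derive_dirichlet_int. }
  assert (E : RInt (fun y => f y * dirichlet N y) 0 PI - PI * f 0 =
    - RInt (fun y => f1 y * (dirichlet_int N y - PI)) 0 PI).
  { assert (H : is_RInt (fun y => f1 y * (dirichlet_int N y - PI) + f y * dirichlet N y) 0 PI
      (f PI * (dirichlet_int N PI - PI) - f 0 * (dirichlet_int N 0 - PI))).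
    { apply (is_RInt_derive (V := R_CompleteNormedModule) (fun y => f y * (dirichlet_int N y - PI))).
      - intros y _. apply (is_derive_Rmult f (fun y => dirichlet_int N y - PI) y (f1 y) (dirichlet N y));
          [apply Hf|].
        eapply is_derive_eq.
        + apply (is_derive_Rminus (dirichlet_int N) (fun _ => PI) y (dirichlet N y) 0).
          * apply is_derive_dirichlet_int.
          * exact (is_derive_const (K := R_AbsRing) (V := R_NormedModule) PI y).
        + ring.
      - intros y _. apply (continuous_plus (fun y => f1 y * (dirichlet_int N y - PI)));
          apply (continuous_mult (K := R_AbsRing)); auto using dirichlet_continuous. }
    rewrite dirichlet_int_PI, dirichlet_int_0 in H.
    apply (is_RInt_unique (V := R_CompleteNormedModule)) in H.
    rewrite (RInt_plus (V := R_CompleteNormedModule) (fun y => f1 y * (dirichlet_int N y - PI))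
      (fun y => f y * dirichlet N y)) in H.
    - unfold plus in H; simpl in H. lra.
    - apply ex_RInt_cont. intros y. apply (continuous_mult (K := R_AbsRing)); auto.
    - apply ex_RInt_cont. intros y. apply (continuous_mult (K := R_AbsRing)); auto using dirichlet_continuous. }
  rewrite E, Rabs_Ropp. exact HN0.
Qed.

Lemma RInt_shift (f : R -> R) (s a b : R) :
  (forall y, continuous f y) -> RInt f (s + a) (s + b) = RInt (fun y => f (s + y)) a b.
Proof.
  intros Hc. pose proof (RInt_comp_lin (V := R_CompleteNormedModule) f 1 s a b) as H.
  replace (1 * a + s) with (s + a) in H by ring. replace (1 * b + s) with (s + b) in H by ring.
  rewrite <- H by now apply ex_RInt_cont. apply RInt_ext. intros x _.
  unfold scal; simpl; unfold mult; simpl. rewrite Rmult_1_l. f_equal. ring.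
Qed.

Lemma RInt_reflect (f : R -> R) (s a b : R) :
  (forall y, continuous f y) -> RInt f (s - b) (s - a) = RInt (fun y => f (s - y)) a b.
Proof.
  intros Hc. pose proof (RInt_comp_lin (V := R_CompleteNormedModule) f (-1) s a b) as H.
  replace (-1 * a + s) with (s - a) in H by ring. replace (-1 * b + s) with (s - b) in H by ring.
  rewrite <- (opp_RInt_swap (V := R_CompleteNormedModule)) by now apply ex_RInt_cont.
  rewrite <- H by now apply ex_RInt_cont.
  rewrite <- (RInt_opp (V := R_CompleteNormedModule)).
  - apply RInt_ext. intros x _. unfold opp, scal; simpl; unfold mult; simpl.
    replace (-1 * x + s) with (s - x) by ring. ring.
  - apply ex_RInt_cont. intros v. apply (continuous_scal_r (-1) (fun v => f (-1 * v + s))).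
    apply (continuous_comp (fun v => -1 * v + s) f); [|apply Hc].
    apply (is_derive_continuous _ _ (-1)). auto_derive; [exact I|ring].
Qed.

Lemma RInt_split2 (f : R -> R) (a b c : R) :
  (forall v, continuous f v) -> RInt f a c = RInt f a b + RInt f b c.
Proof. intros H. symmetry. apply (RInt_Chasles f a b c); now apply ex_RInt_cont. Qed.

Lemma geom_sum_le (r : R) (M : nat) :
  0 <= r < 1 -> sum_f_R0 (fun m => r ^ S m) M <= r / (1 - r).
Proof.
  intros Hr. assert (H : sum_f_R0 (fun m => r ^ S m) M = (r - r ^ S (S M)) / (1 - r)).
  { induction M as [|M IH].
    - simpl. field. lra.
    - rewrite tech5, IH. simpl. field. lra. }
  rewrite H. unfold Rdiv. apply Rmult_le_compat_r; [left; apply Rinv_0_lt_compat; lra|].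
  pose proof (pow_le r (S (S M)) ltac:(lra)). lra.
Qed.

(** The interval is cut into [[0, PI]] and full periods centred at the multiples of [2 PI]. Each
    period splits into two half cells, moved to [[0, PI]] by translation or reflection; [N0] serves
    all [M]. *)
Lemma dirichlet_sum (K d : R) (g g1 : R -> R) (eps : R) :
  0 < eps -> 0 < d -> 0 <= K ->
  (forall y, is_derive g y (g1 y)) -> (forall y, continuous g1 y) ->
  (forall y, Rabs (g1 y) <= K * exp (- d * Rabs y)) ->
  exists N0, forall N, (N0 <= N)%nat -> forall M,
    Rabs (RInt (fun y => g y * dirichlet N y) 0 (2 * PI * INR (S M) + PI) -
      (PI * g 0 + 2 * PI * sum_f_R0 (fun m => g (2 * PI * INR (S m))) M)) <=
    K * eps + 2 * (K * eps * sum_f_R0 (fun m => exp (- d * PI) ^ S m) M).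
Proof.
  intros He Hd HK Hg Hc HB. pose proof PI_gt_3 as HPI.
  destruct (dirichlet_half_cell eps He) as (N0 & HN0). exists N0. intros N HN.
  specialize (HN0 N HN).
  assert (Hgc : forall y, continuous g y) by (intros y; eapply is_derive_continuous, Hg).
  set (F := fun y => g y * dirichlet N y).
  assert (HF : forall y, continuous F y).
  { intros y. apply (continuous_mult (K := R_AbsRing)); [apply Hgc|apply dirichlet_continuous]. }
  assert (H0 : Rabs (RInt F 0 PI - PI * g 0) <= K * eps).
  { apply (HN0 g g1 K Hg Hc). intros y Hy. eapply Rle_trans; [apply HB|].
    rewrite <- (Rmult_1_r K) at 2. apply Rmult_le_compat_l; [exact HK|].
    rewrite <- exp_0. apply exp_le. pose proof (Rabs_pos y). nra. }
  assert (Hcell : forall m, Rabs (RInt F (2 * PI * INR m + PI) (2 * PI * INR (S m) + PI)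
     - 2 * PI * g (2 * PI * INR (S m))) <= 2 * (K * eps * exp (- d * PI) ^ S m)).
  { intros m. set (s := 2 * PI * INR (S m)).
    assert (Hs : s = 2 * PI * INR m + 2 * PI) by (unfold s; rewrite S_INR; ring).
    assert (Hm0 : 0 <= 2 * PI * INR m) by (apply Rmult_le_pos; [lra|apply pos_INR]).
    (* On this cell [|y| >= s - PI >= (m + 1) PI], so the errors decrease geometrically in [m]. *)
    set (Bm := K * exp (- d * PI) ^ S m).
    assert (HBm : forall y, s - PI <= Rabs y -> Rabs (g1 y) <= Bm).
    { intros y Hy. eapply Rle_trans; [apply HB|]. apply Rmult_le_compat_l; [exact HK|].
      rewrite <- (Rpower_pow (S m) (exp (- d * PI))) by apply exp_pos.
      unfold Rpower. rewrite ln_exp. apply exp_le. rewrite S_INR.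
      assert (PI * INR m <= 2 * PI * INR m) by (pose proof (pos_INR m); nra).
      assert ((INR m + 1) * PI <= Rabs y) by lra. nra. }
    replace (2 * PI * INR m + PI) with (s - PI) by lra.
    rewrite (RInt_split2 F (s - PI) s (s + PI)) by exact HF.
    assert (E1 : RInt F (s - PI) s = RInt (fun y => g (s - y) * dirichlet N y) 0 PI).
    { rewrite <- (Rminus_0_r s) at 2. rewrite RInt_reflect by exact HF.
      apply RInt_ext. intros y _. unfold F. f_equal.
      unfold s. unfold Rminus. rewrite dirichlet_period. apply dirichlet_even. }
    assert (E2 : RInt F s (s + PI) = RInt (fun y => g (s + y) * dirichlet N y) 0 PI).
    { rewrite <- (Rplus_0_r s) at 1. rewrite RInt_shift by exact HF.
      apply RInt_ext. intros y _. unfold F. f_equal. apply dirichlet_period. }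
    rewrite E1, E2.
    assert (P1 : Rabs (RInt (fun y => g (s - y) * dirichlet N y) 0 PI - PI * g (s - 0)) <= Bm * eps).
    { apply (HN0 (fun y => g (s - y)) (fun y => - g1 (s - y))).
      - intros y. eapply is_derive_eq.
        + apply (is_derive_comp g (fun y => s - y)); [apply Hg|].
          instantiate (1 := -1). auto_derive; [exact I|ring].
        + unfold scal; simpl; unfold mult; simpl. ring.
      - intros y. apply (continuous_opp (fun y => g1 (s - y))).
        apply (continuous_comp (fun y => s - y) g1); [|apply Hc].
        apply (is_derive_continuous _ _ (-1)). auto_derive; [exact I|ring].
      - intros y Hy. rewrite Rabs_Ropp. apply HBm. rewrite Rabs_pos_eq; lra. }
    assert (P2 : Rabs (RInt (fun y => g (s + y) * dirichlet N y) 0 PI - PI * g (s + 0)) <= Bm * eps).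
    { apply (HN0 (fun y => g (s + y)) (fun y => g1 (s + y))).
      - intros y. eapply is_derive_eq.
        + apply (is_derive_comp g (fun y => s + y)); [apply Hg|].
          instantiate (1 := 1). auto_derive; [exact I|ring].
        + unfold scal; simpl; unfold mult; simpl. ring.
      - intros y. apply (continuous_comp (fun y => s + y) g1); [|apply Hc].
        apply (is_derive_continuous _ _ 1). auto_derive; [exact I|ring].
      - intros y Hy. apply HBm. rewrite Rabs_pos_eq; lra. }
    rewrite Rminus_0_r in P1. rewrite Rplus_0_r in P2.
    set (I1 := RInt (fun y => g (s - y) * dirichlet N y) 0 PI) in *.
    set (I2 := RInt (fun y => g (s + y) * dirichlet N y) 0 PI) in *.
    replace (I1 + I2 - 2 * PI * g s) with ((I1 - PI * g s) + (I2 - PI * g s)) by ring.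
    eapply Rle_trans; [apply Rabs_triang|]. unfold Bm in *.
    lra. }
  induction M as [|M IH].
  - cbn [sum_f_R0]. specialize (Hcell 0%nat). simpl INR at 1 in Hcell.
    replace (2 * PI * 0 + PI) with PI in Hcell by ring.
    rewrite (RInt_split2 F 0 PI) by exact HF.
    match goal with |- Rabs (?a + ?b - (?c + ?e)) <= _ =>
      replace (a + b - (c + e)) with ((a - c) + (b - e)) by ring end.
    eapply Rle_trans; [apply Rabs_triang|]. lra.
  - rewrite !tech5. specialize (Hcell (S M)).
    rewrite (RInt_split2 F 0 (2 * PI * INR (S M) + PI)) by exact HF.
    set (A := RInt F 0 (2 * PI * INR (S M) + PI)) in *.
    set (D := RInt F (2 * PI * INR (S M) + PI) (2 * PI * INR (S (S M)) + PI)) in *.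
    replace (A + D - (PI * g 0 + 2 * PI * (sum_f_R0 (fun m => g (2 * PI * INR (S m))) M
      + g (2 * PI * INR (S (S M)))))) with
      ((A - (PI * g 0 + 2 * PI * sum_f_R0 (fun m => g (2 * PI * INR (S m))) M))
       + (D - 2 * PI * g (2 * PI * INR (S (S M))))) by ring.
    eapply Rle_trans; [apply Rabs_triang|]. lra.
Qed.

Lemma rnice_mult_bounded (K d B : R) (g r : R -> R) :
  rnice K d g -> (forall y, continuous r y) -> (forall y, Rabs (r y) <= B) ->
  rnice (K * B) d (fun y => g y * r y).
Proof.
  intros Hg Hr HB. pose proof (rnice_K_ge_0 _ _ _ Hg) as HK. destruct Hg as (Hc & Hd & H).
  split; [|split; [exact Hd|]].
  - intros y. apply (continuous_mult (K := R_AbsRing)); auto.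
  - intros y. rewrite Rabs_mult. replace (K * B * exp (- d * Rabs y)) with (K * exp (- d * Rabs y) * B) by ring.
    apply Rmult_le_compat; auto using Rabs_pos.
Qed.

Lemma rint_dirichlet (K d : R) (g : R -> R) (N : nat) :
  rnice K d g ->
  rint (fun y => g y * dirichlet N y) =
  rint g + 2 * sum_f_R0 (fun k => rint (fun y => g y * cos (INR (S k) * y))) N.
Proof.
  intros Hg.
  assert (Hcos : forall n, rnice (K * 1) d (fun y => g y * cos (INR n * y))).
  { intros n. apply rnice_mult_bounded; [exact Hg| |].
    - intros y. eapply is_derive_continuous, is_derive_cos_scal.
    - intros y. apply Rabs_cos_le. }
  assert (Hdir : forall M, rnice (K * (2 * INR M + 3)) d (fun y => g y * dirichlet M y)).
  { intros M. apply rnice_mult_bounded; [exact Hg| |].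
    - intros y. apply dirichlet_continuous.
    - intros y. apply dirichlet_bound. }
  induction N as [|N IH].
  - rewrite (rint_ext _ (fun y => 1 * g y + 2 * (g y * cos (INR 1 * y)))).
    + rewrite (rint_lin _ _ _ _ _ _ _ _ Hg (Hcos 1%nat)). cbn [sum_f_R0]. ring.
    + intros y. unfold dirichlet. cbn [sum_f_R0]. ring.
  - rewrite (rint_ext _ (fun y => 1 * (g y * dirichlet N y) + 2 * (g y * cos (INR (S (S N)) * y)))).
    + rewrite (rint_lin _ _ _ _ _ _ _ _ (Hdir N) (Hcos (S (S N)))), IH, tech5. ring.
    + intros y. unfold dirichlet. rewrite tech5. ring.
Qed.

(** The integral of [g] against the Dirichlet kernel is evaluated twice: term by term it is a
    partial sum of the cosine series, cell by cell it is close to the sum of samples. *)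
Lemma poisson_summation (K d : R) (g g1 : R -> R) :
  (forall y, is_derive g y (g1 y)) -> rnice K d g -> rnice K d g1 ->
  (forall y, g (- y) = g y) ->
  exists s t,
    is_series (fun m => g (2 * PI * INR (S m))) s /\
    is_series (fun k => rint (fun y => g y * cos (INR (S k) * y))) t /\
    rint g + 2 * t = 2 * PI * (g 0 + 2 * s).
Proof.
  intros Hder Hg Hg1 Heven. pose proof PI_gt_3 as HPI.
  pose proof (rnice_K_ge_0 _ _ _ Hg) as HK. pose proof Hg as (Hc & Hd & HB).
  pose proof Hg1 as (Hc1 & _ & HB1).
  set (r := exp (- d * PI)).
  assert (Hr : 0 < r < 1).
  { split; [apply exp_pos|]. rewrite <- exp_0. apply exp_increasing. nra. }
  assert (Hex : ex_series (fun m => g (2 * PI * INR (S m)))).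
  { apply (ex_series_le (V := R_CompleteNormedModule) _ (fun m => K * r ^ S m)).
    - intros m. change (Rabs (g (2 * PI * INR (S m))) <= K * r ^ S m).
      eapply Rle_trans; [apply HB|]. apply Rmult_le_compat_l; [exact HK|].
      unfold r. rewrite <- (Rpower_pow (S m) (exp (- d * PI))) by apply exp_pos.
      unfold Rpower. rewrite ln_exp. apply exp_le.
      pose proof (pos_INR (S m)) as Hm.
      assert (0 <= PI * INR (S m)) by (apply Rmult_le_pos; lra).
      assert (0 <= d * (PI * INR (S m))) by (apply Rmult_le_pos; lra).
      rewrite Rabs_pos_eq; lra.
    - apply (ex_series_ext (fun m => (K * r) * r ^ m)).
      + intros m. simpl. ring.
      + apply (ex_series_scal (K := R_AbsRing) (V := R_NormedModule) (K * r)).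
        apply ex_series_geom. rewrite Rabs_pos_eq; lra. }
  set (s := Series (fun m => g (2 * PI * INR (S m)))).
  assert (Hs : is_series (fun m => g (2 * PI * INR (S m))) s) by now apply Series_correct.
  (* The second sum is read off from the identity to be proved; convergence to it is what
     remains. *)
  exists s, ((2 * PI * (g 0 + 2 * s) - rint g) / 2). split; [exact Hs|]. split; [|field].
  change (is_lim_seq (sum_n (fun k => rint (fun y => g y * cos (INR (S k) * y))))
    (Finite ((2 * PI * (g 0 + 2 * s) - rint g) / 2))).
  apply is_lim_seq_spec. intros eps.
  set (C := K + 2 * (K * (r / (1 - r)))).
  assert (HC : 0 <= C).
  { unfold C. assert (0 <= r / (1 - r)) by (apply Rdiv_le_0_compat; lra). nra. }
  assert (He : 0 < eps / (2 * (C + 1))) by (apply Rdiv_lt_0_compat; [apply cond_pos|lra]).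
  destruct (dirichlet_sum K d g g1 _ He Hd HK Hder Hc1 HB1) as (N0 & HN0).
  exists N0. intros N HN. specialize (HN0 N HN). rewrite sum_n_Reals.
  set (e := eps / (2 * (C + 1))) in *.
  assert (Hnice : rnice (K * (2 * INR N + 3)) d (fun y => g y * dirichlet N y)).
  { apply rnice_mult_bounded; [exact Hg| |].
    - intros y. apply dirichlet_continuous.
    - intros y. apply dirichlet_bound. }
  assert (Hmain : Rabs (rint (fun y => g y * dirichlet N y) - 2 * PI * (g 0 + 2 * s)) <= 2 * (C * e)).
  (* [N] is fixed here. [eta] absorbs the truncation of the integral and of the series of samples as
     [M] grows. *)
  { apply Rle_plus_epsilon. intros eta Heta.
    assert (Heta2 : 0 < eta / 2) by lra.
    destruct (rint_near _ _ _ _ Hnice Heta2) as (A & HA).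
    assert (Heta3 : 0 < eta / 2 / (4 * PI)) by (apply Rdiv_lt_0_compat; lra).
    assert (Hs' := proj2 (is_lim_seq_spec (sum_n (fun m => g (2 * PI * INR (S m)))) (Finite s)) Hs
      (mkposreal _ Heta3)).
    destruct Hs' as (M1 & HM1). simpl in HM1.
    destruct (nfloor_ex (Rabs A) (Rabs_pos A)) as (M2 & HM2).
    set (M := Nat.max M1 M2). specialize (HM1 M ltac:(lia)). rewrite sum_n_Reals in HM1.
    set (L := 2 * PI * INR (S M) + PI).
    assert (HL : A <= L).
    { assert (INR M2 <= INR M) by (apply le_INR; lia). unfold L. rewrite S_INR.
      pose proof (Rle_abs A). pose proof (pos_INR M). nra. }
    specialize (HA L L HL HL). specialize (HN0 M). fold L in HN0.
    rewrite RInt_even in HA.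
    2: { apply Hnice. }
    2: { intros y. rewrite Heven, dirichlet_even. reflexivity. }
    pose proof (geom_sum_le r M ltac:(lra)) as Hgeom. fold r in HN0.
    set (I := RInt (fun y => g y * dirichlet N y) 0 L) in *.
    set (sM := sum_f_R0 (fun m => g (2 * PI * INR (S m))) M) in *.
    set (R := rint (fun y => g y * dirichlet N y)) in *.
    assert (Hb : Rabs (I - (PI * g 0 + 2 * PI * sM)) <= C * e).
    { eapply Rle_trans; [exact HN0|]. unfold C.
      assert (K * e * sum_f_R0 (fun m => r ^ S m) M <= K * e * (r / (1 - r))).
      { apply Rmult_le_compat_l; [|exact Hgeom]. apply Rmult_le_pos; lra. }
      lra. }
    assert (Hsm : Rabs (4 * PI * (sM - s)) <= eta / 2).
    { rewrite Rabs_mult, Rabs_pos_eq by lra. left.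
      apply Rmult_lt_compat_l with (r := 4 * PI) in HM1; [|lra].
      replace (4 * PI * (eta / 2 / (4 * PI))) with (eta / 2) in HM1 by (field; lra). exact HM1. }
    replace (R - 2 * PI * (g 0 + 2 * s)) with
      (- (2 * I - R) + (2 * (I - (PI * g 0 + 2 * PI * sM)) + 4 * PI * (sM - s))) by ring.
    eapply Rle_trans; [apply Rabs_triang|]. rewrite Rabs_Ropp.
    eapply Rle_trans; [apply Rplus_le_compat_l, Rabs_triang|].
    rewrite (Rabs_mult 2), (Rabs_pos_eq 2) by lra. lra. }
  rewrite (rint_dirichlet K d g N Hg) in Hmain.
  set (T := sum_f_R0 (fun k => rint (fun y => g y * cos (INR (S k) * y))) N) in *.
  replace (T - (2 * PI * (g 0 + 2 * s) - rint g) / 2) with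
    ((rint g + 2 * T - 2 * PI * (g 0 + 2 * s)) / 2) by field.
  rewrite Rabs_div, (Rabs_pos_eq 2) by lra.
  apply Rle_lt_trans with (C * e); [lra|].
  apply Rlt_le_trans with ((2 * (C + 1)) * e).
  - apply Rmult_lt_compat_r; [exact He|lra].
  - right. unfold e. field. lra.
Qed.

(** * The Poisson identity for the Fourier integral *)

Lemma is_series_C (u : nat -> C) (a b : R) :
  is_series (fun n => Re (u n)) a -> is_series (fun n => Im (u n)) b ->
  is_series u ((a, b) : C).
Proof.
  intros Ha Hb.
  assert (Hsum : forall n, sum_n u n = (sum_n (fun n => Re (u n)) n, sum_n (fun n => Im (u n)) n)).
  { induction n as [|n IH].
    - rewrite !sum_O. apply surjective_pairing.
    - rewrite !sum_Sn, IH. reflexivity. }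
  apply (filterlim_ext (fun n => (sum_n (fun n => Re (u n)) n, sum_n (fun n => Im (u n)) n))).
  { intros n. now rewrite Hsum. }
  intros P [eps HP].
  assert (Ha' : eventually (fun n => ball a eps (sum_n (fun n => Re (u n)) n)))
    by exact (Ha _ (locally_ball a eps)).
  assert (Hb' : eventually (fun n => ball b eps (sum_n (fun n => Im (u n)) n)))
    by exact (Hb _ (locally_ball b eps)).
  unfold filtermap. eapply filter_imp; [|exact (filter_and _ _ Ha' Hb')].
  intros n [H1 H2]. apply HP. split; assumption.
Qed.

(** Poisson summation for [y |-> G (y / alpha)]: samples at multiples of [2 PI] give
    [cosh (PI n / alpha)], and frequency [n] becomes [alpha n] after rescaling. *)
Lemma jint_poisson (mu alpha x : R) :
  0 < alpha -> 0 < x ->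
  exists s t : C,
    is_series (fun n => hfun mu (x * cosh (PI * INR (S n) / alpha) ^ 2)) s /\
    is_series (fun n => jint (hfun mu) (alpha * INR (S n)) x) t /\
    (jint (hfun mu) 0 x + 2 * t = RtoC (2 * PI / alpha) * (hfun mu x + 2 * s))%C.
Proof.
  intros Ha Hx. assert (Hia : 0 < / alpha) by now apply Rinv_0_lt_compat.
  set (G := fun y => hfun mu (x * cosh (y / 2) ^ 2)).
  set (G1 := fun y => (RtoC (th2 y) * theta_hfun mu (x * cosh (y / 2) ^ 2)%R)%C).
  assert (HG : forall y, cderive G y (G1 y)).
  { intros y. apply cderive_xcosh2; [exact Hx|]. intros u Hu. now apply cderive_hfun_theta. }
  assert (NG : cnice G).
  { apply (cnice_ext (jkernel (hfun mu) 0 x)).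
    - intros y. unfold jkernel, G. rewrite Rmult_0_l, cos_0. ring.
    - apply jkernel_cnice; [apply tame_hfun|exact Hx]. }
  assert (NG1 : cnice G1).
  { apply (cnice_ext (fun y => theta_hfun mu (x * cosh (y / 2) ^ 2)%R * RtoC (th2 y))%C).
    - intros y. unfold G1. ring.
    - apply cnice_trig; [apply tame_theta_hfun|exact Hx| |apply th2_bound].
      intros y. eapply is_derive_continuous, is_derive_th2. }
  assert (Geven : forall y, G (- y) = G y).
  { intros y. unfold G. do 2 f_equal. f_equal. unfold cosh.
    replace (- y / 2) with (- (y / 2)) by field. rewrite Ropp_involutive. f_equal. ring. }
  (* Poisson summation is real; [p] stands for [Re] and [Im], so both components are treated at
     once. *)
  assert (Hreal : forall p : C -> R,
    (forall z, Rabs (p z) <= Cmod z) ->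
    (forall f y l, cderive f y l -> is_derive (fun t => p (f t)) y (p l)) ->
    (forall f y, ccontinuous f y -> continuous (fun t => p (f t)) y) ->
    exists s t,
      is_series (fun n => p (hfun mu (x * cosh (PI * INR (S n) / alpha) ^ 2))) s /\
      is_series (fun n => rint (fun y => p (G y) * cos (alpha * INR (S n) * y))) t /\
      rint (fun y => p (G y)) + 2 * t = 2 * PI / alpha * (p (hfun mu x) + 2 * s)).
  { intros p Hp1 Hp2 Hp3.
    destruct NG as (K0 & d0 & N0). destruct NG1 as (K1 & d1 & N1).
    pose proof (cdom_K_ge_0 _ _ _ N0) as HK0. pose proof (cdom_K_ge_0 _ _ _ N1) as HK1.
    set (K := K0 + / alpha * K1). set (d := Rmin d0 d1 * / alpha).
    assert (Hd : 0 < Rmin d0 d1) by (apply Rmin_glb_lt; [apply N0|apply N1]).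
    pose proof (Rmin_l d0 d1) as Hdl. pose proof (Rmin_r d0 d1) as Hdr.
    assert (HaK : 0 <= / alpha * K1) by (apply Rmult_le_pos; lra).
    assert (Hdiv : forall y, continuous (fun y => y / alpha) y).
    { intros y. eapply is_derive_continuous. auto_derive; [exact I|reflexivity]. }
    assert (Hexp : forall d' y, Rmin d0 d1 <= d' ->
      exp (- d' * Rabs (y / alpha)) <= exp (- d * Rabs y)).
    { intros d' y Hd'. apply exp_le. unfold Rdiv. rewrite Rabs_mult, (Rabs_pos_eq (/ alpha)) by lra.
      unfold d. pose proof (Rabs_pos y).
      assert (Rmin d0 d1 * (Rabs y * / alpha) <= d' * (Rabs y * / alpha)).
      { apply Rmult_le_compat_r; [|exact Hd']. apply Rmult_le_pos; lra. }
      lra. }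
    assert (Hn0 : rnice K d (fun y => p (G (y / alpha)))).
    { split; [|split; [apply Rmult_lt_0_compat; assumption|]].
      - intros y. apply (continuous_comp (fun y => y / alpha) (fun y => p (G y))); [apply Hdiv|].
        apply Hp3, N0.
      - intros y. eapply Rle_trans; [apply Hp1|]. destruct N0 as (_ & _ & B0).
        eapply Rle_trans; [apply B0|]. apply Rmult_le_compat; [lra|left; apply exp_pos|unfold K; lra|].
        apply Hexp, Hdl. }
    assert (Hn1 : rnice K d (fun y => / alpha * p (G1 (y / alpha)))).
    { split; [|split; [apply Rmult_lt_0_compat; assumption|]].
      - intros y. apply (continuous_scal_r (/ alpha) (fun y => p (G1 (y / alpha)))).
        apply (continuous_comp (fun y => y / alpha) (fun y => p (G1 y))); [apply Hdiv|].
        apply Hp3, N1.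
      - intros y. rewrite Rabs_mult, (Rabs_pos_eq (/ alpha)) by lra.
        destruct N1 as (_ & _ & B1).
        apply Rle_trans with (/ alpha * (K1 * exp (- d1 * Rabs (y / alpha)))).
        + apply Rmult_le_compat_l; [lra|]. eapply Rle_trans; [apply Hp1|apply B1].
        + rewrite <- Rmult_assoc.
          apply Rmult_le_compat; [lra|left; apply exp_pos|unfold K; lra|]. apply Hexp, Hdr. }
    assert (Hder : forall y, is_derive (fun y => p (G (y / alpha))) y (/ alpha * p (G1 (y / alpha)))).
    { intros y. apply (is_derive_comp (fun y => p (G y)) (fun y => y / alpha)); [apply Hp2, HG|].
      auto_derive; [exact I|]. field. lra. }
    destruct (poisson_summation K d _ _ Hder Hn0 Hn1) as (s & t & Hs & Ht & E).
    { intros y. replace (- y / alpha) with (- (y / alpha)) by (unfold Rdiv; ring). now rewrite Geven. }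
    assert (Hscale : forall f, (exists K' d', rnice K' d' f) ->
      rint (fun y => f (y / alpha)) = alpha * rint f).
    { intros f (K' & d' & Hf).
      rewrite <- (rint_scale_shift K' d' f (/ alpha) 0 Hia Hf).
      assert (Hf' : rnice K' (d' * / alpha) (fun y => f (y / alpha))).
      { pose proof (rnice_K_ge_0 _ _ _ Hf). destruct Hf as (Hfc & Hfd & Hfb).
        split; [|split; [apply Rmult_lt_0_compat; assumption|]].
        - intros y. apply (continuous_comp (fun y => y / alpha) f); [apply Hdiv|apply Hfc].
        - intros y. eapply Rle_trans; [apply Hfb|]. right. f_equal. f_equal.
          unfold Rdiv. rewrite Rabs_mult, (Rabs_pos_eq (/ alpha)) by lra. ring. }
      rewrite (rint_ext (fun v => / alpha * f (/ alpha * v + 0))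
        (fun y => / alpha * f (y / alpha) + 0 * f (y / alpha))).
      - rewrite (rint_lin _ _ _ _ _ _ _ _ Hf' Hf'). field. lra.
      - intros v. replace (/ alpha * v + 0) with (v / alpha) by (unfold Rdiv; ring). ring. }
    assert (Hpn : rnice K0 d0 (fun y => p (G y))).
    { destruct N0 as (C0 & D0 & B0). split; [intros y; apply Hp3, C0|split; [exact D0|]].
      intros y. eapply Rle_trans; [apply Hp1|apply B0]. }
    (* Rescaling [y] multiplies every cosine integral by [alpha]. *)
    exists s, (t / alpha). split; [|split].
    - eapply is_series_ext; [|exact Hs]. intros n. cbv beta. unfold G.
      replace (2 * PI * INR (S n) / alpha / 2) with (PI * INR (S n) / alpha) by (field; lra).
      reflexivity.
    - apply (is_series_ext (fun n => / alpha * rint (fun y => p (G (y / alpha)) * cos (INR (S n) * y)))).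
      + intros n. match goal with |- ?a = ?b => change (@eq R a b) end.
        rewrite (rint_ext (fun y => p (G (y / alpha)) * cos (INR (S n) * y))
          (fun y => (fun z => p (G z) * cos (alpha * INR (S n) * z)) (y / alpha))).
        * rewrite (Hscale (fun z => p (G z) * cos (alpha * INR (S n) * z))); [field; lra|]. exists (K0 * 1), d0.
          apply rnice_mult_bounded; [exact Hpn| |].
          -- intros y. eapply is_derive_continuous, is_derive_cos_scal.
          -- intros y. apply Rabs_cos_le.
        * intros y. f_equal. f_equal. field. lra.
      + replace (t / alpha) with (/ alpha * t) by (unfold Rdiv; ring).
        apply (is_series_scal (K := R_AbsRing) (V := R_NormedModule) (/ alpha)). exact Ht.
    - change (rint (fun y : R => p (G (y / alpha))) + 2 * t = 2 * PI * (p (G (0 / alpha)) + 2 * s)) in E.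
      rewrite (Hscale (fun y => p (G y))) in E by (exists K0, d0; exact Hpn).
      replace (p (G (0 / alpha))) with (p (hfun mu x)) in E.
      + transitivity ((alpha * rint (fun y => p (G y)) + 2 * t) / alpha); [field; lra|].
        rewrite E. field. lra.
      + unfold G. do 2 f_equal. unfold Rdiv. rewrite !Rmult_0_l, cosh_0. ring. }
  destruct (Hreal Re Re_le_Cmod) as (s1 & t1 & Hs1 & Ht1 & E1).
  { intros f y l Hf. apply Hf. }
  { intros f y Hf. apply Hf. }
  destruct (Hreal Im Im_le_Cmod) as (s2 & t2 & Hs2 & Ht2 & E2).
  { intros f y l Hf. apply Hf. }
  { intros f y Hf. apply Hf. }
  assert (Hj : forall tau, jint (hfun mu) tau x =
    (rint (fun y => Re (G y) * cos (tau * y)), rint (fun y => Im (G y) * cos (tau * y)))).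
  { intros tau. unfold jint, cint, jkernel. fold G. f_equal; apply rint_ext; intros y.
    - apply re_scal_r.
    - apply im_scal_r. }
  exists (s1, s2), (t1, t2). split; [|split].
  - now apply is_series_C.
  - apply is_series_C; (eapply is_series_ext; [|eassumption]); intros n; now rewrite Hj.
  - rewrite Hj. apply C_ext.
    + rewrite re_scal_l.
      change (rint (fun y => Re (G y) * cos (0 * y)) + Re (2 * (t1, t2))%C =
        2 * PI / alpha * (Re (hfun mu x) + Re (2 * (s1, s2))%C)).
      rewrite !re_scal_l.
      rewrite (rint_ext _ (fun y => Re (G y))); [exact E1|].
      intros y. rewrite Rmult_0_l, cos_0. ring.
    + rewrite im_scal_l.
      change (rint (fun y => Im (G y) * cos (0 * y)) + Im (2 * (t1, t2))%C =
        2 * PI / alpha * (Im (hfun mu x) + Im (2 * (s1, s2))%C)).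
      rewrite !im_scal_l.
      rewrite (rint_ext _ (fun y => Im (G y))); [exact E2|].
      intros y. rewrite Rmult_0_l, cos_0. ring.
Qed.

(** * The Whittaker and parabolic cylinder series *)

Lemma is_series_C_scal (k : C) (u : nat -> C) (l : C) :
  is_series u l -> is_series (fun n => (k * u n)%C) (k * l)%C.
Proof. exact (is_series_scal (K := C_AbsRing) (V := C_NormedModule) k u l). Qed.

Open Scope C_scope.

Theorem theorem3p1 (alpha x mu : R) (halpha : (0 < alpha)%R) (hx : (0 < x)%R) :
  exists SW SD : C,
    is_series
      (fun n : nat =>
         whittakerW (RtoC mu) (Ci * RtoC (alpha * INR (S n))) x) SW /\
    is_series
      (fun n : nat =>
         RtoC (exp (- (x / 4) * cosh (2 * PI * INR (S n) / alpha)))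
         * parabolicD (RtoC (2 * mu))
             (sqrt (2 * x) * cosh (PI * INR (S n) / alpha))) SD /\
    whittakerW (RtoC mu) (RtoC 0) x + 2 * SW =
      RtoC (Rpower 2 (- mu) * sqrt (PI * x) / alpha)
      * (parabolicD (RtoC (2 * mu)) (sqrt (2 * x))
         + 2 * RtoC (exp (x / 4)) * SD).
Proof.
  destruct (jint_poisson mu alpha x halpha hx) as (s & t & Hs & Ht & E).
  set (kW := RtoC (exp (x / 2) * sqrt x / (2 * sqrt PI))).
  set (kD := RtoC (Rpower 2 mu * exp (x / 4))).
  assert (Hsq : (0 < sqrt (2 * x))%R) by (apply sqrt_lt_R0; lra).
  assert (Hsq2 : (sqrt (2 * x) ^ 2 = 2 * x)%R).
  { simpl. rewrite Rmult_1_r. apply sqrt_sqrt. lra. }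
  assert (HD : forall v, parabolicD (RtoC (2 * mu)) (sqrt (2 * x) * cosh v) =
    RtoC (Rpower 2 mu * exp (x / 2 * cosh v ^ 2)) * hfun mu (x * cosh v ^ 2)).
  { intros v. rewrite parabolicD_hfun.
    - replace ((sqrt (2 * x) * cosh v) ^ 2)%R with (2 * x * cosh v ^ 2)%R
        by (rewrite Rpow_mult_distr, Hsq2; reflexivity).
      replace (2 * x * cosh v ^ 2 / 4)%R with (x / 2 * cosh v ^ 2)%R by field.
      replace (2 * x * cosh v ^ 2 / 2)%R with (x * cosh v ^ 2)%R by field. reflexivity.
    - apply Rmult_lt_0_compat; [exact Hsq|]. pose proof (cosh_ge_1 v). lra. }
  exists (kW * t), (kD * s). split; [|split].
  - apply (is_series_ext (fun n => kW * jint (hfun mu) (alpha * INR (S n)) x)).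
    + intros n. symmetry. now apply whittakerW_jint.
    + now apply is_series_C_scal.
  - apply (is_series_ext (fun n => kD * hfun mu (x * cosh (PI * INR (S n) / alpha) ^ 2)%R)).
    + intros n. rewrite HD, Cmult_assoc. f_equal. unfold kD. rewrite <- RtoC_mult. f_equal.
      set (v := (PI * INR (S n) / alpha)%R).
      replace (2 * PI * INR (S n) / alpha)%R with (v + v)%R by (unfold v, Rdiv; ring).
      (* With this identity the exponential weight of each term combines with the factor
         [exp (x/2 cosh^2 v)] of [D] into [e^(x/4)], independent of [n]. *)
      assert (Hc : (cosh (v + v) = 2 * cosh v ^ 2 - 1)%R).
      { unfold cosh. rewrite Ropp_plus_distr, !exp_plus.
        assert (Hv : (exp v * exp (- v) = 1)%R) by (rewrite <- exp_plus, Rplus_opp_r; apply exp_0).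
        transitivity ((exp v * exp v + exp (- v) * exp (- v)) / 2 + (exp v * exp (- v) - 1))%R;
          [rewrite Hv; field|field]. }
      rewrite Hc.
      replace (x / 4)%R with (- (x / 4) * (2 * cosh v ^ 2 - 1) + x / 2 * cosh v ^ 2)%R at 1 by field.
      rewrite exp_plus. ring.
    + now apply is_series_C_scal.
  - pose proof (HD 0%R) as HD0. rewrite cosh_0, Rmult_1_r in HD0.
    replace (x / 2 * 1 ^ 2)%R with (x / 2)%R in HD0 by field.
    replace (x * 1 ^ 2)%R with x in HD0 by ring. rewrite HD0.
    replace (RtoC 0) with (Ci * RtoC 0) by ring.
    rewrite whittakerW_jint by exact hx. fold kW.
    transitivity (kW * (jint (hfun mu) 0 x + 2 * t)); [ring|]. rewrite E.
    unfold kW, kD.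
    assert (Hpi : (0 < sqrt PI)%R) by apply sqrt_lt_R0, PI_RGT_0.
    assert (Hpp : (sqrt PI * sqrt PI = PI)%R) by (apply sqrt_sqrt; left; apply PI_RGT_0).
    (* Both sides reduce to this value: on the left [2 PI / (2 sqrt PI) = sqrt PI], on the right the
       powers of 2 cancel and two factors [e^(x/4)] make [e^(x/2)]. *)
    transitivity (RtoC (exp (x / 2) * sqrt x * sqrt PI / alpha) * (hfun mu x + 2 * s)).
    + rewrite Cmult_assoc, <- RtoC_mult. f_equal. f_equal.
      rewrite <- Hpp at 2. field. lra.
    + rewrite sqrt_mult by (try (left; apply PI_RGT_0); lra).
      pose proof (exp_pos (mu * ln 2)) as Hp2. change (exp (mu * ln 2)) with (Rpower 2 mu) in Hp2.
      rewrite Rpower_Ropp.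
      replace (RtoC (Rpower 2 mu * exp (x / 2)) * hfun mu x
          + 2 * RtoC (exp (x / 4)) * (RtoC (Rpower 2 mu * exp (x / 4)) * s)) with
        (RtoC (Rpower 2 mu * exp (x / 2)) * (hfun mu x + 2 * s)).
      * rewrite Cmult_assoc, <- RtoC_mult. f_equal. f_equal. field. lra.
      * replace (exp (x / 2)) with (exp (x / 4) * exp (x / 4))%R
          by (rewrite <- exp_plus; f_equal; field).
        rewrite !RtoC_mult. ring.
Qed.
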